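(* Let $N>1$ and let $A=[A(i,j)]_{i,j=1}^N$ be an irreducible non-permutation matrix with entries in $\{0,1\}$. Let $[\mathcal{T}_A]_s$ and $[\mathcal{T}_A]_w$ be the classes in $\operatorname{Ext}_{\operatorname{s}}(\mathcal{O}_A)$ and $\operatorname{Ext}_{\operatorname{w}}(\mathcal{O}_A)$ of the Toeplitz extension $\sigma_{\mathcal{T}_A}$ of the Cuntz--Krieger algebra $\mathcal{O}_A$. Then: (i) $d_s([\mathcal{T}_A]_s)=-\hat{\iota}_A(1)-[1_N]$ in $\mathbb{Z}^N/(I-\widehat{A})\mathbb{Z}^N$; (ii) $d_w([\mathcal{T}_A]_w)=-[1_N]$ in $\mathbb{Z}^N/(I-A)\mathbb{Z}^N$, where $[1_N]$ denotes the class of the vector $(1,\dots,1)\in\mathbb{Z}^N$.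
   Context: $H$ is a separable infinite-dimensional Hilbert space, $Q(H)=B(H)/K(H)$ the Calkin algebra, $\pi:B(H)\to Q(H)$ the quotient map. $I$ is the $N\times N$ identity matrix; integer matrices act on column vectors in $\mathbb{Z}^N$. $R_1$ is the $N\times N$ matrix whose first row is $[1,\dots,1]$ and whose other rows are zero, and $\widehat{A}=A+R_1-AR_1$, so $I-\widehat{A}=(I-A)(I-R_1)$. $\mathcal{O}_A$ is the universal $C^*$-algebra generated by partial isometries $S_1,\dots,S_N$ with $\sum_{j}S_jS_j^*=1$ and $S_i^*S_i=\sum_{j}A(i,j)S_jS_j^*$, $i=1,\dots,N$; put $P_i=S_iS_i^*$. An extension of $\mathcal{O}_A$ is a unital $*$-monomorphism $\tau:\mathcal{O}_A\to Q(H)$; it is trivial if $\tau=\pi\circ\rho$ for a unital $*$-monomorphism $\rho:\mathcal{O}_A\to B(H)$. Extensions $\tau_1,\tau_2$ are strongly equivalent if $\tau_1=\operatorname{Ad}(\pi(U))\circ\tau_2$ for a unitary $U\in B(H)$, weakly equivalent if $\tau_1=\operatorname{Ad}(u)\circ\tau_2$ for a unitary $u\in Q(H)$. $\operatorname{Ext}_{\operatorname{s}}(\mathcal{O}_A)$, $\operatorname{Ext}_{\operatorname{w}}(\mathcal{O}_A)$ are the abelian groups of strong, resp. weak, equivalence classes under direct sum. Fredholm index: $\operatorname{ind}=\dim\operatorname{Ker}-\dim\operatorname{Coker}$. If $e=\pi(E)$ with $E\in B(H)$, $e\in Q(H)$ projections and $x$ is invertible in $eQ(H)e$, then $\operatorname{ind}_e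 x$ is the Fredholm index of any $X\in B(EH)$ with $\pi(X)=x$. For an extension $\sigma$ and a trivial extension $\tau$ with $\tau(P_i)=\sigma(P_i)=:e_i$ for all $i$ (such $\tau$ exists), put $d_i(\sigma,\tau)=\operatorname{ind}_{e_i}\sigma(S_i)\tau(S_i^* )$. Then $d_s([\sigma]_s)$ is the class of $[d_i(\sigma,\tau)]_{i=1}^N$ in $\mathbb{Z}^N/(I-\widehat{A})\mathbb{Z}^N$ and $d_w([\sigma]_w)$ is its class in $\mathbb{Z}^N/(I-A)\mathbb{Z}^N$; both are well defined, independently of $\tau$. $\hat{\iota}_A:\mathbb{Z}\to\mathbb{Z}^N/(I-\widehat{A})\mathbb{Z}^N$ is given by $\hat{\iota}_A(m)=[(I-A)[k_i]_{i=1}^N]$ for any $[k_i]_{i=1}^N\in\mathbb{Z}^N$ with $\sum_{i}k_i=m$. Toeplitz extension: let $\{\xi_1,\dots,\xi_N\}$ be an orthonormal basis of $\mathbb{C}^N$ and $v_0$ a unit vector spanning a one-dimensional Hilbert space $H_0$. In the full Fock space $H_0\oplus\bigoplus_{n\ge1}(\mathbb{C}^N)^{\otimes n}$ let $H_A$ be the closed linear span of $v_0$ and all $\xi_{i_1}\otimes\cdots\otimes\xi_{i_n}$ ($n\ge1$) with $A(i_j,i_{j+1})=1$ for $j=1,\dots,n-1$. Define $T_i\in B(H_A)$ by $T_iv_0=\xi_i$ and $T_i(\xi_{i_1}\otimes\cdots\otimes\xi_{i_n})=\xi_i\otimes\xi_{i_1}\otimes\cdots\otimes\xi_{i_n}$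 if $A(i,i_1)=1$, and $0$ otherwise. The Toeplitz algebra $\mathcal{T}_A$ is $C^*(T_1,\dots,T_N)$. The Toeplitz extension is the unital $*$-monomorphism $\sigma_{\mathcal{T}_A}:\mathcal{O}_A\to Q(H_A)$ with $\sigma_{\mathcal{T}_A}(S_i)=\pi(T_i)$; its classes are denoted $[\mathcal{T}_A]_s$ and $[\mathcal{T}_A]_w$. *)

(* Defs.v *)
From HB Require Import structures.
From mathcomp Require Import all_boot all_order all_algebra.
From mathcomp Require Import generic_quotient ring_quotient.
From mathcomp Require Import all_classical all_reals all_analysis.
From mathcomp Require Import complex.
Set Implicit Arguments.
Unset Strict Implicit.
Unset Printing Implicit Defensive.
Import Order.TTheory GRing.Theory Num.Theory.
Import numFieldNormedType.Exports.
Local Open Scope classical_set_scope.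
Local Open Scope ring_scope.
Local Open Scope quotient_scope.
Local Open Scope complex_scope.

HB.mixin Record hasStar A := { star : A -> A }.

(* This class only provides the operations; the axioms of the star operation
   are part of the class CStarAlg. *)
#[short(type="starAlgType")]
HB.structure Definition StarAlg (R : realType) :=
  {A of GRing.Algebra R[i] A & hasStar A}.

(* The norm is part of the mixin, with completeness in terms of sequences,
   because the hierarchy has no join of normed modules and algebras. *)
HB.mixin Record isCStar (R : realType) A & GRing.Algebra R[i] A & hasStar A := {
  cnorm : A -> R;
  cnorm0_eq0 : forall a : A, cnorm a = 0 -> a = 0;
  cnormD : forall a b : A, cnorm (a + b) <= cnorm a + cnorm b;
  cnormZ : forall (c : R[i]) (a : A), cnorm (c *: a) = complex.Re `|c| * cnorm a;
  cnormM : forall a b : A, cnorm (a * b) <= cnorm a * cnorm b;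
  cnorm_complete : forall u : nat -> A,
    (forall eps : R, 0 < eps -> exists N, forall m n,
       (N <= m)%N -> (N <= n)%N -> cnorm (u m - u n) < eps) ->
    exists a : A, forall eps : R, 0 < eps -> exists N, forall n,
       (N <= n)%N -> cnorm (u n - a) < eps;
  cstarK : forall a : A, star (star a) = a;
  cstarD : forall a b : A, star (a + b) = star a + star b;
  cstarZ : forall (c : R[i]) (a : A), star (c *: a) = c^* *: star a;
  cstarM : forall a b : A, star (a * b) = star b * star a;
  cnorm_star : forall a : A, cnorm (star a * a) = cnorm a ^+ 2
}.

#[short(type="cstarAlgType")]
HB.structure Definition CStarAlg (R : realType) :=
  {A of GRing.Algebra R[i] A & hasStar A & isCStar R A}.

Section StarAlgebra.
Variable R : realType.

Definition projection (A : starAlgType R) (e : A) := e * e = e /\ star e = e.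

Definition unitary (A : starAlgType R) (u : A) :=
  star u * u = 1 /\ u * star u = 1.

Definition partial_isometry (A : starAlgType R) (s : A) := s * star s * s = s.

Definition conjugation (A : starAlgType R) (u x : A) := u * x * star u.

Definition unital_star_hom (A B : starAlgType R) (f : A -> B) :=
  [/\ f 1 = 1,
      forall (c : R[i]) (a b : A), f (c *: a + b) = c *: f a + f b,
      forall a b : A, f (a * b) = f a * f b
    & forall a : A, f (star a) = star (f a)].

Definition unital_star_mono (A B : starAlgType R) (f : A -> B) :=
  unital_star_hom f /\ injective f.

Definition star_subalg (A : starAlgType R) (D : set A) :=
  [/\ D 1,
      forall (c : R[i]) (a b : A), D a -> D b -> D (c *: a + b),
      forall a b : A, D a -> D b -> D (a * b)
    & forall a : A, D a -> D (star a)].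

Definition cnorm_closed (A : cstarAlgType R) (D : set A) :=
  forall a : A, (forall eps : R, 0 < eps ->
    exists2 b, D b & cnorm (a - b) < eps) -> D a.

End StarAlgebra.

HB.mixin Record isHilbert (R : realType) H & CompleteNormedModule R[i] H := {
  inner : H -> H -> R[i];
  inner_linearl : forall (c : R[i]) (x y z : H),
    inner (c *: x + y) z = c * inner x z + inner y z;
  inner_conj : forall x y : H, inner y x = (inner x y)^*;
  inner_norm : forall x : H, inner x x = `|x| ^+ 2;
  hilbert_separable : exists2 D : set H, countable D & dense D;
  hilbert_infinite_dim : forall (n : nat) (b : 'I_n -> H),
    exists x : H, forall c : 'I_n -> R[i], x != \sum_(i < n) c i *: b i
}.

(* All Hilbert spaces are assumed to be separable and of infinite dimension;
   this makes B(H) and Q(H) nonzero, hence instances of algType. *)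
#[short(type="hilbertType")]
HB.structure Definition Hilbert (R : realType) :=
  {H of CompleteNormedModule R[i] H & isHilbert R H}.

Section HilbertSpace.
Variables (R : realType) (H : hilbertType R).

Definition subspace_of (V : set H) :=
  V 0 /\ forall (c : R[i]) (x y : H), V x -> V y -> V (c *: x + y).

Definition closed_span (S : set H) : set H :=
  [set x | forall V : set H, subspace_of V -> closed V -> S `<=` V -> V x].

(* dim V / W = n, for subspaces W of V *)
Definition dim_quotient (V W : set H) (n : nat) :=
  exists b : 'I_n -> H, (forall i, V (b i)) /\
    forall x, V x ->
      exists! c : {ffun 'I_n -> R[i]}, W (x - \sum_(i < n) c i *: b i).

Definition bounded_op (f : H -> H) :=
  linear f /\ exists M : R[i], forall x, `|f x| <= M * `|x|.

Record bop := Bop { bop_fun :> H -> H; bop_subproof : `[< bounded_op bop_fun >] }.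

HB.instance Definition _ := [isSub for bop_fun].
HB.instance Definition _ := [Choice of bop by <:].

Lemma bopP (X : bop) : bounded_op X.
Proof. exact/asboolP/bop_subproof. Qed.

Lemma bop_ext (X Y : bop) : X =1 Y -> X = Y.
Proof. by move=> XY; apply: val_inj; apply/funext. Qed.

HB.instance Definition _ (X : bop) :=
  GRing.isLinear.Build R[i] H H *:%R (bop_fun X) (bopP X).1.

Lemma bounded_op_norm (f : H -> H) : bounded_op f ->
  exists2 M : R[i], 0 <= M & forall x, `|f x| <= M * `|x|.
Proof.
move=> [_ [M fM]]; have [[x x0]|H0] := pselect (exists x : H, x != 0).
  exists M => //; have := le_trans (normr_ge0 _) (fM x).
  by rewrite pmulr_lge0// normr_gt0.
exists 0 => // x; rewrite mul0r.
have x0 : x = 0 by apply/eqP; apply: contra_notT H0 => ?; exists x.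
by rewrite (le_trans (fM x))// x0 normr0 mulr0.
Qed.

Fact bounded_op0 : bounded_op (fun=> 0).
Proof.
split=> [c x y|]; first by rewrite scaler0 addr0.
by exists 0 => x; rewrite normr0 mul0r.
Qed.

Fact bounded_op1 : bounded_op id.
Proof. by split=> //; exists 1 => x; rewrite mul1r. Qed.

Fact bounded_opN (X : bop) : bounded_op (fun x => - X x).
Proof.
split=> [c x y|]; first by rewrite linearP opprD scalerN.
by have [_ [M XM]] := bopP X; exists M => x; rewrite normrN.
Qed.

Fact bounded_opD (X Y : bop) : bounded_op (fun x => X x + Y x).
Proof.
split=> [c x y|]; first by rewrite !linearP scalerDr addrACA.
have [_ [M XM]] := bopP X; have [_ [P YP]] := bopP Y.
by exists (M + P) => x; rewrite mulrDl (le_trans (ler_normD _ _))// lerD.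
Qed.

Fact bounded_opZ (a : R[i]) (X : bop) : bounded_op (fun x => a *: X x).
Proof.
split=> [c x y|]; first by rewrite linearP scalerDr !scalerA mulrC.
have [_ [M XM]] := bopP X; exists (`|a| * M) => x.
by rewrite normrZ -mulrA ler_wpM2l.
Qed.

Fact bounded_opM (X Y : bop) : bounded_op (fun x => X (Y x)).
Proof.
split=> [c x y|]; first by rewrite !linearP.
have [M M0 XM] := bounded_op_norm (bopP X).
have [P P0 YP] := bounded_op_norm (bopP Y).
by exists (M * P) => x; rewrite (le_trans (XM _))// -mulrA ler_wpM2l.
Qed.

Definition bop_zero := Bop (asboolT bounded_op0).
Definition bop_one := Bop (asboolT bounded_op1).
Definition bop_opp X := Bop (asboolT (bounded_opN X)).
Definition bop_add X Y := Bop (asboolT (bounded_opD X Y)).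
Definition bop_scale a X := Bop (asboolT (bounded_opZ a X)).
Definition bop_mul X Y := Bop (asboolT (bounded_opM X Y)).

Fact bop_addA : associative bop_add.
Proof. by move=> X Y Z; apply: bop_ext => x /=; rewrite addrA. Qed.
Fact bop_addC : commutative bop_add.
Proof. by move=> X Y; apply: bop_ext => x /=; rewrite addrC. Qed.
Fact bop_add0 : left_id bop_zero bop_add.
Proof. by move=> X; apply: bop_ext => x /=; rewrite add0r. Qed.
Fact bop_addN : left_inverse bop_zero bop_opp bop_add.
Proof. by move=> X; apply: bop_ext => x /=; rewrite addNr. Qed.

HB.instance Definition _ :=
  GRing.isZmodule.Build bop bop_addA bop_addC bop_add0 bop_addN.

Fact bop_mulA : associative bop_mul.
Proof. by move=> X Y Z; apply: bop_ext. Qed.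
Fact bop_mul1l : left_id bop_one bop_mul.
Proof. by move=> X; apply: bop_ext. Qed.
Fact bop_mul1r : right_id bop_one bop_mul.
Proof. by move=> X; apply: bop_ext. Qed.
Fact bop_mulDl : left_distributive bop_mul +%R.
Proof. by move=> X Y Z; apply: bop_ext. Qed.
Fact bop_mulDr : right_distributive bop_mul +%R.
Proof. by move=> X Y Z; apply: bop_ext => x /=; rewrite raddfD. Qed.

Fact bop_one_neq0 : bop_one != 0.
Proof.
have [x x0] := hilbert_infinite_dim 0 (fun=> 0 : H).
apply/eqP => /(congr1 (fun X : bop => X x)) /= /eqP.
by apply/negP; have := x0 (fun=> 0); rewrite big_ord0.
Qed.

HB.instance Definition _ := GRing.Zmodule_isNzRing.Build bop
  bop_mulA bop_mul1l bop_mul1r bop_mulDl bop_mulDr bop_one_neq0.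

Fact bop_scaleA a b X : bop_scale a (bop_scale b X) = bop_scale (a * b) X.
Proof. by apply: bop_ext => x /=; rewrite scalerA. Qed.
Fact bop_scale1 : left_id 1 bop_scale.
Proof. by move=> X; apply: bop_ext => x /=; rewrite scale1r. Qed.
Fact bop_scaleDr : right_distributive bop_scale +%R.
Proof. by move=> a X Y; apply: bop_ext => x /=; rewrite scalerDr. Qed.
Fact bop_scaleDl X : {morph bop_scale^~ X : a b / a + b}.
Proof. by move=> a b; apply: bop_ext => x /=; rewrite scalerDl. Qed.

HB.instance Definition _ := GRing.Zmodule_isLmodule.Build R[i] bop
  bop_scaleA bop_scale1 bop_scaleDr bop_scaleDl.

Fact bop_scaleAl (a : R[i]) (X Y : bop) : a *: (X * Y) = a *: X * Y.
Proof. exact: bop_ext. Qed.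

HB.instance Definition _ := GRing.Lmodule_isLalgebra.Build R[i] bop bop_scaleAl.

Fact bop_scaleAr (a : R[i]) (X Y : bop) : a *: (X * Y) = X * (a *: Y).
Proof. by apply: bop_ext => x /=; rewrite linearZ. Qed.

HB.instance Definition _ := GRing.Lalgebra_isAlgebra.Build R[i] bop bop_scaleAr.

(* By the Riesz representation theorem the set below is a singleton, so that
   the default value 0 is never used. *)
Definition adjoint (X : bop) : bop :=
  xget 0 [set Y : bop | forall x y : H, inner (X x) y = inner x (Y y)].

HB.instance Definition _ := hasStar.Build bop adjoint.

Definition compact_op (X : bop) := precompact (X @` [set x | `|x| <= 1]).

Definition compact_ops : {pred bop} := fun X => `[< compact_op X >].

Lemma bop_continuous (X : bop) : continuous X.
Proof.
apply: bounded_linear_continuous; apply/linear_boundedP.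
have [M M0 XM] := bounded_op_norm (bopP X).
near=> r => x; rewrite (le_trans (XM x))// ler_wpM2r//.
by near: r; apply: nbhs_pinfty_ge; rewrite ger0_real.
Unshelve. all: by end_near. Qed.

Lemma compact_opS (X : bop) (K : set H) : compact K ->
  (forall x, `|x| <= 1 -> K (X x)) -> compact_op X.
Proof.
move=> cK XK; apply: (precompact_subset (B := K)).
  by move=> _ [x x1 <-]; exact: XK.
by apply: compact_precompact => //; exact: norm_hausdorff.
Qed.

Lemma compact_op_sub (X : bop) x : `|x| <= 1 ->
  closure (X @` [set x | `|x| <= 1]) (X x).
Proof. by move=> x1; apply: subset_closure; exists x. Qed.

Lemma compact_opsP (X : bop) : reflect (compact_op X) (X \in compact_ops).
Proof. exact: asboolP. Qed.

Fact compact_ops_zmod_closed : zmod_closed compact_ops.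
Proof.
split=> [|X Y /compact_opsP + /compact_opsP].
  apply/compact_opsP; apply: (@compact_opS _ [set 0]) => //.
  exact: compact_set1.
rewrite /compact_op !precompactE => cX cY; apply/compact_opsP.
apply: (compact_opS (K := (fun z : H * H => z.1 - z.2) @`
  (closure (X @` [set x | `|x| <= 1]) `*` closure (Y @` [set x | `|x| <= 1])))).
  apply: continuous_compact; last exact: compact_setX.
  apply: continuous_subspaceT => z; exact: cvgB cvg_fst cvg_snd.
by move=> x x1; exists (X x, Y x) => //; split; exact: compact_op_sub.
Qed.

HB.instance Definition _ :=
  GRing.isZmodClosed.Build bop compact_ops compact_ops_zmod_closed.

Fact compact_ops_mull (X Y : bop) : Y \in compact_ops -> X * Y \in compact_ops.
Proof.
move=> /compact_opsP; rewrite /compact_op precompactE => cY; apply/compact_opsP.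
apply: (compact_opS (K := X @` closure (Y @` [set x | `|x| <= 1]))).
  by apply: continuous_compact => //; apply/continuous_subspaceT/bop_continuous.
by move=> x x1; exists (Y x) => //; exact: compact_op_sub.
Qed.

Fact compact_ops_scale (a : R[i]) (X : bop) :
  X \in compact_ops -> a *: X \in compact_ops.
Proof.
have -> : a *: X = (a *: (1 : bop)) * X by apply: bop_ext.
exact: compact_ops_mull.
Qed.

Fact compact_ops_mulr (X Y : bop) : X \in compact_ops -> X * Y \in compact_ops.
Proof.
have [M M0 YM] := bounded_op_norm (bopP Y).
have M1 : 0 < M + 1 by rewrite ltr_wpDl.
have -> : X * Y = ((M + 1) *: X) * ((M + 1)^-1 *: Y).
  apply: bop_ext => x; rewrite /= linearZ /= scalerA divff ?gt_eqF//.
  by rewrite scale1r.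
move=> /(compact_ops_scale (M + 1)) /compact_opsP.
rewrite /compact_op precompactE => cX; apply/compact_opsP.
apply: compact_opS cX _ => x x1; apply: compact_op_sub.
rewrite /= normrZ gtr0_norm ?invr_gt0// mulrC ler_pdivrMr// mul1r.
apply: (le_trans (YM x)); apply: (le_trans (ler_piMr M0 x1)).
by rewrite lerDl.
Qed.

Lemma innerDl (x y z : H) : inner (x + y) z = inner x z + inner y z.
Proof. by have := inner_linearl 1 x y z; rewrite scale1r mul1r. Qed.

Lemma inner0l (z : H) : inner 0 z = 0.
Proof. by apply: (addrI (inner 0 z)); rewrite -innerDl !addr0. Qed.

Lemma innerZl c (x z : H) : inner (c *: x) z = c * inner x z.
Proof. by have := inner_linearl c x 0 z; rewrite inner0l !addr0. Qed.

Lemma innerBl (x y z : H) : inner (x - y) z = inner x z - inner y z.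
Proof. by rewrite innerDl -scaleN1r innerZl mulN1r. Qed.

Lemma innerBr (x y z : H) : inner z (x - y) = inner z x - inner z y.
Proof.
by rewrite (inner_conj (x - y)) innerBl rmorphB (inner_conj x) (inner_conj y).
Qed.

Lemma inner_suml n (x : 'I_n -> H) (z : H) :
  inner (\sum_(i < n) x i) z = \sum_(i < n) inner (x i) z.
Proof.
by elim/big_rec2: _ => [|i a b _ IH]; rewrite ?inner0l// innerDl IH.
Qed.

Lemma orthonormal_extend n (e : nat -> H) :
  (forall i j, (i < n)%N -> (j < n)%N -> inner (e i) (e j) = (i == j)%:R) ->
  exists x, inner x x = 1 /\ forall i, (i < n)%N -> inner x (e i) = 0.
Proof.
move=> eP; have [y yP] := hilbert_infinite_dim n (fun i => e i).
pose z := y - \sum_(i < n) inner y (e i) *: e i.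
have z0 : z != 0 by rewrite subr_eq0 yP.
have ze i : (i < n)%N -> inner z (e i) = 0.
  move=> ltin; rewrite innerBl inner_suml (bigD1 (Ordinal ltin))//= innerZl.
  rewrite eP// eqxx mulr1 big1 ?addr0 ?subrr// => j ji.
  by rewrite innerZl eP// (negbTE (ji : (j : nat) != i)) mulr0.
exists (`|z|^-1 *: z); split=> [|i ltin]; last by rewrite innerZl ze// mulr0.
rewrite inner_norm normrZ normfV normr_id mulVf ?normr_eq0//.
by rewrite expr1n.
Qed.

Lemma orthonormal_sequence :
  exists e : nat -> H, forall i j, inner (e i) (e j) = (i == j)%:R.
Proof.
pose next (s : seq H) : H :=
  xget 0 [set x | inner x x = 1 /\ forall y, y \in s -> inner x y = 0].
pose s := fix s n := if n is n'.+1 then next (s n') :: s n' else [::].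
pose e n := next (s n).
have ms n y : y \in s n -> exists2 i, (i < n)%N & y = e i.
  elim: n => [//|n IH]; rewrite inE => /orP[/eqP->|/IH[i lein ->]].
    by exists n.
  by exists i => //; exact: ltnW.
have sm n i : (i < n)%N -> e i \in s n.
  elim: n => [//|n IH]; rewrite ltnS leq_eqVlt inE => /orP[/eqP->|/IH->].
    by rewrite eqxx.
  by rewrite orbT.
have eP n : (forall i j, (i < n)%N -> (j < n)%N ->
    inner (e i) (e j) = (i == j)%:R) /\ inner (e n) (e n) = 1 /\
    forall i, (i < n)%N -> inner (e n) (e i) = 0.
  elim: n => [|n [IH [en1 en0]]].
    split=> //; rewrite /e /=.
    have [//|x [x1 _]] := @orthonormal_extend 0 (fun=> 0).
    have xP : exists x : H, inner x x = 1 /\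
        forall y, y \in [::] -> inner x y = 0 by exists x.
    by have [] := xgetPex (0 : H) xP.
  have IHn i j : (i < n.+1)%N -> (j < n.+1)%N ->
      inner (e i) (e j) = (i == j)%:R.
    rewrite !ltnS leq_eqVlt => /orP[/eqP->|ltin];
      rewrite leq_eqVlt => /orP[/eqP->|ltjn].
    - by rewrite eqxx.
    - by rewrite en0// gtn_eqF.
    - by rewrite inner_conj en0// conjc0 ltn_eqF.
    - exact: IH.
  split=> //.
  have [x [x1 x0]] := orthonormal_extend IHn.
  have xP : exists x, inner x x = 1 /\
      forall y, y \in s n.+1 -> inner x y = 0.
    by exists x; split=> // y /ms[i ? ->]; exact: x0.
  have [e1 e0] := xgetPex (0 : H) xP.
  by split=> // i /sm; exact: e0.
exists e => i j; have [H1 _] := eP (maxn i j).+1.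
by apply: H1; rewrite ltnS leq_max leqnn ?orbT.
Qed.

Fact compact_ops_proper : (1 : bop) \notin compact_ops.
Proof.
apply/compact_opsP; rewrite /compact_op precompactE => cB.
have [e eP] := orthonormal_sequence.
have e1 n : `|e n| = 1.
  apply/eqP; rewrite -(@pexpr_eq1 _ _ 2)//.
  by rewrite -inner_norm eP eqxx.
have [|p [_ pe]] := cB (e @ \oo) _.
  exists 0%N => // n _; have en1 : `|e n| <= 1 by rewrite e1.
  exact: (@compact_op_sub 1 _ en1).
have half : 0 < 2^-1 :> R[i] by rewrite invr_gt0.
have enp N : exists2 n, (N <= n)%N & `|p - e n| < 2^-1.
  have [] := pe [set e n | n in [set n | (N <= n)%N]] (ball p 2^-1).
  - by exists N => // n Nn; exists n.
  - exact: nbhsx_ballx.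
  - by move=> _ [[n Nn <-]]; rewrite -ball_normE; exists n.
have [n _ pn] := enp 0%N; have [m nm pm] := enp n.+1.
have : `|e n - e m| < 1.
  have -> : e n - e m = (p - e m) - (p - e n) 
    by rewrite opprB [RHS]addrC addrA subrK.
  apply: le_lt_trans (ler_normB _ _) _.
  by rewrite [ltRHS]splitr !div1r ltrD.
rewrite -(@expr_lt1 _ 2)// -inner_norm innerBl !innerBr !eP !eqxx.
rewrite (gtn_eqF nm) (ltn_eqF nm) subr0 sub0r opprK -subr_lt0 addrK.
by rewrite ltr10.
Qed.

Definition calkin := Quotient.quot compact_ops.

HB.instance Definition _ := GRing.Zmodule.on calkin.

Definition calkin_pi (X : bop) : calkin := \pi_calkin X.

Lemma calkin_eqP (X Y : bop) :
  calkin_pi X = calkin_pi Y <-> X - Y \in compact_ops.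
Proof. by rewrite Quotient.idealrBE; split=> [/eqP|/eqP]. Qed.

Lemma calkin_reprK (x : calkin) : calkin_pi (repr x) = x.
Proof. exact: reprK. Qed.

Lemma calkin_ind (P : calkin -> Prop) :
  (forall X, P (calkin_pi X)) -> forall x, P x.
Proof. by move=> PX x; rewrite -(calkin_reprK x). Qed.

Definition calkin_one := calkin_pi 1.
Definition calkin_mul (x y : calkin) := calkin_pi (repr x * repr y).
Definition calkin_scale (c : R[i]) (x : calkin) := calkin_pi (c *: repr x).

Lemma calkin_piD X Y : calkin_pi (X + Y) = calkin_pi X + calkin_pi Y.
Proof. exact: raddfD. Qed.

Lemma calkin_piM X Y :
  calkin_pi (X * Y) = calkin_mul (calkin_pi X) (calkin_pi Y).
Proof.
apply/calkin_eqP; set X' := repr _; set Y' := repr _.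
have XX' : X - X' \in compact_ops by apply/calkin_eqP; rewrite calkin_reprK.
have YY' : Y - Y' \in compact_ops by apply/calkin_eqP; rewrite calkin_reprK.
rewrite -(subrKA (X' * Y)) -mulrBl -mulrBr rpredD//.
  exact: compact_ops_mulr.
exact: compact_ops_mull.
Qed.

Lemma calkin_piZ c X : calkin_pi (c *: X) = calkin_scale c (calkin_pi X).
Proof.
apply/calkin_eqP; rewrite -scalerBr; apply: compact_ops_scale.
by apply/calkin_eqP; rewrite calkin_reprK.
Qed.

Fact calkin_mulA : associative calkin_mul.
Proof.
elim/calkin_ind => X; elim/calkin_ind => Y; elim/calkin_ind => Z.
by rewrite -!calkin_piM mulrA.
Qed.
Fact calkin_mul1l : left_id calkin_one calkin_mul.
Proof. by elim/calkin_ind => X; rewrite -calkin_piM mul1r. Qed.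
Fact calkin_mul1r : right_id calkin_one calkin_mul.
Proof. by elim/calkin_ind => X; rewrite -calkin_piM mulr1. Qed.
Fact calkin_mulDl : left_distributive calkin_mul +%R.
Proof.
elim/calkin_ind => X; elim/calkin_ind => Y; elim/calkin_ind => Z.
by rewrite -calkin_piD -!calkin_piM mulrDl calkin_piD.
Qed.
Fact calkin_mulDr : right_distributive calkin_mul +%R.
Proof.
elim/calkin_ind => X; elim/calkin_ind => Y; elim/calkin_ind => Z.
by rewrite -calkin_piD -!calkin_piM mulrDr calkin_piD.
Qed.
Fact calkin_one_neq0 : calkin_one != 0.
Proof.
apply/eqP => one0; have : calkin_pi 1 = calkin_pi 0.
  by rewrite -/calkin_one one0 /calkin_pi raddf0.
by move/calkin_eqP; rewrite subr0; apply/negP/compact_ops_proper.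
Qed.

HB.instance Definition _ := GRing.Zmodule_isNzRing.Build calkin
  calkin_mulA calkin_mul1l calkin_mul1r calkin_mulDl calkin_mulDr
  calkin_one_neq0.

Fact calkin_scaleA a b x :
  calkin_scale a (calkin_scale b x) = calkin_scale (a * b) x.
Proof. by elim/calkin_ind: x => X; rewrite -!calkin_piZ scalerA. Qed.
Fact calkin_scale1 : left_id 1 calkin_scale.
Proof. by elim/calkin_ind => X; rewrite -calkin_piZ scale1r. Qed.
Fact calkin_scaleDr : right_distributive calkin_scale +%R.
Proof.
move=> a; elim/calkin_ind => X; elim/calkin_ind => Y.
by rewrite -calkin_piD -!calkin_piZ scalerDr calkin_piD.
Qed.
Fact calkin_scaleDl x : {morph calkin_scale^~ x : a b / a + b}.
Proof.
elim/calkin_ind: x => X a b.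
by rewrite -!calkin_piZ scalerDl calkin_piD.
Qed.

HB.instance Definition _ := GRing.Zmodule_isLmodule.Build R[i] calkin
  calkin_scaleA calkin_scale1 calkin_scaleDr calkin_scaleDl.

Fact calkin_scaleAl (a : R[i]) (x y : calkin) : a *: (x * y) = a *: x * y.
Proof.
elim/calkin_ind: x => X; elim/calkin_ind: y => Y.
rewrite /GRing.scale /GRing.mul /=.
by rewrite -calkin_piZ -!calkin_piM -calkin_piZ scalerAl.
Qed.

HB.instance Definition _ :=
  GRing.Lmodule_isLalgebra.Build R[i] calkin calkin_scaleAl.

Fact calkin_scaleAr (a : R[i]) (x y : calkin) : a *: (x * y) = x * (a *: y).
Proof.
elim/calkin_ind: x => X; elim/calkin_ind: y => Y.
rewrite /GRing.scale /GRing.mul /=.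
by rewrite -calkin_piZ -!calkin_piM -calkin_piZ scalerAr.
Qed.

HB.instance Definition _ :=
  GRing.Lalgebra_isAlgebra.Build R[i] calkin calkin_scaleAr.

(* K(H) is closed under adjoints, so this does not depend on the lift. *)
HB.instance Definition _ :=
  hasStar.Build calkin (fun x => calkin_pi (star (repr x))).

(* ind X = k, where X is regarded as an operator on E H (that is, E X E = X) *)
Definition fredholm_index (E X : bop) (k : int) :=
  exists m n : nat,
    [/\ dim_quotient (range E `&` [set x | X x = 0]) [set 0] m,
        dim_quotient (range E) (X @` range E) n
      & k = m%:Z - n%:Z].

Definition corner_index (e x : calkin) : int :=
  xget 0 [set k | exists E X : bop,
    [/\ projection E, calkin_pi E = e, E * X * E = X, calkin_pi X = x
      & fredholm_index E X k]].

End HilbertSpace.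

Section CuntzKrieger.
Variables (N : nat) (A : 'M[int]_N).

Definition zero_one := forall i j, A i j = 0 \/ A i j = 1.

Definition irreducible :=
  forall i j, exists n : nat, (0 < n)%N /\ 0 < (A ^+ n) i j.

Variable R : realType.

Definition ck_family (B : starAlgType R) (S : 'I_N -> B) :=
  [/\ forall i, partial_isometry (S i),
      \sum_j S j * star (S j) = 1
    & forall i, star (S i) * S i = \sum_j (S j * star (S j)) *~ A i j].

(* (O, S) is the universal C*-algebra generated by a Cuntz-Krieger family; the
   homomorphism in the last clause is unique because S generates O. *)
Definition is_ck_algebra (O : cstarAlgType R) (S : 'I_N -> O) :=
  [/\ ck_family S,
      forall D : set O, star_subalg D -> cnorm_closed D ->
        (forall i, D (S i)) -> D = setT
    & forall (B : cstarAlgType R) (T : 'I_N -> B), ck_family T ->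
        exists f : O -> B, unital_star_hom f /\ forall i, f (S i) = T i].

End CuntzKrieger.

Section Extensions.
Variables (R : realType) (O : cstarAlgType R) (H : hilbertType R).

Record extension := Extension {
  extension_fun :> O -> calkin H;
  extension_mono : unital_star_mono extension_fun
}.

Definition trivial_extension (tau : extension) :=
  exists2 rho : O -> bop H,
    unital_star_mono rho & forall a, tau a = calkin_pi (rho a).

Definition strongly_equivalent (tau1 tau2 : extension) :=
  exists2 U : bop H,
    unitary U & forall a, tau1 a = conjugation (calkin_pi U) (tau2 a).

Definition weakly_equivalent (tau1 tau2 : extension) :=
  exists2 u : calkin H, unitary u & forall a, tau1 a = conjugation u (tau2 a).

Definition Ext_s := {c : set extension |
  exists sigma, c = [set tau | strongly_equivalent tau sigma]}.

Definition Ext_w := {c : set extension |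
  exists sigma, c = [set tau | weakly_equivalent tau sigma]}.

Definition class_s (sigma : extension) : Ext_s :=
  exist _ [set tau | strongly_equivalent tau sigma] (ex_intro _ sigma erefl).

Definition class_w (sigma : extension) : Ext_w :=
  exist _ [set tau | weakly_equivalent tau sigma] (ex_intro _ sigma erefl).

End Extensions.

Section Cokernel.
Variables (N : nat) (M : 'M[int]_N).

Definition mx_image : {pred 'cV[int]_N} :=
  fun v => `[< exists w : 'cV[int]_N, v = M *m w >].

Fact mx_image_zmod_closed : zmod_closed mx_image.
Proof.
split=> [|v w /asboolP[v' ->] /asboolP[w' ->]]; apply/asboolP.
  by exists 0; rewrite mulmx0.
by exists (v' - w'); rewrite mulmxBr.
Qed.

HB.instance Definition _ :=
  GRing.isZmodClosed.Build 'cV[int]_N mx_image mx_image_zmod_closed.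

Definition coker := Quotient.quot mx_image.

Definition coker_class (v : 'cV[int]_N) : coker := \pi_coker v.

End Cokernel.

Section IndexMaps.
Variables (N : nat) (A : 'M[int]_N).

Definition first_row_ones : 'M[int]_N := \matrix_(i, j) (i == 0 :> nat)%:R.

Definition hat_mx : 'M[int]_N := A + first_row_ones - A *m first_row_ones.

(* The class does not depend on the choice of k. *)
Definition iota_hat (m : int) : coker (1%:M - hat_mx) :=
  coker_class _ ((1%:M - A) *m
    xget 0 [set k : 'cV[int]_N | \sum_(i < N) k i 0 = m]).

Variables (R : realType) (O : cstarAlgType R) (S : 'I_N -> O).
Variable H : hilbertType R.

Definition index_vector (sigma tau : extension O H) : 'cV[int]_N :=
  \col_i corner_index (sigma (S i * star (S i)))
                      (sigma (S i) * tau (star (S i))).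

(* The common class modulo M of the vectors d(sigma, tau) for sigma in c and
   tau trivial such that tau(P_i) = sigma(P_i) for all i *)
Definition index_class (M : 'M[int]_N) (c : set (extension O H)) : coker M :=
  xget 0 [set q | exists sigma tau : extension O H,
    [/\ c sigma, trivial_extension tau,
        forall i, tau (S i * star (S i)) = sigma (S i * star (S i))
      & q = coker_class M (index_vector sigma tau)]].

Definition d_s (c : Ext_s O H) : coker (1%:M - hat_mx) :=
  index_class (1%:M - hat_mx) (sval c).

Definition d_w (c : Ext_w O H) : coker (1%:M - A) :=
  index_class (1%:M - A) (sval c).

End IndexMaps.

Section Toeplitz.
Variables (N : nat) (A : 'M[int]_N) (R : realType) (H : hilbertType R).

Definition admissible (w : seq 'I_N) := sorted (fun i j => A i j == 1) w.

(* H is the Fock space H_A: e [::] stands for the vacuum vector v_0 and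
   e [:: i_1; ...; i_n] for the tensor product of xi_(i_1), ..., xi_(i_n). *)
Definition fock_basis (e : seq 'I_N -> H) :=
  (forall v w, admissible v -> admissible w -> inner (e v) (e w) = (v == w)%:R)
  /\ closed_span [set e w | w in [set w | admissible w]] = setT.

Definition creation_operators (e : seq 'I_N -> H) (T : 'I_N -> bop H) :=
  forall i w, admissible w ->
    T i (e w) = if admissible (i :: w) then e (i :: w) else 0.

End Toeplitz.

(* Main.v *)
From HB Require Import structures.
Require Import Defs.
From mathcomp Require Import all_boot all_order all_algebra.
From mathcomp Require Import finmap.
From mathcomp Require Import all_classical all_reals all_analysis.
From mathcomp Require Import complex ring lra zify.
Set Implicit Arguments.
Unset Strict Implicit.
Unset Printing Implicit Defensive.
Import Order.TTheory GRing.Theory Num.Theory.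
Import numFieldNormedType.Exports.
Local Open Scope classical_set_scope.
Local Open Scope ring_scope.
Local Open Scope complex_scope.

(** On the Fock space, T i T i^* is the projection F i onto the words that start
    with i.  The empty word starts with no letter, so that, with vac the projection
    onto the vacuum vector, sum_j F j = 1 - vac, and
    T i^* T i = sum_j A(i, j) F j + vac.  The index vector of the Toeplitz extension
    measures these defects.

    Let an extension sigma' = Ad(u) sigma in the class of the Toeplitz extension
    and a trivial extension tau have the same values e i on the range projections,
    and let rho be a representation that lifts tau.  Put V i = rho (S i) and
    E i = V i V i^*, a lift of e i, and let k j be the index of u^* from E j H to
    F j H.  The element sigma' (S i) tau (S i^* ) = u T i u^* V i^* factors through
    [E i -> sum_j A(i, j) E j -> vac + sum_j A(i, j) F j -> F i -> E i].
    Here V i^* and T i are isomorphisms, u^* has index sum_j A(i, j) k j - 1, as it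
    is a direct sum with nothing to map to the vacuum, and u has index - k i.
    The index vector is therefore - (I - A) k - (1, ..., 1), whatever tau is
    ([toeplitz_indices]).  This is (ii).  If u lifts to a unitary, summing over all
    letters gives sum_j k j - 1 = 0, and as I - A and I - hat A agree on vectors
    whose coordinates sum to 0 ([hat_mx_sum0]), this is (i).

    The argument needs the Fredholm index of elements of the Calkin algebra between
    the ranges of two projections.  [has_index] is a purely linear notion of index,
    for which products, direct sums and perturbations of finite rank are
    elementary; [index_compact] is the analytic input, and [eind_exists]
    deduces that the index is defined on the Calkin algebra.

    Since the classes would take a default value if there were no suitable tau, one
    has to be constructed ([trivial_extension_exists]).  Giving the empty word a
    first letter, bijections between infinite sets of words provide a
    Cuntz-Krieger family V on the Fock space, hence a representation of O.  These
    bijections can be chosen to prepend the letter i, as T i does, to the words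
    that end in a given letter z ([letter_bijection]).  Appending to words a path
    to z embeds T into V modulo compact operators, and the extension defined by V is
    injective because sigma is.  This last step compares two homomorphisms on
    generators only, which requires that homomorphisms into the Calkin algebra be
    continuous: small elements have small lifts ([small_lift]). *)

(** * Subspaces of finite codimension *)

Section Codimension.
Variable K : fieldType.

Definition lin_subspace (M : lmodType K) (V : set M) :=
  V 0 /\ forall (c : K) (x y : M), V x -> V y -> V (c *: x + y).

(** Linearity on a subspace only: coordinates modulo a subspace and inverses of
    injective restrictions are not given outside of it. *)
Definition linear_on (M M' : lmodType K) (V : set M) (f : M -> M') :=
  forall (c : K) (x y : M), V x -> V y -> f (c *: x + y) = c *: f x + f y.

(** Finite codimension is witnessed by coordinates on V / W, which restrict,
    compose and can be transported without any choice of complements. *)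
Definition codim (M : lmodType K) (V W : set M) (n : nat) :=
  exists phi : M -> 'rV[K]_n,
    [/\ linear_on V phi, forall x, W x <-> V x /\ phi x = 0
      & forall r, exists2 x, V x & phi x = r].

Section Subspaces.
Variables M : lmodType K.
Implicit Types V W Z : set M.

Lemma subspaceD V x y : lin_subspace V -> V x -> V y -> V (x + y).
Proof. by move=> [_ VP] Vx Vy; rewrite -[x]scale1r; exact: VP. Qed.

Lemma subspaceZ V c x : lin_subspace V -> V x -> V (c *: x).
Proof. by move=> [V0 VP] Vx; rewrite -[_ *: _]addr0; exact: VP. Qed.

Lemma subspaceB V x y : lin_subspace V -> V x -> V y -> V (x - y).
Proof.
by move=> VP Vx Vy; rewrite -scaleN1r; apply: subspaceD => //; exact: subspaceZ.
Qed.

Lemma subspace_sum V n (x : 'I_n -> M) : lin_subspace V -> (forall i, V (x i)) ->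
  V (\sum_(i < n) x i).
Proof.
move=> VP Vx; elim/big_ind: _ => //; first by case: VP.
by move=> y z Vy Vz; exact: subspaceD.
Qed.

Section LinearOn.
Variables (M' : lmodType K) (V : set M) (f : M -> M').
Hypotheses (VP : lin_subspace V) (fP : linear_on V f).

Lemma linear_on0 : f 0 = 0.
Proof.
have [V0 _] := VP; have := fP 1 V0 V0.
by rewrite !scale1r addr0 => /(congr1 (fun z => z - f 0)); rewrite subrr addrK.
Qed.

Lemma linear_onD x y : V x -> V y -> f (x + y) = f x + f y.
Proof. by move=> Vx Vy; have := fP 1 Vx Vy; rewrite !scale1r. Qed.

Lemma linear_onZ c x : V x -> f (c *: x) = c *: f x.
Proof.
by move=> Vx; have [V0 _] := VP; have := fP c Vx V0; rewrite linear_on0 !addr0.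
Qed.

Lemma linear_onB x y : V x -> V y -> f (x - y) = f x - f y.
Proof.
move=> Vx Vy; have VNy : V (- y) by rewrite -scaleN1r; exact: subspaceZ.
by rewrite (linear_onD Vx VNy) -scaleN1r linear_onZ// scaleN1r.
Qed.

Lemma linear_on_sum n (x : 'I_n -> M) : (forall i, V (x i)) ->
  f (\sum_(i < n) x i) = \sum_(i < n) f (x i).
Proof.
move=> Vx; suff: V (\sum_(i < n) x i) /\
    f (\sum_(i < n) x i) = \sum_(i < n) f (x i) by case.
elim/big_rec2: _ => [|i y1 y2 _ [Vy2 IH]].
  by split; [case: VP|exact: linear_on0].
by split; [exact: subspaceD|rewrite linear_onD// IH].
Qed.

Lemma linear_on_ker : lin_subspace (V `&` [set x | f x = 0]).
Proof.
split=> [|c x y [Vx fx] [Vy fy]].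
  by case: VP => V0 _; split => //; exact: linear_on0.
by split; [exact: (proj2 VP)|rewrite /= fP// fx fy scaler0 addr0].
Qed.

Lemma linear_on_image : lin_subspace (f @` V).
Proof.
split=> [|c _ _ [x Vx <-] [y Vy <-]].
  by exists 0; [case: VP|exact: linear_on0].
by exists (c *: x + y); [exact: (proj2 VP)|rewrite fP].
Qed.

End LinearOn.

Lemma sub_linear_on (M' : lmodType K) V W (f : M -> M') :
  W `<=` V -> linear_on V f -> linear_on W f.
Proof. by move=> WV fP c x y /WV ? /WV ?; exact: fP. Qed.

Lemma codim_subspace V W n : lin_subspace V -> codim V W n -> lin_subspace W.
Proof.
move=> VP [phi [phiP WP _]].
have -> : W = V `&` [set x | phi x = 0] by apply/seteqP; split=> x /WP.
exact: linear_on_ker.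
Qed.

Lemma codim_sub V W n : codim V W n -> W `<=` V.
Proof. by move=> [phi [_ WP _]] x /WP[]. Qed.

End Subspaces.

(** A subspace is the row space of a matrix of maximal rank among those whose
    row space it contains. *)
Lemma row_subspace n (S : set 'rV[K]_n) : lin_subspace S ->
  exists B : 'M[K]_n, forall v, S v <-> (v <= B)%MS.
Proof.
move=> SP.
pose P k := `[< exists2 B : 'M[K]_n, \rank B = k & forall v, (v <= B)%MS -> S v >].
have exP : exists k, P k.
  exists 0%N; apply/asboolP; exists 0; first exact: mxrank0.
  by move=> v; rewrite submx0 => /eqP->; case: SP.
have leP k : P k -> (k <= n)%N.
  by move=> /asboolP[B <- _]; exact: rank_leq_row.
case: (ex_maxnP exP leP) => k /asboolP[B rkB BS] maxB.
exists B => v; split=> [Sv|]; last exact: BS.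
have : (\rank (B + v)%MS <= \rank B)%N.
  rewrite rkB; apply: maxB; apply/asboolP; exists (B + v)%MS => // u.
  move=> /sub_addsmxP[[u1 u2] /= ->]; apply: subspaceD => //.
    by apply: BS; exact: submxMl.
  by rewrite [u2]mx11_scalar mul_scalar_mx; exact: subspaceZ.
move=> rk; have := mxrank_leqif_sup (addsmxSl B v) => /leqifP.
case: ifP => [le _|_]; last by rewrite ltnNge rk.
exact: submx_trans (addsmxSr _ _) le.
Qed.

Section Codim.
Variables M : lmodType K.
Implicit Types V W Z : set M.

(** A linear map to a finite-dimensional space need not be onto: its kernel
    still has finite codimension, the dimension of its image. *)
Lemma codim_ker V W n (phi : M -> 'rV[K]_n) : lin_subspace V ->
  linear_on V phi -> (forall x, W x <-> V x /\ phi x = 0) ->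
  exists m, codim V W m.
Proof.
move=> VP phiP WP.
have [B BP] := row_subspace (linear_on_image VP phiP).
pose chi x := phi x *m pinvmx (row_base B).
have BK v : (v <= B)%MS -> v *m pinvmx (row_base B) *m row_base B = v.
  by move=> vB; rewrite mulmxKpV// eq_row_base.
exists (\rank B), chi; split=> [c x y Vx Vy|x|r].
- by rewrite /chi phiP// mulmxDl scalemxAl.
- rewrite WP; split=> [[Vx phix]|[Vx chix]]; split=> //.
    by rewrite /chi phix mul0mx.
  rewrite -[phi x]BK ?[phi x *m _]chix ?mul0mx//.
  by apply/BP; exists x.
- have /BP[x Vx phix] : (r *m row_base B <= B)%MS.
    by rewrite (submx_trans (submxMl _ _))// eq_row_base.
  by exists x => //; rewrite /chi phix mulmxKp// row_base_free.
Qed.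

(** A linear section of the coordinate map of a quotient. *)
Lemma codim_section V n (phi : M -> 'rV[K]_n) : lin_subspace V ->
  linear_on V phi -> (forall r, exists2 x, V x & phi x = r) ->
  exists s : 'rV[K]_n -> M,
    [/\ linear s, forall r, V (s r) & forall r, phi (s r) = r].
Proof.
move=> VP phiP phi_onto.
pose v i := projT1 (cid2 (phi_onto (delta_mx 0 i))).
have Vv i : V (v i) by rewrite /v; case: cid2.
have phiv i : phi (v i) = delta_mx 0 i by rewrite /v; case: cid2.
exists (fun r => \sum_i r 0 i *: v i); split=> [c r r'|r|r].
- rewrite scaler_sumr -big_split; apply: eq_bigr => i _ /=.
  by rewrite !mxE scalerDl scalerA.
- by apply: subspace_sum => // i; exact: subspaceZ.
- rewrite (linear_on_sum VP)//; last by move=> i; exact: subspaceZ.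
  rewrite [RHS]row_sum_delta; apply: eq_bigr => i _.
  by rewrite (linear_onZ VP)// phiv.
Qed.

(** With s a section of the coordinates phi on V / W, the vector x - s (phi x)
    lies in W and has coordinates on W / Z. *)
Lemma codim_trans V W Z m n : lin_subspace V -> codim V W m -> codim W Z n ->
  codim V Z (m + n).
Proof.
move=> VP VW WZ; have WP := codim_subspace VP VW.
have [phi [phiP phiW phi_onto]] := VW; have [psi [psiP psiZ psi_onto]] := WZ.
have [s [sP Vs sK]] := codim_section VP phiP phi_onto.
have Wx x : V x -> W (x - s (phi x)).
  move=> Vx; apply/phiW; split; first exact: subspaceB.
  by rewrite (linear_onB VP)// sK subrr.
have s0 : s 0 = 0.
  by have := sP (-1) 0 0; rewrite scaler0 addr0 => ->; rewrite scaleN1r addNr.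
exists (fun x => row_mx (phi x) (psi (x - s (phi x)))); split=> [c x y Vx Vy|x|r].
- rewrite phiP// sP scale_row_mx add_row_mx; congr row_mx.
  rewrite -psiP; [|exact: Wx..].
  by rewrite scalerBr addrACA opprD.
- rewrite psiZ; split=> [[/phiW[Vx phix] psix]|[Vx]].
    by split=> //; rewrite phix s0 subr0 psix row_mx0.
  rewrite -row_mx0 => /eq_row_mx[phix]; rewrite phix s0 subr0 => psix.
  by split=> //; apply/phiW.
- have [y Wy psiy] := psi_onto (rsubmx r).
  have [Vy phiy] := (phiW y).1 Wy.
  exists (s (lsubmx r) + y); first exact: subspaceD.
  rewrite (linear_onD phiP)// sK phiy addr0 [_ + y]addrC addrK psiy.
  exact: hsubmxK.
Qed.

Lemma codim_capl V V' W n : lin_subspace V -> lin_subspace V' -> V' `<=` V ->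
  codim V W n -> exists m, codim V' (V' `&` W) m.
Proof.
move=> VP V'P V'V [phi [phiP WP _]].
apply: (codim_ker (phi := phi)) => //; first exact: sub_linear_on phiP.
move=> x; split=> [[V'x /WP[]]//|[V'x phix]]; split=> //.
by apply/WP; split=> //; exact: V'V.
Qed.

Lemma codim_between V W Z n : lin_subspace V -> lin_subspace W ->
  Z `<=` W -> W `<=` V -> codim V Z n -> exists m, codim V W m.
Proof.
move=> VP WP ZW WV [phi [phiP ZP _]].
have [B BP] := row_subspace (linear_on_image WP (sub_linear_on WV phiP)).
apply: (codim_ker (phi := fun x => phi x *m cokermx B)) => //.
  by move=> c x y Vx Vy; rewrite phiP// mulmxDl scalemxAl.
move=> x; split=> [Wx|[Vx]].
  split; first exact: WV.
  by apply/eqP; rewrite -submxE; apply/BP; exists x.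
move/eqP; rewrite -submxE => /BP[y Wy phiyx].
rewrite -[x](subrK y); apply: subspaceD => //; apply/ZW/ZP.
have Vy := WV _ Wy.
by split; [exact: subspaceB|rewrite (linear_onB VP)// phiyx subrr].
Qed.

(** Coordinates on V / W' are injective on the image of a section of V / W. *)
Lemma codim_le V W W' m n : lin_subspace V -> W' `<=` W ->
  codim V W m -> codim V W' n -> (m <= n)%N.
Proof.
move=> VP W'W [phi [phiP WP phi_onto]] [psi [psiP W'P _]].
have [s [sP Vs sK]] := codim_section VP phiP phi_onto.
have lP : linear (psi \o s) by move=> c r r' /=; rewrite sP psiP.
pose lS := GRing.isLinear.Build _ _ _ _ _ lP.
pose l : {linear 'rV[K]_m -> 'rV[K]_n} := HB.pack (psi \o s) lS.
suff : row_free (lin1_mx l).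
  by rewrite /row_free => /eqP <-; exact: rank_leq_col.
apply/inj_row_free => r; rewrite mul_rV_lin1 /= => psis.
have : W' (s r) by apply/W'P.
by move=> /W'W /WP[_]; rewrite sK.
Qed.

Lemma codim_inj V W m n : lin_subspace V -> codim V W m -> codim V W n -> m = n.
Proof.
move=> VP Wm Wn; apply/eqP; rewrite eqn_leq.
by rewrite (codim_le VP _ Wm Wn)//= (codim_le VP _ Wn Wm).
Qed.

Lemma codim_refl V : lin_subspace V -> codim V V 0.
Proof.
move=> VP; exists (fun=> 0); split=> [c x y _ _|x|r].
- by rewrite scaler0 addr0.
- by split=> [|[]].
- by exists 0; [case: VP|apply/rowP; case].
Qed.

End Codim.

Lemma codim_image (M M' : lmodType K) (V W : set M) (f : M -> M') n :
  lin_subspace V -> linear_on V f -> {in V &, injective f} -> W `<=` V ->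
  codim V W n -> codim (f @` V) (f @` W) n.
Proof.
move=> VP fP f_inj WV [phi [phiP WP phi_onto]].
have ex y : exists x, (f @` V) y -> V x /\ f x = y.
  by have [[x Vx <-]|?] := pselect ((f @` V) y); [exists x|exists 0].
pose g y := projT1 (cid (ex y)).
have gP y : (f @` V) y -> V (g y) /\ f (g y) = y by rewrite /g; case: cid.
have gK x : V x -> g (f x) = x.
  move=> Vx; have [Vg fg] : V (g (f x)) /\ f (g (f x)) = f x by apply: gP; exists x.
  by apply: f_inj => //; rewrite inE.
exists (phi \o g); split=> [c _ _ [x Vx <-] [y Vy <-]|y|r] /=.
- by rewrite -fP// !gK ?phiP//; exact: (proj2 VP).
- split=> [[x Wx <-]|[[x Vx <-]]]; last first.
    by rewrite gK// => phix; exists x => //; apply/WP.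
  have Vx := WV _ Wx; split; first by exists x.
  by rewrite gK//; have [] := (WP x).1 Wx.
- have [x Vx <-] := phi_onto r; exists (f x); first by exists x.
  by rewrite gK.
Qed.

End Codimension.

(** * The index of a linear map *)

Section Index.
Variable K : fieldType.

(** The index is computed on any subspace of finite codimension which f maps
    injectively onto one of finite codimension.  It agrees with the difference
    of the dimensions of kernel and cokernel, and in this form it only depends
    on f up to finite codimension, so that products, finite rank perturbations
    and direct sums are handled by restriction. *)
Definition has_index (M M' : lmodType K) (V : set M) (W : set M') (f : M -> M')
    (k : int) :=
  exists V0 m n, [/\ codim V V0 m, codim W (f @` V0) n,
    {in V0 &, injective f} & k = m%:Z - n%:Z].

Lemma codim_preimage (M M' : lmodType K) (V : set M) (W : set M')
    (f : M -> M') n : lin_subspace V -> linear_on V f ->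
  codim (f @` V) (f @` V `&` W) n -> codim V (V `&` f @^-1` W) n.
Proof.
move=> VP fP [phi [phiP WP phi_onto]].
have fV x : V x -> (f @` V) (f x) by move=> Vx; exists x.
exists (phi \o f); split=> [c x y Vx Vy|x|r] /=.
- by rewrite fP// phiP//; exact: fV.
- split=> [[Vx Wfx]|[Vx phix]].
    by split=> //; have [] := (WP (f x)).1 (conj (fV _ Vx) Wfx).
  by split=> //; have [] := (WP (f x)).2 (conj (fV _ Vx) phix).
- by have [_ [x Vx <-] phix] := phi_onto r; exists x.
Qed.

Section OneMap.
Variables (M M' : lmodType K) (V : set M) (W : set M') (f : M -> M').
Hypotheses (VP : lin_subspace V) (WP : lin_subspace W) (fP : linear_on V f).

(** Shrinking the domain adds the same number to both codimensions; this is why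
    the index does not depend on it. *)
Lemma index_shrink (V0 V2 : set M) m n r :
  codim V V0 m -> codim W (f @` V0) n -> {in V0 &, injective f} ->
  codim V0 V2 r ->
  [/\ codim V V2 (m + r), codim W (f @` V2) (n + r) & {in V2 &, injective f}].
Proof.
move=> VV0 WV0 f_inj V02; have V0P := codim_subspace VP VV0.
have V20 := codim_sub V02.
split; first exact: codim_trans VV0 V02.
  apply: codim_trans WV0 _ => //; apply: codim_image => //.
  exact: sub_linear_on (codim_sub VV0) fP.
by move=> x y; rewrite !inE => /V20 ? /V20 ?; apply: f_inj; rewrite inE.
Qed.

Lemma index_uniq k l : has_index V W f k -> has_index V W f l -> k = l.
Proof.
move=> [V0 [m [n [VV0 WV0 inj0 ->]]]] [V1 [m' [n' [VV1 WV1 inj1 ->]]]].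
have V0P := codim_subspace VP VV0; have V1P := codim_subspace VP VV1.
have [r cr] := codim_capl VP V0P (codim_sub VV0) VV1.
have [r' cr'] := codim_capl VP V1P (codim_sub VV1) VV0.
rewrite setIC in cr'.
have [a b _] := index_shrink VV0 WV0 inj0 cr.
have [a' b' _] := index_shrink VV1 WV1 inj1 cr'.
have := codim_inj VP a a'; have := codim_inj WP b b'; lia.
Qed.

(** f and g agree on the kernel of phi, of finite codimension. *)
Lemma index_perturb (g : M -> M') k d (phi : M -> 'rV[K]_d) :
  linear_on V phi -> (forall x, V x -> phi x = 0 -> f x = g x) ->
  has_index V W f k -> has_index V W g k.
Proof.
move=> phiP fg [V0 [m [n [VV0 WV0 inj0 ->]]]].
have V0P := codim_subspace VP VV0; have V0V := codim_sub VV0.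
have [r cr] : exists r, codim V0 (V0 `&` [set x | phi x = 0]) r.
  by apply: (codim_ker (phi := phi)) => //; exact: sub_linear_on phiP.
have [a b inj2] := index_shrink VV0 WV0 inj0 cr.
have fgV x : (V0 `&` [set x | phi x = 0]) x -> f x = g x.
  by move=> [/V0V Vx phix]; exact: fg.
exists (V0 `&` [set x | phi x = 0]), (m + r)%N, (n + r)%N; split=> //.
- by rewrite -(eq_imagel fgV).
- move=> x y; rewrite !inE => Vx Vy; rewrite -!fgV// => fxy.
  by apply: inj2; rewrite ?inE.
- lia.
Qed.

Lemma index_ext (g : M -> M') k : (forall x, V x -> f x = g x) ->
  has_index V W f k -> has_index V W g k.
Proof.
move=> fg; apply: (@index_perturb _ _ 0 (fun=> 0)) => [c x y _ _|x Vx _].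
  by rewrite scaler0 addr0.
exact: fg.
Qed.

Lemma index_iso : {in V &, injective f} -> f @` V = W -> has_index V W f 0.
Proof.
move=> f_inj fV; exists V, 0%N, 0%N; split=> //; first exact: codim_refl.
by rewrite fV; exact: codim_refl.
Qed.

End OneMap.

Lemma index_from0 (M M' : lmodType K) (W : set M') (f : M -> M') n :
  f 0 = 0 -> codim W [set 0] n -> has_index [set 0] W f (- n%:Z).
Proof.
move=> f0 Wn; exists [set 0], 0%N, n; split.
- by apply: codim_refl; split=> // c x y -> ->; rewrite scaler0 addr0.
- by rewrite image_set1 f0.
- by move=> x y; rewrite !inE => -> ->.
- by rewrite sub0r.
Qed.

(** Restrict f and g so that the range of the first is the domain of the second:
    this intermediate space has the same codimension seen from both sides. *)
Lemma index_comp (M1 M2 M3 : lmodType K) (V : set M1) (W : set M2) (Z : set M3)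
    (f : M1 -> M2) (g : M2 -> M3) k l :
  lin_subspace V -> lin_subspace W -> lin_subspace Z ->
  linear_on V f -> linear_on W g ->
  has_index V W f k -> has_index W Z g l -> has_index V Z (g \o f) (k + l).
Proof.
move=> VP WP ZP fP gP [V0 [m [n [VV0 WV0 inj0 ->]]]].
move=> [W1 [m' [n' [WW1 ZW1 inj1 ->]]]].
have V0P := codim_subspace VP VV0; have V0V := codim_sub VV0.
have fP0 := sub_linear_on V0V fP.
have fV0P := linear_on_image V0P fP0.
have W1P := codim_subspace WP WW1.
have [r cr] := codim_capl WP fV0P (codim_sub WV0) WW1.
have [r' cr'] := codim_capl WP W1P (codim_sub WW1) WV0.
rewrite setIC in cr'.
set V2 := V0 `&` f @^-1` W1.
have V02 : codim V0 V2 r by exact: codim_preimage.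
have fV2 : f @` V2 = f @` V0 `&` W1.
  apply/seteqP; split=> [_ [x [V0x W1x] <-]|_ [[x V0x <-] W1x]].
    by split=> //; exists x.
  by exists x.
have [a b inj2] := index_shrink VP WP fP VV0 WV0 inj0 V02.
have [a' b' inj2'] := index_shrink WP ZP gP WW1 ZW1 inj1 cr'.
have eqmn : (n + r = m' + r')%N by apply: (codim_inj WP) a'; rewrite -fV2.
exists V2, (m + r)%N, (n' + r')%N; split=> //.
- by rewrite -image_comp fV2.
- move=> x y xV2 yV2 /= gfxy.
  have fV x' : x' \in V2 -> f x' \in f @` V0 `&` W1.
    by rewrite !inE -fV2 => ?; exists x'.
  by apply: inj2 => //; apply: inj2' gfxy; exact: fV.
- lia.
Qed.

Definition direct_sum (M : lmodType K) (V V1 V2 : set M) (p1 p2 : M -> M) :=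
  [/\ forall x, V x -> [/\ V1 (p1 x), V2 (p2 x) & x = p1 x + p2 x],
      linear_on V p1, linear_on V p2,
      forall x, V1 x -> [/\ V x, p1 x = x & p2 x = 0]
    & forall x, V2 x -> [/\ V x, p1 x = 0 & p2 x = x]].

Lemma codim_sum (M : lmodType K) (V V1 V2 U1 U2 : set M) (p1 p2 : M -> M) m1 m2 :
  lin_subspace V -> direct_sum V V1 V2 p1 p2 -> codim V1 U1 m1 -> codim V2 U2 m2 ->
  codim V [set x | [/\ V x, U1 (p1 x) & U2 (p2 x)]] (m1 + m2).
Proof.
move=> VP [Vp p1P p2P V1V V2V] [phi1 [phi1P U1P onto1]] [phi2 [phi2P U2P onto2]].
exists (fun x => row_mx (phi1 (p1 x)) (phi2 (p2 x))); split=> [c x y Vx Vy|x|r].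
- have [? ? _] := Vp _ Vx; have [? ? _] := Vp _ Vy.
  by rewrite p1P// p2P// phi1P// phi2P// scale_row_mx add_row_mx.
- split=> [[Vx /U1P[_ e1] /U2P[_ e2]]|[Vx]].
    by split=> //; rewrite e1 e2 row_mx0.
  rewrite -row_mx0 => /eq_row_mx[e1 e2]; have [? ? _] := Vp _ Vx.
  by split=> //; [apply/U1P|apply/U2P].
- have [x1 Vx1 e1] := onto1 (lsubmx r); have [x2 Vx2 e2] := onto2 (rsubmx r).
  have [V1x p11 p21] := V1V _ Vx1; have [V2x p12 p22] := V2V _ Vx2.
  exists (x1 + x2); first exact: subspaceD.
  rewrite (linear_onD p1P)// (linear_onD p2P)// p11 p12 p21 p22 addr0 add0r.
  by rewrite e1 e2 hsubmxK.
Qed.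

Lemma index_sum (M M' : lmodType K) (V V1 V2 : set M) (W W1 W2 : set M')
    (p1 p2 : M -> M) (q1 q2 : M' -> M') (f : M -> M') k1 k2 :
  lin_subspace V -> lin_subspace W ->
  direct_sum V V1 V2 p1 p2 -> direct_sum W W1 W2 q1 q2 -> linear_on V f ->
  (forall x, V1 x -> W1 (f x)) -> (forall x, V2 x -> W2 (f x)) ->
  has_index V1 W1 f k1 -> has_index V2 W2 f k2 -> has_index V W f (k1 + k2).
Proof.
move=> VP WP VV WW fP fV1 fV2 [U1 [m1 [n1 [VU1 WU1 inj1 ->]]]].
move=> [U2 [m2 [n2 [VU2 WU2 inj2 ->]]]].
have [Vp p1P p2P V1V V2V] := VV; have [Wq q1P q2P W1W W2W] := WW.
have fE x : V x -> q1 (f x) = f (p1 x) /\ q2 (f x) = f (p2 x).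
  move=> Vx; have [V1x V2x {1 3}->] := Vp _ Vx.
  have [? _ _] := V1V _ V1x; have [? _ _] := V2V _ V2x.
  rewrite (linear_onD fP)//.
  have [Wf1 e1 e2] := W1W _ (fV1 _ V1x); have [Wf2 e3 e4] := W2W _ (fV2 _ V2x).
  by rewrite (linear_onD q1P)// (linear_onD q2P)// e1 e2 e3 e4 addr0 add0r.
set U := [set x | [/\ V x, U1 (p1 x) & U2 (p2 x)]].
exists U, (m1 + m2)%N, (n1 + n2)%N; split; first exact: codim_sum VU1 VU2.
- have -> : f @` U = [set y | [/\ W y, (f @` U1) (q1 y) & (f @` U2) (q2 y)]].
    apply/seteqP; split=> [_ [x [Vx Ux1 Ux2] <-]|y].
      have [E1 E2] := fE _ Vx; rewrite /= E1 E2; split; [|by exists (p1 x)|by exists (p2 x)].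
      have [V1x V2x ->] := Vp _ Vx.
      have [? _ _] := V1V _ V1x; have [? _ _] := V2V _ V2x.
      have [? _ _] := W1W _ (fV1 _ V1x); have [? _ _] := W2W _ (fV2 _ V2x).
      by rewrite (linear_onD fP)//; exact: subspaceD.
    move=> [Wy [x1 Ux1 e1] [x2 Ux2 e2]].
    have [Vx1 p11 p21] := V1V _ (codim_sub VU1 Ux1).
    have [Vx2 p12 p22] := V2V _ (codim_sub VU2 Ux2).
    have [_ _ ->] := Wq _ Wy; exists (x1 + x2).
      split; first exact: subspaceD.
        by rewrite (linear_onD p1P)// p11 p12 addr0.
      by rewrite (linear_onD p2P)// p21 p22 add0r.
    by rewrite (linear_onD fP)// e1 e2.
  exact: codim_sum WU1 WU2.
- move=> x y; rewrite !inE => -[Vx Ux1 Ux2] [Vy Uy1 Uy2] fxy.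
  have [fx1 fx2] := fE _ Vx; have [fy1 fy2] := fE _ Vy.
  have [_ _ ->] := Vp _ Vx; have [_ _ ->] := Vp _ Vy; congr (_ + _).
    by apply: inj1; rewrite ?inE// -fx1 -fy1 fxy.
  by apply: inj2; rewrite ?inE// -fx2 -fy2 fxy.
- lia.
Qed.

(** Only g o f and f o g are assumed to have an index.  On the preimage Y of
    g (f (U)) under g, a vector y differs from its unique candidate preimage
    in f (U) by an element of ker g, and ker g embeds into a finite-dimensional
    space because f o g is injective on a subspace of finite codimension. *)
Lemma index_factor (M M' : lmodType K) (V : set M) (W : set M')
    (f : M -> M') (g : M' -> M) k l :
  lin_subspace V -> lin_subspace W -> linear_on V f -> linear_on W g ->
  (forall x, V x -> W (f x)) -> (forall y, W y -> V (g y)) ->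
  has_index V V (g \o f) k -> has_index W W (f \o g) l ->
  exists j, has_index V W f j.
Proof.
move=> VP WP fP gP fVW gWV [U [m [n [VU VgU injU _]]]].
move=> [U' [m' [n' [[phi [phiP U'P _]] _ injU' _]]]].
have UP := codim_subspace VP VU; have UV := codim_sub VU.
have injfU : {in U &, injective f}.
  by move=> x y xU yU fxy; apply: injU => //=; rewrite fxy.
set Y := W `&` g @^-1` ((g \o f) @` U).
have [r WY] : exists r, codim W Y r.
  have [psi [psiP ZP _]] := VgU.
  apply: (codim_ker (phi := psi \o g)) => // [c x y Wx Wy /=|y].
    by rewrite gP// psiP//; exact: gWV.
  by split=> [[Wy /ZP[]]//|[Wy psiy]]; split=> //; apply/ZP; split=> //; exact: gWV.
have YP := codim_subspace WP WY.
have ex y : exists u, Y y -> U u /\ g (f u) = g y.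
  by have [[_ [u Uu gfu]]|?] := pselect (Y y); [exists u|exists 0].
pose u y := projT1 (cid (ex y)).
have uP y : Y y -> U (u y) /\ g (f (u y)) = g y by rewrite /u; case: cid.
have uE y v : Y y -> U v -> g (f v) = g y -> u y = v.
  move=> Yy Uv gfv; have [Uu gfu] := uP _ Yy.
  by apply: injU; rewrite ?inE//= gfu gfv.
have uL : linear_on Y u.
  move=> c x y Yx Yy; have [Ux gx] := uP _ Yx; have [Uy gy] := uP _ Yy.
  apply: uE; [exact: (proj2 YP)|exact: (proj2 UP)|].
  have [Vx Vy] := (UV _ Ux, UV _ Uy).
  by rewrite fP// gP ?gx ?gy ?gP//; [case: Yx|case: Yy|exact: fVW..].
have WYf y : Y y -> W (f (u y)).
  by move=> /uP[/UV ? _]; exact: fVW.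
have fuL : linear_on Y (fun y => y - f (u y)).
  move=> c x y Yx Yy; have [Ux gx] := uP _ Yx; have [Uy gy] := uP _ Yy.
  rewrite uL// fP; [|exact: UV..].
  by rewrite scalerBr addrACA opprD.
have [s Ys] : exists s, codim Y (f @` U) s.
  apply: (codim_ker (phi := fun y => phi (y - f (u y)))) => //.
    move=> c x y Yx Yy; rewrite fuL// phiP//.
      by apply: subspaceB => //; [case: Yx|exact: WYf].
    by apply: subspaceB => //; [case: Yy|exact: WYf].
  move=> y; split=> [[x Ux <-]|[Yy phiy]].
    have Yfx : Y (f x) by split; [exact/fVW/UV|exists x].
    split=> //; rewrite (uE (f x) x)// subrr; exact: linear_on0 WP phiP.
  have [Uu gfu] := uP _ Yy; exists (u y) => //.
  have [Wy _] := Yy; have Wfu := WYf _ Yy.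
  have Wd : W (y - f (u y)) by exact: subspaceB.
  have U'd : U' (y - f (u y)) by apply/U'P.
  have U'0 : U' 0 by apply/U'P; split; [case: WP|exact: linear_on0 WP phiP].
  apply/esym/eqP; rewrite -subr_eq0; apply/eqP/injU'; rewrite ?inE//=.
  rewrite (linear_onB WP gP)// gfu subrr.
  by rewrite (linear_on0 WP gP).
exists (m%:Z - (r + s)%:Z), U, m, (r + s)%N; split=> //.
exact: codim_trans WY Ys.
Qed.

End Index.

(** * Norms with real values *)

Section RealNorm.
Variables (R : realType) (V : normedModType R[i]).
Implicit Types x y : V.

(** The norm of a complex Hilbert space takes its values in R[i]; its real part
    is the norm as a real number. *)
Definition rnorm x : R := complex.Re `|x|.

Lemma rnormE x : `|x| = (rnorm x)%:C.
Proof. by rewrite /rnorm RRe_real// ger0_real. Qed.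

Lemma rnorm_ge0 x : 0 <= rnorm x.
Proof. by rewrite -ler0c -rnormE. Qed.

Lemma rnormD x y : rnorm (x + y) <= rnorm x + rnorm y.
Proof. by rewrite -lecR raddfD/= -!rnormE ler_normD. Qed.

Lemma rnormN x : rnorm (- x) = rnorm x.
Proof. by rewrite /rnorm normrN. Qed.

Lemma rnorm0 : rnorm (0 : V) = 0.
Proof. by rewrite /rnorm normr0. Qed.

Lemma rnormB x y : rnorm (x - y) <= rnorm x + rnorm y.
Proof. by rewrite -(rnormN y) rnormD. Qed.

Lemma rnormBC x y : rnorm (x - y) = rnorm (y - x).
Proof. by rewrite -opprB rnormN. Qed.

Lemma rnorm_eq0 x : (rnorm x == 0) = (x == 0).
Proof. by rewrite -[RHS]normr_eq0 rnormE (inj_eq (@complexI R) _ 0). Qed.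

End RealNorm.

Section ComplexModulus.
Variable R : realType.
Implicit Types a b : R[i].

Definition cabs a : R := complex.Re `|a|.

Lemma cabsE a : `|a| = (cabs a)%:C.
Proof. by rewrite /cabs RRe_real ?normr_real. Qed.

Lemma cabs_ge0 a : 0 <= cabs a.
Proof. by rewrite -ler0c -cabsE. Qed.

Lemma cabs_eq0 a : (cabs a == 0) = (a == 0).
Proof. by rewrite -[RHS]normr_eq0 cabsE (inj_eq (@complexI R) _ 0). Qed.

Lemma cabs0 : cabs 0 = 0.
Proof. by rewrite /cabs normr0. Qed.

Lemma cabsN a : cabs (- a) = cabs a.
Proof. by rewrite /cabs normrN. Qed.

Lemma cabsJ a : cabs (conjc a) = cabs a.
Proof. by rewrite /cabs normcJ. Qed.

Lemma mulcJ a : a * conjc a = (cabs a ^+ 2)%:C.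
Proof. by rewrite -sqr_normc cabsE rmorphXn. Qed.

Lemma cabs_real (r : R) : 0 <= r -> cabs r%:C = r.
Proof. by move=> r0; rewrite /cabs ger0_norm ?ler0c. Qed.

Lemma Re_le_cabs a : complex.Re a <= cabs a.
Proof.
rewrite -lecR -cabsE; apply: le_trans (normc_ge_Re a).
by rewrite lecR ler_norm.
Qed.

Lemma Re_gt0 a : 0 < a -> 0 < complex.Re a.
Proof. by move=> a0; rewrite -ltcR RRe_real ?gtr0_real. Qed.

End ComplexModulus.

Lemma rnormZ (R : realType) (V : normedModType R[i]) (c : R[i]) (x : V) :
  rnorm (c *: x) = cabs c * rnorm x.
Proof. by apply: (@complexI R); rewrite rmorphM/= -!rnormE -cabsE normrZ. Qed.

(** Used both for norms of vectors and for norms of elements of a C*-algebra, for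
    which there is no common structure. *)
Lemma geometric_cauchy (R : realType) (U : zmodType) (nu : U -> R) (u : nat -> U) C :
  (forall a, nu (- a) = nu a) -> (forall a b, nu (a + b) <= nu a + nu b) ->
  nu 0 = 0 -> (forall n, nu (u n.+1 - u n) <= C / 2 ^+ n) ->
  forall eps : R, 0 < eps -> exists N, forall m n,
    (N <= m)%N -> (N <= n)%N -> nu (u m - u n) < eps.
Proof.
move=> nuN nuD nu0 uC eps eps0.
have nu_ge0 a : 0 <= nu a.
  have := nuD a (- a); rewrite subrr nu0 nuN; lra.
have pow0 n : 0 < 2 ^+ n :> R by rewrite exprn_gt0.
have C0 : 0 <= C by have := le_trans (nu_ge0 _) (uC 0%N); rewrite expr0 divr1.
have le1 n k : nu (u (n + k)%N - u n) <= 2 * C / 2 ^+ n - 2 * C / 2 ^+ (n + k).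
  elim: k => [|k IH]; first by rewrite addn0 !subrr nu0.
  rewrite addnS -(subrKA (u (n + k)%N)); apply: le_trans (nuD _ _) _.
  apply: le_trans (lerD (uC _) IH) _; rewrite exprS.
  have p0 := pow0 (n + k)%N; set p := 2 ^+ (n + k) in p0 *.
  have -> : 2 * C / (2 * p) = C / p by field; rewrite gt_eqF.
  lra.
have [N NP] : exists N, 4 * C / eps < 2 ^+ N.
  have := archi_boundP (divr_ge0 (mulr_ge0 (ler0n R 4) C0) (ltW eps0)).
  move=> lt1; exists (Num.bound (4 * C / eps)); apply: lt_trans lt1 _.
  by rewrite -natrX ltr_nat ltn_expl.
have tail n k : (N <= n)%N -> nu (u (n + k)%N - u n) < eps.
  move=> Nn; have := le1 n k.
  have : 0 <= 2 * C / 2 ^+ (n + k) by rewrite divr_ge0 ?mulr_ge0 // ltW.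
  have : 2 * C / 2 ^+ n <= 2 * C / 2 ^+ N.
    rewrite ler_wpM2l ?mulr_ge0// lef_pV2 ?posrE//.
    by rewrite ler_eXn2l ?ltr1n.
  have : 2 * C / 2 ^+ N < eps.
    rewrite ltr_pdivrMr//; rewrite ltr_pdivrMr// in NP.
    by rewrite [ltRHS]mulrC; apply: le_lt_trans NP; lra.
  lra.
exists N => m n Nm Nn; have [mn|nm] := leqP m n.
  by rewrite -(subnKC mn) -opprB nuN; exact: tail.
by rewrite -(subnKC (ltnW nm)); exact: tail.
Qed.

(** * Inner products *)

Section Inner.
Variables (R : realType) (H : hilbertType R).
Implicit Types x y z : H.

Lemma innerDr z x y : inner z (x + y) = inner z x + inner z y.
Proof. by rewrite inner_conj innerDl rmorphD /= -!inner_conj. Qed.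

Lemma innerZr z (c : R[i]) x : inner z (c *: x) = conjc c * inner z x.
Proof. by rewrite inner_conj innerZl rmorphM /= -inner_conj. Qed.

Lemma inner0r z : inner z (0 : H) = 0.
Proof. by have := innerZr z 0 (0 : H); rewrite scaler0 conjc0 mul0r.
Qed.

Lemma inner_bigr (I : Type) (r : seq I) (P : pred I) (x : I -> H) z :
  inner z (\sum_(i <- r | P i) x i) = \sum_(i <- r | P i) inner z (x i).
Proof.
by elim/big_rec2: _ => [|i a b _ IH]; rewrite ?inner0r// innerDr IH.
Qed.

Lemma inner_bigl (I : Type) (r : seq I) (P : pred I) (x : I -> H) z :
  inner (\sum_(i <- r | P i) x i) z = \sum_(i <- r | P i) inner (x i) z.
Proof.
by elim/big_rec2: _ => [|i a b _ IH]; rewrite ?inner0l// innerDl IH.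
Qed.

Lemma innerE x : inner x x = (rnorm x ^+ 2)%:C.
Proof. by rewrite inner_norm rnormE rmorphXn. Qed.

Lemma inner_eq0 x : inner x x = 0 -> x = 0.
Proof.
rewrite innerE => /eqP; rewrite (inj_eq (@complexI R) _ 0) sqrf_eq0 rnorm_eq0.
by move/eqP.
Qed.

Lemma inner_ext x y : (forall z, inner z x = inner z y) -> x = y.
Proof.
move=> xy; apply/eqP; rewrite -subr_eq0; apply/eqP/inner_eq0.
by rewrite innerBr xy subrr.
Qed.

Lemma rnorm_reject x y : y != 0 ->
  rnorm (x - (inner x y / inner y y) *: y) ^+ 2 =
  rnorm x ^+ 2 - cabs (inner x y) ^+ 2 / rnorm y ^+ 2.
Proof.
move=> y0; have ry : rnorm y ^+ 2 != 0 by rewrite sqrf_eq0 rnorm_eq0.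
have dy : inner y y != 0 by rewrite innerE (inj_eq (@complexI R) _ 0).
apply: (@complexI R); rewrite -innerE rmorphB/= -innerE rmorphM/= fmorphV/=.
rewrite -innerE -mulcJ innerBl !innerBr !innerZl !innerZr.
have -> : conjc (inner x y / inner y y) = conjc (inner x y) / inner y y.
  by rewrite rmorphM fmorphV/= -[in X in _ / X](inner_conj).
rewrite -(inner_conj x y); field.
by rewrite dy.
Qed.

Lemma cauchy_schwarz x y : cabs (inner x y) <= rnorm x * rnorm y.
Proof.
have [->|y0] := eqVneq y 0.
  by rewrite inner0r rnorm0 mulr0 cabs0.
have ry : 0 < rnorm y by rewrite lt0r rnorm_eq0 y0 rnorm_ge0.
have := sqr_ge0 (rnorm (x - (inner x y / inner y y) *: y)).
rewrite rnorm_reject// subr_ge0 ler_pdivrMr ?exprn_gt0// -exprMn.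
rewrite ler_pXn2r ?nnegrE ?mulr_ge0 ?rnorm_ge0 ?cabs_ge0 //.
Qed.

Lemma parallelogram x y :
  rnorm (x - y) ^+ 2 = 2 * rnorm x ^+ 2 + 2 * rnorm y ^+ 2 - rnorm (x + y) ^+ 2.
Proof.
apply: (@complexI R).
rewrite rmorphB rmorphD /= (rmorphM _ 2 (rnorm x ^+ 2)) (rmorphM _ 2 (rnorm y ^+ 2)) /=.
rewrite -!innerE innerBl !innerBr !innerDl !innerDr.
have -> : (2 : R)%:C = 2 by rewrite -[2]/(2%:R) rmorph_nat.
ring.
Qed.

Lemma pythagoras x y : inner x y = 0 ->
  rnorm (x + y) ^+ 2 = rnorm x ^+ 2 + rnorm y ^+ 2.
Proof.
move=> xy; apply: (@complexI R); rewrite rmorphD/= -!innerE innerDl !innerDr.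
by rewrite (inner_conj x y) xy conjc0 addr0 add0r.
Qed.

Lemma hilbert_complete (u : nat -> H) :
  (forall eps : R, 0 < eps -> exists N, forall m n,
     (N <= m)%N -> (N <= n)%N -> rnorm (u m - u n) < eps) ->
  exists x, forall eps : R, 0 < eps -> exists N, forall n,
     (N <= n)%N -> rnorm (u n - x) < eps.
Proof.
move=> uC; have : cauchy (u @ \oo).
  apply/cauchyP => eps eps0.
  have [N NP] := uC (complex.Re eps) (Re_gt0 eps0).
  exists (u N), N => // n /= Nn; rewrite -ball_normE /=.
  rewrite rnormE -(RRe_real (gtr0_real eps0)) ltcR.
  by apply: NP.
move/cauchy_cvgP => /cvg_ex[/= x /cvgrPdist_lt ux]; exists x => eps eps0.
have [|N _ NP] := ux eps%:C; first by rewrite ltcR.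
exists N => n Nn; have := NP n Nn.
by rewrite /= distrC rnormE ltcR.
Qed.

Lemma eq_of_close x y : (forall eps : R, 0 < eps -> rnorm (x - y) < eps) -> x = y.
Proof.
move=> xy; apply/eqP; rewrite -subr_eq0 -rnorm_eq0; apply/negPn/negP => n0.
have lt0 : 0 < rnorm (x - y) by rewrite lt0r n0 rnorm_ge0.
by have := xy _ lt0; rewrite ltxx.
Qed.

End Inner.

(** * Riesz representation and the C*-algebra of bounded operators *)

Section Riesz.
Variables (R : realType) (H : hilbertType R).

Section Functional.
Variables (f : H -> R[i]) (M : R).
Hypothesis f_lin : forall c x y, f (c *: x + y) = c * f x + f y.
Hypothesis f_bound : forall x, cabs (f x) <= M * rnorm x.

Let f0 : f 0 = 0.
Proof.
have := f_lin 1 0 0; rewrite scaler0 addr0 mul1r => /(congr1 (fun z => z - f 0)).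
by rewrite subrr addrK.
Qed.

Let fZ c x : f (c *: x) = c * f x.
Proof. by rewrite -[_ *: _]addr0 f_lin f0 addr0. Qed.

Let fD x y : f (x + y) = f x + f y.
Proof. by have := f_lin 1 x y; rewrite scale1r mul1r. Qed.

Let fB x y : f (x - y) = f x - f y.
Proof. by rewrite -scaleN1r fD fZ mulN1r. Qed.

(** The affine hyperplane f = 1 has a point of least norm: by the
    parallelogram law, a minimizing sequence is a Cauchy sequence. *)
Lemma hyperplane_least_norm : (exists x, f x != 0) ->
  exists x, f x = 1 /\ forall y, f y = 1 -> rnorm x <= rnorm y.
Proof.
move=> [x0 fx0].
pose A := [set rnorm x | x in [set x | f x = 1]].
have A_inf : has_inf A.
  split; first by exists (rnorm ((f x0)^-1 *: x0)), ((f x0)^-1 *: x0) => //=; rewrite fZ mulVf.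
  by exists 0 => _ [x _ <-]; exact: rnorm_ge0.
pose c := inf A.
have c_le x : f x = 1 -> c <= rnorm x.
  by move=> fx; apply: ge_inf; [case: A_inf|exists x].
have c0 : 0 <= c.
  by apply: lb_le_inf; [case: A_inf|move=> _ [x _ <-]; exact: rnorm_ge0].
have ex n : exists x, f x = 1 /\ rnorm x < c + n.+1%:R^-1.
  have [|_ [x fx <-] ltx] := inf_adherent (eps := n.+1%:R^-1) _ A_inf.
    by rewrite invr_gt0 ltr0n.
  by exists x.
pose u n := projT1 (cid (ex n)).
have fu n : f (u n) = 1 by rewrite /u; case: cid => ? [].
have ule n : rnorm (u n) < c + n.+1%:R^-1 by rewrite /u; case: cid => ? [].
have inv_le (N n : nat) : (N <= n)%N -> n.+1%:R^-1 <= N.+1%:R^-1 :> R.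
  by move=> Nn; rewrite lef_pV2 ?posrE ?ltr0n// ler_nat.
have invS (d : R) : 0 < d -> exists N : nat, N.+1%:R^-1 < d.
  move=> d0; exists (Num.bound d^-1); rewrite invf_plt ?posrE ?ltr0n//.
  apply: lt_trans (archi_boundP _) _; first by rewrite invr_ge0 ltW.
  by rewrite ltr_nat.
have uC : forall eps : R, 0 < eps -> exists N, forall m n,
     (N <= m)%N -> (N <= n)%N -> rnorm (u m - u n) < eps.
  (* 2 (c + t)^2 + 2 (c + t)^2 - 4 c^2 = 8 c t + 4 t^2 <= t (8 c + 8) for t <= 1 *)
  move=> eps eps0; pose d := Num.min 1 (eps ^+ 2 / (8 * c + 8)).
  have e0 : 0 < eps ^+ 2 by rewrite exprn_gt0.
  have [N Nd] : exists N : nat, N.+1%:R^-1 < d.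
    by apply: invS; rewrite lt_min ltr01 divr_gt0//; lra.
  exists N => m n Nm Nn.
  rewrite -(@ltr_pXn2r _ 2) ?nnegrE ?rnorm_ge0 ?(ltW eps0)//.
  rewrite parallelogram.
  have mid : 4 * c ^+ 2 <= rnorm (u m + u n) ^+ 2.
    have -> : u m + u n = 2 *: (2^-1 *: (u m + u n)).
      by rewrite scalerA divff ?scale1r// pnatr_eq0.
    have : c <= rnorm (2^-1 *: (u m + u n)).
      apply: c_le; rewrite fZ fD !fu mulrDr mulr1 -[X in X + X = 1]div1r.
      by rewrite -splitr.
    set r := rnorm (2^-1 *: _) => cr.
    rewrite rnormZ; have -> : cabs (2 : R[i]) = 2.
      by rewrite -[RHS](@cabs_real R)// /cabs rmorph_nat.
    rewrite exprMn -natrX ler_pM2l ?ltr0n// ler_pXn2r// nnegrE//.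
    exact: rnorm_ge0.
  move: Nd; rewrite lt_min => /andP[] + +.
  rewrite ltr_pdivlMr; last lra.
  have := ule m; have := ule n; have := inv_le _ _ Nm; have := inv_le _ _ Nn.
  have := rnorm_ge0 (u n); have := rnorm_ge0 (u m).
  have : 0 <= N.+1%:R^-1 :> R by rewrite invr_ge0 ler0n.
  move: (rnorm (u m)) (rnorm (u n)) (N.+1%:R^-1 : R) (m.+1%:R^-1 : R) mid.
  move: (n.+1%:R^-1 : R) => jn a b t im mid.
  move=> t0 a0 b0 nt mt nb ma ht t1.
  have ac : a ^+ 2 <= (c + t) ^+ 2 by rewrite ler_pXn2r// ?nnegrE; lra.
  have bc : b ^+ 2 <= (c + t) ^+ 2 by rewrite ler_pXn2r// ?nnegrE; lra.
  have : t ^+ 2 <= t by rewrite expr2 ler_piMl; lra.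
  have : 2 * (c + t) ^+ 2 + 2 * (c + t) ^+ 2 - 4 * c ^+ 2 = 8 * (c * t) + 4 * t ^+ 2.
    by ring.
  have tE : t * (8 * c + 8) = 8 * (c * t) + 8 * t by ring.
  rewrite tE in t1; lra.
have [x xP] := hilbert_complete uC.
exists x; split=> [|y fy].
  apply/eqP; rewrite -subr_eq0 -cabs_eq0; apply/negPn/negP => n0.
  have lt0 : 0 < cabs (f x - 1) by rewrite lt0r n0 cabs_ge0.
  have M1 : 0 < `|M| + 1 by rewrite ltr_wpDl.
  have [N NP] := xP _ (divr_gt0 lt0 M1).
  have := NP N (leqnn _); rewrite ltr_pdivlMr// => ltN.
  have : cabs (f x - 1) <= M * rnorm (u N - x).
    by rewrite rnormBC -(fu N) -fB; exact: f_bound.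
  have : M * rnorm (u N - x) <= `|M| * rnorm (u N - x).
    by rewrite ler_wpM2r ?rnorm_ge0// ler_norm.
  have := rnorm_ge0 (u N - x); lra.
apply: le_trans (c_le _ fy); apply/ler_addgt0Pr => e e0.
have [N NP] := xP _ (divr_gt0 e0 (ltr0n R 2)).
have [N' NP'] := invS _ (divr_gt0 e0 (ltr0n R 2)).
pose n := maxn N N'.
have := NP n (leq_maxl _ _); have := ule n; have := inv_le _ n (leq_maxr N N').
rewrite rnormBC => h1 h2 h3.
have := rnormD (u n) (x - u n); rewrite addrCA subrr addr0 => h4.
move: NP' h1 h2 h3 h4; move: (N'.+1%:R^-1 : R) (n.+1%:R^-1 : R) => t s. lra.
Qed.

Lemma riesz : exists z, forall x, f x = inner x z.
Proof.
have [nz|z0] := pselect (exists x, f x != 0); last first.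
  exists 0 => x; rewrite inner0r; apply/eqP/negPn/negP => fx; apply: z0.
  by exists x.
have [x [fx xmin]] := hyperplane_least_norm nz.
have x0 : inner x x != 0.
  apply/eqP => /inner_eq0 x0; move: fx; rewrite x0 f0 => /eqP.
  by rewrite eq_sym oner_eq0.
have xker h : f h = 0 -> inner x h = 0.
  move=> fh; have [->|h0] := eqVneq h 0; first exact: inner0r.
  have : rnorm x <= rnorm (x - (inner x h / inner h h) *: h).
    by apply: xmin; rewrite fB fZ fh mulr0 subr0.
  rewrite -(@ler_pXn2r _ 2) ?nnegrE ?rnorm_ge0// rnorm_reject// -subr_ge0.
  rewrite addrAC subrr add0r oppr_ge0 => le0.
  have := divr_ge0 (sqr_ge0 (cabs (inner x h))) (sqr_ge0 (rnorm h)) => ge0.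
  have /eqP : cabs (inner x h) ^+ 2 / rnorm h ^+ 2 = 0 by apply/le_anti/andP.
  rewrite mulf_eq0 invr_eq0 !sqrf_eq0 rnorm_eq0 (negPf h0) orbF cabs_eq0.
  by move/eqP.
exists (conjc (inner x x)^-1 *: x) => y; rewrite innerZr conjcK.
have : inner x (y - f y *: x) = 0 by apply: xker; rewrite fB fZ fx mulr1 subrr.
move=> /(congr1 (@conjc R)); rewrite -inner_conj conjc0 innerBl innerZl.
move/eqP; rewrite subr_eq0 => /eqP ->.
by rewrite mulrCA mulVf// mulr1.
Qed.

End Functional.

Implicit Types X Y : bop H.

Lemma bop_bound X : exists2 M : R, 0 <= M & forall x, rnorm (X x) <= M * rnorm x.
Proof.
have [M M0 XM] := bounded_op_norm (bopP X).
exists (complex.Re M) => [|x]; first by rewrite -ler0c RRe_real// ger0_real.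
by rewrite -lecR rmorphM/= (RRe_real (ger0_real M0)) -!rnormE XM.
Qed.

Lemma bop_of (f : H -> H) (M : R) :
  linear f -> (forall x, rnorm (f x) <= M * rnorm x) ->
  exists X : bop H, forall x, X x = f x.
Proof.
move=> f_lin fM; have fP : bounded_op f.
  by split=> //; exists M%:C => x; rewrite !rnormE -rmorphM lecR.
by exists (Bop (asboolT fP)).
Qed.

(** The Riesz vectors of the functionals x |-> <X x, y> depend linearly on y. *)
Lemma adjointP X x y : inner (X x) y = inner x (star X y).
Proof.
suff [Y YP] : exists Y : bop H, forall x y, inner (X x) y = inner x (Y y).
  have xP : exists Y : bop H, [set Y | forall x y, inner (X x) y = inner x (Y y)] Y.
    by exists Y.
  exact: (xgetPex 0 xP).
have [M M0 XM] := bop_bound X.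
have ex y' : exists z, forall x, inner (X x) y' = inner x z.
  apply: (@riesz _ (M * rnorm y')) => [c a b|a].
    by rewrite linearP innerDl innerZl.
  rewrite mulrAC; apply: le_trans (cauchy_schwarz _ _) _.
  by rewrite ler_wpM2r ?rnorm_ge0.
pose g y' := projT1 (cid (ex y')).
have gP a b : inner (X a) b = inner a (g b) by rewrite /g; case: cid.
have g_lin : linear g.
  move=> c a b; apply: inner_ext => z.
  by rewrite -gP !innerDr !innerZr -!gP.
have [|Y YP] := bop_of (M := M) g_lin; last by exists Y => a b; rewrite YP.
move=> a; have [->|ga0] := eqVneq (rnorm (g a)) 0.
  by rewrite mulr_ge0 ?rnorm_ge0.
have ga : 0 < rnorm (g a) by rewrite lt0r ga0 rnorm_ge0.
rewrite -(ler_pM2l ga) -expr2 -(cabs_real (sqr_ge0 _)) -innerE -gP.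
apply: le_trans (cauchy_schwarz _ _) _.
by rewrite mulrA ler_wpM2r ?rnorm_ge0// mulrC.
Qed.

Lemma adjointPr X x y : inner x (X y) = inner (star X x) y.
Proof. by rewrite inner_conj adjointP -inner_conj. Qed.

Lemma star_unique X Y :
  (forall x y, inner (X x) y = inner x (Y y)) -> star X = Y.
Proof.
by move=> XY; apply: bop_ext => y; apply: inner_ext => x; rewrite -adjointP XY.
Qed.

Lemma bop_starK : involutive (star : bop H -> bop H).
Proof. by move=> X; apply: star_unique => x y; rewrite -adjointPr. Qed.

Lemma bop_starD X Y : star (X + Y) = star X + star Y.
Proof.
by apply: star_unique => x y; rewrite /= innerDl !adjointP innerDr.
Qed.

Lemma bop_starZ c X : star (c *: X) = conjc c *: star X.
Proof.
by apply: star_unique => x y; rewrite /= innerZl !adjointP innerZr conjcK.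
Qed.

Lemma bop_starM X Y : star (X * Y) = star Y * star X.
Proof. by apply: star_unique => x y; rewrite /= !adjointP. Qed.

Lemma bop_star1 : star (1 : bop H) = 1.
Proof. exact: star_unique. Qed.

Lemma bop_star0 : star (0 : bop H) = 0.
Proof. by apply: star_unique => x y; rewrite /= inner0l inner0r. Qed.

Lemma bop_starN X : star (- X) = - star X.
Proof.
apply: (addrI (star X)); rewrite -bop_starD !subrr.
exact: bop_star0.
Qed.

Definition opnorm X : R :=
  inf [set M | 0 <= M /\ forall x, rnorm (X x) <= M * rnorm x].

Lemma opnorm_le X M : 0 <= M -> (forall x, rnorm (X x) <= M * rnorm x) ->
  opnorm X <= M.
Proof. by move=> M0 XM; apply: ge_inf => //; exists 0 => ? []. Qed.

Lemma opnorm_ge0 X : 0 <= opnorm X.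
Proof.
apply: lb_le_inf; last by move=> ? [].
by have [M M0 XM] := bop_bound X; exists M.
Qed.

Lemma opnormP X x : rnorm (X x) <= opnorm X * rnorm x.
Proof.
have [->|x0] := eqVneq x 0; first by rewrite raddf0 !rnorm0 mulr0.
have rx : 0 < rnorm x by rewrite lt0r rnorm_eq0 x0 rnorm_ge0.
rewrite -ler_pdivrMr//; apply: lb_le_inf.
  by have [M M0 XM] := bop_bound X; exists M.
by move=> M [_ XM]; rewrite ler_pdivrMr.
Qed.

Lemma opnorm0_eq0 X : opnorm X = 0 -> X = 0.
Proof.
move=> X0; apply: bop_ext => x; apply/eqP.
by rewrite -rnorm_eq0 eq_le rnorm_ge0 andbT -[leRHS](mul0r (rnorm x)) -X0 opnormP.
Qed.

Lemma opnormD X Y : opnorm (X + Y) <= opnorm X + opnorm Y.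
Proof.
apply: opnorm_le => [|x]; first by rewrite addr_ge0 ?opnorm_ge0.
by rewrite (le_trans (rnormD _ _))// mulrDl lerD ?opnormP.
Qed.

Lemma opnormM X Y : opnorm (X * Y) <= opnorm X * opnorm Y.
Proof.
apply: opnorm_le => [|x]; first by rewrite mulr_ge0 ?opnorm_ge0.
rewrite (le_trans (opnormP X (Y x)))// -mulrA.
by rewrite ler_wpM2l ?opnorm_ge0 ?opnormP.
Qed.

Lemma opnormZ c X : opnorm (c *: X) = cabs c * opnorm X.
Proof.
have le_ d Z : opnorm (d *: Z) <= cabs d * opnorm Z.
  apply: opnorm_le => [|x]; first by rewrite mulr_ge0 ?opnorm_ge0 ?cabs_ge0.
  by rewrite /= rnormZ -mulrA ler_wpM2l ?cabs_ge0 ?opnormP.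
apply/eqP; rewrite eq_le le_/=.
have [->|c0] := eqVneq c 0; first by rewrite cabs0 mul0r opnorm_ge0.
have ac : 0 < cabs c by rewrite lt0r cabs_eq0 c0 cabs_ge0.
rewrite -ler_pdivlMl//; have := le_ c^-1 (c *: X).
rewrite scalerA mulVf// scale1r; congr (_ <= _ * _).
by rewrite /cabs normfV cabsE -fmorphV.
Qed.

Lemma opnorm_star_le X : opnorm (star X) <= opnorm X.
Proof.
apply: opnorm_le => [|a]; first exact: opnorm_ge0.
have [->|ga0] := eqVneq (rnorm (star X a)) 0.
  by rewrite mulr_ge0 ?rnorm_ge0 ?opnorm_ge0.
have ga : 0 < rnorm (star X a) by rewrite lt0r ga0 rnorm_ge0.
rewrite -(ler_pM2l ga) -expr2 -(cabs_real (sqr_ge0 _)) -innerE -adjointP.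
apply: le_trans (cauchy_schwarz _ _) _.
by rewrite mulrA ler_wpM2r ?rnorm_ge0// mulrC opnormP.
Qed.

(** The inequality |X|^2 <= |X^* X| comes from |X x|^2 = <x, X^* X x>. *)
Lemma opnorm_star_mul X : opnorm (star X * X) = opnorm X ^+ 2.
Proof.
apply/eqP; rewrite eq_le; apply/andP; split.
  by rewrite (le_trans (opnormM _ _))// expr2 ler_wpM2r ?opnorm_ge0 ?opnorm_star_le.
have s0 := opnorm_ge0 (star X * X).
rewrite -[leRHS]sqr_sqrtr// ler_pXn2r ?nnegrE ?opnorm_ge0 ?sqrtr_ge0//.
apply: opnorm_le => [|x]; first exact: sqrtr_ge0.
rewrite -(@ler_pXn2r _ 2) ?nnegrE ?mulr_ge0 ?rnorm_ge0 ?sqrtr_ge0//.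
rewrite exprMn sqr_sqrtr// -(cabs_real (sqr_ge0 (rnorm (X x)))) -innerE adjointP.
rewrite inner_conj cabsJ; apply: le_trans (cauchy_schwarz _ _) _.
by rewrite expr2 mulrA ler_wpM2r ?rnorm_ge0//; exact: (opnormP (star X * X)).
Qed.

(** The strong limit of a bounded sequence of operators is again bounded; this
    gives both the completeness of B(H) and operators defined by series. *)
Lemma strong_limit (u : nat -> bop H) (M : R) :
  (forall n x, rnorm (u n x) <= M * rnorm x) ->
  (forall x (eps : R), 0 < eps -> exists N, forall m n,
     (N <= m)%N -> (N <= n)%N -> rnorm (u m x - u n x) < eps) ->
  exists X : bop H, forall x (eps : R), 0 < eps -> exists N, forall n,
     (N <= n)%N -> rnorm (u n x - X x) < eps.
Proof.
move=> uM uC; have ex x := hilbert_complete (uC x).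
pose f x := projT1 (cid (ex x)).
have fP x (eps : R) : 0 < eps -> exists N, forall n,
    (N <= n)%N -> rnorm (u n x - f x) < eps.
  by move: eps; rewrite /f; case: cid.
have f_lin : linear f.
  move=> c x y; apply: eq_of_close => eps eps0.
  have c1 : 0 < cabs c + 1 by rewrite ltr_wpDl ?cabs_ge0.
  have e3 : 0 < eps / 3 by rewrite divr_gt0.
  have [N1 P1] := fP (c *: x + y) _ e3.
  have [N2 P2] := fP x _ (divr_gt0 e3 c1).
  have [N3 P3] := fP y _ e3.
  pose n := maxn N1 (maxn N2 N3).
  have /P1 := leq_maxl N1 (maxn N2 N3).
  have /P2 : (N2 <= n)%N by rewrite !leq_max leqnn orbT.
  have /P3 : (N3 <= n)%N by rewrite !leq_max leqnn !orbT.
  rewrite -/n linearP => h3 + h1; rewrite ltr_pdivlMr// => h2.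
  have -> : f (c *: x + y) - (c *: f x + f y) =
      - (c *: u n x + u n y - f (c *: x + y)) +
      (c *: (u n x - f x) + (u n y - f y)).
    rewrite scalerBr opprB [in X in _ = _ + X]addrACA -opprD subrKA //.
  apply: (le_lt_trans (rnormD _ _)); rewrite rnormN.
  have := rnormD (c *: (u n x - f x)) (u n y - f y); rewrite rnormZ.
  have : cabs c * rnorm (u n x - f x) <= rnorm (u n x - f x) * (cabs c + 1).
    by rewrite mulrC ler_wpM2l ?rnorm_ge0// lerDl.
  lra.
have fM x : rnorm (f x) <= M * rnorm x.
  apply/ler_addgt0Pr => e e0; have [N NP] := fP x _ e0.
  have := NP N (leqnn _); rewrite rnormBC; have := uM N x.
  have := rnormD (u N x) (f x - u N x); rewrite addrCA subrr addr0; lra.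
by have [X XP] := bop_of f_lin fM; exists X => x; rewrite XP; exact: fP.
Qed.

Lemma opnorm_complete (u : nat -> bop H) :
  (forall eps : R, 0 < eps -> exists N, forall m n,
     (N <= m)%N -> (N <= n)%N -> opnorm (u m - u n) < eps) ->
  exists X : bop H, forall eps : R, 0 < eps -> exists N, forall n,
     (N <= n)%N -> opnorm (u n - X) < eps.
Proof.
move=> uC; have [N0 N0P] := uC 1 ltr01.
have [|x eps eps0|X XP] := @strong_limit (fun n => u (N0 + n)%N) (opnorm (u N0) + 1).
- move=> n x; have /ltW le1 := N0P (N0 + n)%N N0 (leq_addr _ _) (leqnn _).
  rewrite mulrDl mul1r; have := opnormP (u (N0 + n)%N - u N0) x.
  have := opnormP (u N0) x; have := rnormD (u N0 x) ((u (N0 + n)%N - u N0) x).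
  rewrite /= addrCA subrr addr0 => h1 h2 h3.
  apply: le_trans h1 _; apply: lerD => //; apply: le_trans h3 _.
  by rewrite ler_piMl ?rnorm_ge0.
- have x1 : 0 < rnorm x + 1 by rewrite ltr_wpDl ?rnorm_ge0.
  have [N NP] := uC _ (divr_gt0 eps0 x1); exists N => m n Nm Nn.
  have := NP (N0 + m)%N (N0 + n)%N; rewrite !(leq_trans _ (leq_addl _ _))//.
  move=> /(_ isT isT); rewrite ltr_pdivlMr//; apply: le_lt_trans.
  apply: le_trans (opnormP (u (N0 + m)%N - u (N0 + n)%N) x) _.
  by rewrite ler_wpM2l ?opnorm_ge0// lerDl.
- exists X => eps eps0; have [N NP] := uC _ (divr_gt0 eps0 (ltr0n R 2)).
  exists N => n Nn; apply: (@le_lt_trans _ _ (eps / 2)); last lra.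
  apply: opnorm_le => [|x]; first lra.
  apply/ler_addgt0Pr => d d0; have [N1 N1P] := XP x _ d0.
  pose m := maxn N N1; have := N1P m (leq_maxr _ _).
  have := NP n (N0 + m)%N Nn (leq_trans (leq_maxl N N1) (leq_addl _ _)).
  have := opnormP (u n - u (N0 + m)%N) x.
  have := rnormD (u n x - u (N0 + m)%N x) (u (N0 + m)%N x - X x).
  rewrite [in X in rnorm X <= _]addrA subrK /= => h1 h2 h3 h4.
  have : opnorm (u n - u (N0 + m)%N) * rnorm x <= eps / 2 * rnorm x.
    by rewrite ler_wpM2r ?rnorm_ge0 ?(ltW h3).
  lra.
Qed.

End Riesz.

HB.instance Definition _ (R : realType) (H : hilbertType R) :=
  isCStar.Build R (bop H) (@opnorm0_eq0 R H) (@opnormD R H) (@opnormZ R H)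
    (@opnormM R H) (@opnorm_complete R H) (@bop_starK R H) (@bop_starD R H)
    (@bop_starZ R H) (@bop_starM R H) (@opnorm_star_mul R H).

(** * Compact operators *)

Section Compact.
Variables (R : realType) (H : hilbertType R).
Implicit Types (X Y K P : bop H) (x y z : H).

Lemma ballE (x : H) (r : R) y : ball x r%:C y <-> rnorm (x - y) < r.
Proof. by rewrite -ball_normE /= rnormE ltcR. Qed.

(** In a complete space, totally bounded sets are precompact: an ultrafilter
    containing a finite union of small balls contains one of them, and so it
    is a Cauchy filter. *)
Lemma totally_bounded_precompact (A : set H) :
  (forall eps : R, 0 < eps -> exists s : seq H,
     forall x, A x -> exists2 z, z \in s & rnorm (z - x) < eps) ->
  precompact A.
Proof.
move=> Atb; rewrite precompactE compact_ultra => F FU FA.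
have : cauchy F.
  apply: cauchy_exP => eps eps0.
  have e0 : 0 < complex.Re eps / 2 by rewrite divr_gt0// Re_gt0.
  have [s sP] := Atb _ e0.
  have : F [set x | exists2 z, z \in s & ball z eps x].
    apply: filterS FA => x xA.
    have [|y [Ay]] := xA (ball x (complex.Re eps / 2)%:C).
      by apply: nbhsx_ballx; rewrite ltcR.
    move=> /ballE xy; have [z zs zy] := sP _ Ay; exists z => //.
    rewrite -(RRe_real (gtr0_real eps0)); apply/ballE.
    rewrite rnormBC in xy; rewrite -(subrKA y).
    by apply: le_lt_trans (rnormD _ _) _; lra.
  elim: s {sP} => [|z s IH] Fs.
    exists 0; apply: filterS Fs => x [z].
    by rewrite in_nil.
  have [Fz|Fz] := in_ultra_setVsetC (ball z eps) FU; first by exists z.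
  apply: IH; apply: filterS (filterI Fs Fz) => x [[y]].
  by rewrite inE => /orP[/eqP->//|ys ? _]; exists y.
move=> /cauchy_cvgP/cvg_ex[/= p Fp]; exists p; split=> //.
apply: closed_closure => B Bp; have FAB : F (closure A `&` B) by apply: filterI => //; exact: Fp.
exact: filter_ex FAB.
Qed.

Lemma compact_op_net K (eps : R) : K \in @compact_ops R H -> 0 < eps ->
  exists s : seq H, forall x, rnorm x <= 1 ->
    exists2 z, z \in s & rnorm (K x - z) < eps.
Proof.
move=> /compact_opsP; rewrite /compact_op precompactE compact_cover => cK eps0.
have [| |D' _ sub] := cK H setT (fun z => ball z eps%:C).
- by move=> z _; exact: ball_open.
- by move=> z _; exists z => //; apply: ballxx; rewrite ltcR.
exists (enum_fset D') => x x1.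
have /sub[z zD' /ballE zx] : closure (K @` [set x | `|x| <= 1]) (K x).
  by apply: compact_op_sub; rewrite rnormE lecR.
by exists z => //; rewrite rnormBC.
Qed.

Lemma ball1_bound X (eps : R) : 0 < eps ->
  (forall x, rnorm x <= 1 -> rnorm (X x) <= eps) ->
  forall x, rnorm (X x) <= eps * rnorm x.
Proof.
move=> eps0 X1 x; have [->|x0] := eqVneq x 0; first by rewrite raddf0 !rnorm0 mulr0.
have rx : 0 < rnorm x by rewrite lt0r rnorm_eq0 x0 rnorm_ge0.
rewrite -ler_pdivrMr//.
have cx : cabs ((rnorm x)^-1)%:C = (rnorm x)^-1 by rewrite cabs_real// invr_ge0 ltW.
have := X1 (((rnorm x)^-1)%:C *: x); rewrite linearZ /= !rnormZ cx.
by rewrite mulVf ?gt_eqF// lexx mulrC; apply.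
Qed.

(** A norm limit of compact operators maps the unit ball to a totally bounded
    set. *)
Lemma compact_ops_closed X : (forall eps : R, 0 < eps -> exists2 K,
    K \in @compact_ops R H & forall x, rnorm ((X - K) x) <= eps * rnorm x) ->
  X \in @compact_ops R H.
Proof.
move=> XK; apply/compact_opsP/totally_bounded_precompact => eps eps0.
have e2 : 0 < eps / 2 by rewrite divr_gt0.
have [K cK KX] := XK _ e2; have [s sP] := compact_op_net cK e2.
exists s => _ [x x1 <-]; rewrite /= rnormE lecR in x1.
have [z zs lez] := sP _ x1; exists z => //.
rewrite rnormBC -(subrKA (K x)); apply: le_lt_trans (rnormD _ _) _.
have : eps / 2 * rnorm x <= eps / 2 by rewrite ler_piMr// ltW.
by have := KX x; rewrite /=; lra.
Qed.

Definition finite_rank (F : bop H) :=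
  exists s : seq (H * H), forall x, F x = \sum_(p <- s) inner x p.2 *: p.1.

Lemma scale_continuous (v : H) : continuous (fun a : R => a%:C *: v).
Proof.
move=> a; apply/cvgrPdist_lt => eps eps0.
have v1 : 0 < rnorm v + 1 by rewrite ltr_wpDl ?rnorm_ge0.
have d0 : 0 < complex.Re eps / (rnorm v + 1) by rewrite divr_gt0// Re_gt0.
exists (complex.Re eps / (rnorm v + 1)) => //= b /= ab.
rewrite -scalerBl -rmorphB rnormE -(RRe_real (gtr0_real eps0)) ltcR rnormZ.
have -> : cabs (a - b)%:C = `|a - b|.
  by apply: (@complexI R); rewrite -cabsE normc_def /= expr0n addr0 sqrtr_sqr.
rewrite ltr_pdivlMr// in ab; apply: le_lt_trans ab.
by rewrite ler_wpM2l// lerDl.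
Qed.

(** The unit ball is mapped into the image of a square of R^2 under
    (a, b) |-> (a + i b) v. *)
Lemma rank1_compact X (v : H) (f : H -> R[i]) :
  (forall x, X x = f x *: v) -> X \in @compact_ops R H.
Proof.
move=> Xf; have [v0|v0] := eqVneq v 0.
  have -> : X = 0 by apply: bop_ext => x; rewrite Xf v0 scaler0.
  exact: rpred0.
have rv : 0 < rnorm v by rewrite lt0r rnorm_eq0 v0 rnorm_ge0.
have [M M0 XM] := bop_bound X.
pose B := M / rnorm v.
pose h (z : R * R) := z.1%:C *: v + z.2%:C *: ('i%C *: v).
apply/compact_opsP/(compact_opS (K := h @` (`[- B, B] `*` `[- B, B]))).
  apply: continuous_compact; last by apply: compact_setX; exact: segment_compact.
  apply: continuous_subspaceT => z; apply: cvgD.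
    apply: (@continuous_comp _ _ _ fst (fun a : R => a%:C *: v)).
      exact: cvg_fst.
    exact: scale_continuous.
  apply: (@continuous_comp _ _ _ snd (fun a : R => a%:C *: ('i%C *: v))).
    exact: cvg_snd.
  exact: scale_continuous.
move=> x; rewrite rnormE lecR => x1.
have fB : cabs (f x) <= B.
  rewrite ler_pdivlMr// -rnormZ -Xf; apply: le_trans (XM x) _.
  by rewrite ler_piMr.
have := normc_def (f x); rewrite cabsE => /(@complexI R) fE.
exists (complex.Re (f x), complex.Im (f x)) => /=; last first.
  by rewrite /h Xf /= scalerA mulrC -scalerDl -complexE.
have bnd (a b : R) : cabs (f x) = Num.sqrt (a ^+ 2 + b ^+ 2) -> `[- B, B]%classic a.
  move=> E; rewrite /= in_itv /= -ler_norml; apply: le_trans fB.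
  by rewrite E -sqrtr_sqr ler_wsqrtr// lerDl sqr_ge0.
by split=> /=; [exact: bnd fE|apply: (bnd _ (complex.Re (f x))); rewrite addrC].
Qed.

(** The operator |v><y| of Dirac's notation. *)
Definition ketbra_fun (v y x : H) := inner x y *: v.

Fact ketbra_bounded v y : bounded_op (ketbra_fun v y).
Proof.
split=> [c a b|]; first by rewrite /ketbra_fun innerDl innerZl scalerDl scalerA.
exists (rnorm v * rnorm y)%:C => x.
rewrite !rnormE -rmorphM lecR rnormZ mulrC -mulrA ler_wpM2l ?rnorm_ge0//.
by rewrite mulrC cauchy_schwarz.
Qed.

Definition ketbra v y : bop H := Bop (asboolT (ketbra_bounded v y)).

Lemma finite_rank_compact F : finite_rank F -> F \in @compact_ops R H.
Proof.
move=> [s Fs]; have -> : F = \sum_(p <- s) ketbra p.1 p.2.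
  apply: bop_ext => x; rewrite Fs.
  elim: s {Fs} => [|p s IH]; first by rewrite !big_nil.
  by rewrite !big_cons /= IH.
apply: rpred_sum => p _.
by apply: (@rank1_compact _ p.1 (fun x => inner x p.2)).
Qed.

Lemma finite_rank_mull X F : finite_rank F -> finite_rank (X * F).
Proof.
move=> [s Fs]; exists [seq (X p.1, p.2) | p <- s] => x.
rewrite big_map /= Fs raddf_sum /=.
by apply: eq_bigr => p _; rewrite linearZ.
Qed.

Lemma finite_rank_ker F : finite_rank F ->
  exists n (phi : H -> 'rV[R[i]]_n),
    linear phi /\ forall x, phi x = 0 -> F x = 0.
Proof.
move=> [s Fs]; exists (size s), (fun x => \row_i inner x (nth (0, 0) s i).2).
split=> [c x y|x /rowP phix].
  by apply/rowP => i; rewrite !mxE innerDl innerZl.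
rewrite Fs (big_nth (0, 0)) big_mkord big1// => i _.
by have := phix i; rewrite !mxE => ->; rewrite scale0r.
Qed.

Lemma projection_inner P : projection P -> forall x y, inner (P x) (y - P y) = 0.
Proof.
move=> [PP Ps] x y; rewrite adjointP Ps raddfB /=.
have -> : P (P y) = P y by rewrite -[in RHS]PP.
by rewrite subrr inner0r.
Qed.

Lemma projection_compl_le P x : projection P -> rnorm (x - P x) <= rnorm x.
Proof.
move=> PP; rewrite -(@ler_pXn2r _ 2) ?nnegrE ?rnorm_ge0//.
rewrite -[in leRHS](subrK (P x) x) [in leRHS]addrC [leRHS]pythagoras ?projection_inner//.
by rewrite lerDr sqr_ge0.
Qed.

(** Gram-Schmidt: a finite set lies in the range of a projection of finite rank. *)
Lemma finite_rank_projection (s : seq H) : exists P : bop H,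
  [/\ projection P, finite_rank P & forall z, z \in s -> P z = z].
Proof.
elim: s => [|z s [P [[PP Ps] [t Pt] Psz]]].
  exists 0; split=> //; first by split; [rewrite mulr0|exact: bop_star0].
  by exists [::] => x; rewrite big_nil.
have PPx x : P (P x) = P x by rewrite -[in RHS]PP.
have [z0|z0] := eqVneq (z - P z) 0.
  exists P; split=> [//||y]; first by exists t.
  rewrite inE => /orP[/eqP->|]; last exact: Psz.
  by apply/esym/eqP; rewrite -subr_eq0 z0.
have [w wE] : exists w, w = z - P z by exists (z - P z).
have Pw : P w = 0 by rewrite wE raddfB /= PPx subrr.
rewrite -wE in z0.
have dw : inner w w != 0 by apply/eqP => /inner_eq0 w0; rewrite w0 eqxx in z0.
have cw : conjc (inner w w) = inner w w by rewrite -inner_conj.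
have [Q QE] : exists Q : bop H, forall x, Q x = (inner x w / inner w w) *: w.
  by exists (ketbra ((inner w w)^-1 *: w) w) => x; rewrite /= /ketbra_fun scalerA.
have Pinner x : inner (P x) w = 0 by rewrite adjointP Ps Pw inner0r.
exists (P + Q); split.
- split.
    apply: bop_ext => x; rewrite /= !QE !raddfD /= !linearZ /= PPx Pw scaler0 addr0.
    rewrite innerDl Pinner add0r innerZl -mulrA mulfV// mulr1.
    by [].
  rewrite bop_starD Ps; congr (_ + _); apply: star_unique => x y; rewrite !QE.
  rewrite innerZl innerZr rmorphM fmorphV/= cw -inner_conj.
  by rewrite mulrAC [RHS]mulrAC [inner x w * _]mulrC.
- exists (((inner w w)^-1 *: w, w) :: t) => x.
  by rewrite big_cons /= QE Pt addrC scalerA.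
- move=> y; rewrite inE => /orP[/eqP->|ys].
    rewrite /= QE; have -> : inner z w = inner w w.
      by rewrite -[in LHS](subrK (P z) z) -wE innerDl Pinner addr0.
    by rewrite mulfV// scale1r wE addrC subrK.
  rewrite /= QE Psz// -[y in inner y](Psz y ys) Pinner mul0r scale0r addr0.
  by [].
Qed.

(** P is the projection onto the span of a finite eps-net of the image of the
    unit ball under K. *)
Lemma compact_approx K (eps : R) : K \in @compact_ops R H -> 0 < eps ->
  exists P : bop H, [/\ projection P, finite_rank P
    & forall x, rnorm (K x - P (K x)) <= eps * rnorm x].
Proof.
move=> cK eps0; have [s sP] := compact_op_net cK eps0.
have [P [PP Pf Ps]] := finite_rank_projection s.
exists P; split=> //; apply: (ball1_bound (X := K - P * K)) => // x x1 /=.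
have [z zs lez] := sP _ x1.
have -> : K x - P (K x) = (K x - z) - P (K x - z).
  by rewrite [P (K x - z)]raddfB /= (Ps z zs) opprB addrA subrK.
by apply: le_trans (projection_compl_le _ PP) _; exact: ltW.
Qed.

Lemma rnorm_adjoint X (c : R) : (forall x, rnorm (X x) <= c * rnorm x) ->
  0 <= c -> forall x, rnorm (star X x) <= c * rnorm x.
Proof.
move=> Xc c0 x; apply: le_trans (opnormP _ _) _.
rewrite ler_wpM2r ?rnorm_ge0//; apply: le_trans (opnorm_star_le X) _.
exact: opnorm_le.
Qed.

Lemma projection1B P : projection P -> projection (1 - P).
Proof.
move=> [PP Ps]; split; last by rewrite bop_starD bop_starN bop_star1 Ps.
by rewrite mulrBl mul1r mulrBr mulr1 PP subrr subr0.
Qed.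

(** Schauder: if P K approximates K then K^* P approximates K^*. *)
Lemma compact_star K : K \in @compact_ops R H -> star K \in @compact_ops R H.
Proof.
move=> cK; apply: compact_ops_closed => eps eps0.
have [P [[PP Ps] Pf KP]] := compact_approx cK eps0.
exists (star K * P); first exact/finite_rank_compact/finite_rank_mull.
have -> : star K - star K * P = star ((1 - P) * K).
  by rewrite bop_starM (projection1B (conj PP Ps)).2 mulrBr mulr1.
apply: rnorm_adjoint; last exact: ltW.
by move=> x; have := KP x; rewrite mulrBl mul1r.
Qed.

(** The adjoint on the Calkin algebra is defined through a chosen lift; it can be
    computed with any lift since adjoints of compact operators are compact. *)
Lemma star_pi X : star (calkin_pi X) = calkin_pi (star X).
Proof.
apply/calkin_eqP; rewrite -bop_starN -bop_starD; apply: compact_star.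
by apply/calkin_eqP; rewrite calkin_reprK.
Qed.

End Compact.

(** * The index of essentially invertible elements of the Calkin algebra *)

Section HilbertIndex.
Variables (R : realType) (H : hilbertType R).
Implicit Types (X Y K P S E F G : bop H) (x y : calkin H).

Lemma bop_linear_on (V : set H) X : @linear_on _ H H V X.
Proof. by move=> c a b _ _; rewrite linearP. Qed.

Lemma projectionK E (a : H) : projection E -> E (E a) = E a.
Proof. by move=> [EE _]; rewrite -[in RHS]EE. Qed.

Lemma rangeE E (a : H) : projection E -> range E a <-> E a = a.
Proof. by move=> EP; split=> [[b _ <-]|<-]; [exact: projectionK|exists a]. Qed.

Lemma range_subspace X : @lin_subspace _ H (range X).
Proof.
split=> [|c _ _ [a _ <-] [b _ <-]]; first by exists 0; rewrite ?raddf0.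
by exists (c *: a + b); rewrite ?linearP.
Qed.

Lemma projection_le E (a : H) : projection E -> rnorm (E a) <= rnorm a.
Proof.
move=> EP; have := projection_compl_le a (projection1B EP).
by rewrite /= opprB addrCA subrr addr0.
Qed.

(** Iterate a |-> b - S a. *)
Lemma contraction_solve S (b : H) : (forall a, rnorm (S a) <= 2^-1 * rnorm a) ->
  exists a, a + S a = b.
Proof.
move=> Sc.
have [u [u0 uE]] : exists u : nat -> H, u 0%N = 0 /\ forall n, u n.+1 = b - S (u n).
  by exists (fix u n := if n is m.+1 then b - S (u m) else 0).
have uS n : u n.+2 - u n.+1 = - S (u n.+1 - u n).
  rewrite (uE n.+1) {2}(uE n) (raddfB S) /= !opprB [LHS]addrC addrA addrNK.
  by [].
have uC n : rnorm (u n.+1 - u n) <= rnorm b / 2 ^+ n.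
  elim: n => [|n IH]; first by rewrite uE u0 raddf0 !subr0 expr0 divr1.
  rewrite uS rnormN; apply: le_trans (Sc _) _.
  by rewrite exprS invfM mulrCA ler_wpM2l// invr_ge0.
have := geometric_cauchy (@rnormN _ H) (@rnormD _ H) (@rnorm0 _ H) uC.
move=> /hilbert_complete[a aP]; exists a; apply: eq_of_close => eps eps0.
have [N NP] := aP _ (divr_gt0 eps0 (ltr0n R 2)).
have h1 := NP N.+1 (leqnSn _); have h2 := NP N (leqnn _).
have -> : a + S a - b = (a - u N.+1) - S (u N - a).
  rewrite (raddfB S) /= uE !opprB -addrA -[RHS]addrA; congr (_ + _).
  by rewrite [RHS]addrC addrA subrK.
apply: le_lt_trans (rnormB _ _) _; rewrite rnormBC.
have := Sc (u N - a); have := rnorm_ge0 (u N - a); lra.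
Qed.

(** F. Riesz: K = (1 - P) K + P K with (1 - P) K small and P K of finite rank;
    adding the first part to E gives a bijection of E H, and the second one
    does not change the index. *)
Lemma index_compact E K : projection E -> K \in @compact_ops R H ->
  E * K * E = K -> has_index (range E) (range E) (E + K) 0.
Proof.
move=> EP cK EKE.
have EK a : E (K a) = K a by rewrite -EKE /= projectionK.
have h0 : 0 < 2^-1 :> R by rewrite invr_gt0.
have [P [PP Pf KP]] := compact_approx cK h0.
have [d [phi [phi_lin phiP]]] := finite_rank_ker Pf.
pose S := E * (1 - P) * K.
have SE a : S a = E (K a - P (K a)) by [].
have Sc a : rnorm (S a) <= 2^-1 * rnorm a.
  by rewrite SE; apply: le_trans (projection_le _ EP) _; exact: KP.
have VP := range_subspace E.
apply: (@index_perturb _ _ _ (range E) (range E) (E + S) _ _ _ _ 0 d (phi \o K)) => //.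
- exact: bop_linear_on.
- by move=> c a b _ _; rewrite /= linearP phi_lin.
- move=> a _ /phiP PK0; congr (_ + _).
  by rewrite /= PK0 subr0 EK.
apply: index_iso => //.
- move=> a b; rewrite !inE => /(rangeE _ EP) Ea /(rangeE _ EP) Eb /= eqab.
  have Sab : S (a - b) = b - a.
    rewrite Ea Eb in eqab; rewrite (raddfB S) /=; apply/eqP; rewrite subr_eq.
    by apply/eqP/(addrI a); rewrite eqab addrA [a + _]addrC subrK.
  apply/eqP; rewrite -subr_eq0 -rnorm_eq0 eq_le rnorm_ge0 andbT.
  have := Sc (a - b); rewrite Sab rnormBC; have := rnorm_ge0 (a - b); lra.
- apply/seteqP; split=> [_ [a _ <-]|b /(rangeE _ EP) Eb].
    by apply/rangeE => //=; rewrite raddfD /= !projectionK.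
  have [a aS] := contraction_solve b Sc.
  have Ea : E a = a.
    by rewrite -[a](addrK (S a)) aS raddfB /= Eb !projectionK.
  by exists a; [apply/rangeE|rewrite /= Ea].
Qed.

(** Compressed to the corners, y is an inverse of x : e -> f in the Calkin
    algebra, where e and f are the classes of E and F. *)
Definition ess_inverse E F x y :=
  calkin_pi E * y * calkin_pi F * x * calkin_pi E = calkin_pi E /\
  calkin_pi F * x * calkin_pi E * y * calkin_pi F = calkin_pi F.

(** The index of x as a map from E H to F H, the same for all lifts X. *)
Definition eind E F x (k : int) :=
  (exists y, ess_inverse E F x y) /\
  forall X, calkin_pi X = x -> has_index (range E) (range F) (F * X * E) k.

Lemma calkin_pi_mul X Y : calkin_pi (X * Y) = calkin_pi X * calkin_pi Y.
Proof. exact: calkin_piM. Qed.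

Lemma calkin_pi_sub X Y : calkin_pi (X - Y) = calkin_pi X - calkin_pi Y.
Proof. exact: raddfB. Qed.

Lemma range_corner E F X (a : H) : projection F -> range F ((F * X * E) a).
Proof. by move=> FP; apply/rangeE => //=; rewrite projectionK. Qed.

(** On E H the product is E + K with K compact. *)
Lemma index_parametrix E F X Y : projection E -> projection F ->
  calkin_pi E * calkin_pi Y * calkin_pi F * calkin_pi X * calkin_pi E = calkin_pi E ->
  has_index (range E) (range E) ((E * Y * F : bop H) \o (F * X * E : bop H)) 0.
Proof.
move=> EP FP YX.
pose K := E * Y * F * (F * X * E) - E.
have -> : (E * Y * F : bop H) \o (F * X * E : bop H) = E + K.
  by apply/funext => a; rewrite /= addrCA subrr addr0.
apply: index_compact => //.
  apply/calkin_eqP; rewrite !calkin_pi_mul -[RHS]YX.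
  rewrite -!mulrA [calkin_pi F * (calkin_pi F * _)]mulrA -calkin_pi_mul.
  by rewrite FP.1.
rewrite /K mulrBr mulrBl EP.1 EP.1 -!mulrA EP.1 !mulrA EP.1.
by [].
Qed.

Section Index.
Variables E F : bop H.
Hypotheses (EP : projection E) (FP : projection F).

(** For lifts X and Y of x and y the indices of F X E and E Y F are opposite to
    each other; as they can be chosen independently, neither depends on its
    lift. *)
Lemma eind_exists x y : ess_inverse E F x y ->
  exists k, eind E F x k /\ eind F E y (- k).
Proof.
move=> [yx xy].
have VE := range_subspace E; have VF := range_subspace F.
have comp0 X Y : calkin_pi X = x -> calkin_pi Y = y ->
    has_index (range E) (range E) ((E * Y * F : bop H) \o (F * X * E : bop H)) 0 /\
    has_index (range F) (range F) ((F * X * E : bop H) \o (E * Y * F : bop H)) 0.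
  by move=> XE YE; split; apply: index_parametrix => //; rewrite XE YE.
have ex X Y : calkin_pi X = x -> calkin_pi Y = y ->
    exists k, has_index (range E) (range F) (F * X * E) k /\
              has_index (range F) (range E) (E * Y * F) (- k).
  move=> XE YE; have [cE cF] := comp0 X Y XE YE.
  have [k kP] : exists k, has_index (range E) (range F) (F * X * E) k.
    apply: (index_factor VE VF _ _ _ _ cE cF) => [||a _|a _];
      by [exact: bop_linear_on|exact: range_corner].
  have [l lP] : exists k, has_index (range F) (range E) (E * Y * F) k.
    apply: (index_factor VF VE _ _ _ _ cF cE) => [||a _|a _];
      by [exact: bop_linear_on|exact: range_corner].
  exists k; split=> //; suff : k + l = 0 by move=> kl; have -> : - k = l by lia.
  apply: index_uniq cE => //; first exact: (bop_linear_on (_ * _)).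
  by apply: index_comp kP lP => //; exact: bop_linear_on.
have XE := calkin_reprK x; have YE := calkin_reprK y.
have [k [kX kY]] := ex _ _ XE YE.
exists k; split; (split; first by [exists y|exists x]) => Z ZE.
  have [l [lZ lY]] := ex _ _ ZE YE.
  have := index_uniq VF VE (@bop_linear_on _ _) kY lY.
  by move/oppr_inj => ->.
have [l [lX lZ]] := ex _ _ XE ZE.
by rewrite (index_uniq VE VF (@bop_linear_on _ _) kX lX).
Qed.

Lemma eind_uniq x k l : eind E F x k -> eind E F x l -> k = l.
Proof.
move=> [_ kP] [_ lP]; have := lP _ (calkin_reprK x); have := kP _ (calkin_reprK x).
by apply: index_uniq; [exact: range_subspace|exact: range_subspace|exact: bop_linear_on].
Qed.

Lemma eind_lift x y X k : ess_inverse E F x y -> calkin_pi X = x ->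
  has_index (range E) (range F) (F * X * E) k -> eind E F x k.
Proof.
move=> xy XE kX; have [l [lP _]] := eind_exists xy.
have -> : k = l; last by [].
apply: index_uniq kX (lP.2 _ XE);
  by [exact: range_subspace|exact: bop_linear_on].
Qed.

(** Operators that are inverse to each other exactly, and not only up to compact
    operators, have index 0. *)
Lemma eind_iso X Y :
  E * Y * F * X * E = E -> F * X * E * Y * F = F -> eind E F (calkin_pi X) 0.
Proof.
move=> YX XY; apply: (@eind_lift _ (calkin_pi Y) X) => //.
  by split; rewrite -!calkin_pi_mul ?YX ?XY.
have YXE a : E a = a -> E (Y (F (X (E a)))) = a.
  by move=> Ea; rewrite -[RHS]Ea -[in RHS]YX.
apply: index_iso; [exact: range_subspace..| |].
  move=> a b; rewrite !inE => /(rangeE _ EP) Ea /(rangeE _ EP) Eb /= eqab.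
  by rewrite -(YXE a Ea) eqab YXE.
apply/seteqP; split=> [_ [a _ <-]|b /(rangeE _ FP) Fb]; first exact: range_corner.
exists (E (Y b)); first by exists (Y b).
by rewrite /= projectionK// -[RHS]Fb -[in RHS]XY /= Fb.
Qed.

End Index.

Lemma eind_comp E F G x y k l : projection E -> projection F -> projection G ->
  eind E F x k -> eind F G y l -> eind E G (y * calkin_pi F * x) (k + l).
Proof.
move=> EP FP GP [[x' [x'x xx']] kP] [[y' [y'y yy']] lP].
have inv : ess_inverse E G (y * calkin_pi F * x) (x' * calkin_pi F * y').
  split.
    rewrite -[RHS]x'x -[in RHS]y'y !mulrA.
    by [].
  by rewrite -[RHS]yy' -[in RHS]xx' !mulrA.
apply: (eind_lift EP GP inv (X := repr y * F * repr x)).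
  by rewrite !calkin_pi_mul !calkin_reprK.
have := index_comp (range_subspace E) (range_subspace F) (range_subspace G)
  (@bop_linear_on _ _) (@bop_linear_on _ _) (kP _ (calkin_reprK x))
  (lP _ (calkin_reprK y)).
congr has_index; apply/funext => a /=.
by rewrite projectionK.
Qed.

Lemma projectionD E F : projection E -> projection F -> E * F = 0 ->
  projection (E + F) /\ F * E = 0.
Proof.
move=> [EE Es] [FF Fs] EF; have FE : F * E = 0.
  by rewrite -Es -Fs -bop_starM EF bop_star0.
split=> //; split; last by rewrite bop_starD Es Fs.
by rewrite mulrDr !mulrDl EE FF EF FE addr0 add0r.
Qed.

Lemma direct_sum_range E F : projection E -> projection F -> E * F = 0 ->
  direct_sum (range (E + F)) (range E) (range F) E F.
Proof.
move=> EP FP EF; have [EFP FE] := projectionD EP FP EF.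
have EF0 a : E (F a) = 0 by rewrite -[E (F a)]/((E * F) a) EF.
have FE0 a : F (E a) = 0 by rewrite -[F (E a)]/((F * E) a) FE.
split; try exact: bop_linear_on.
- move=> a /(rangeE _ EFP) Ea; split; [by exists a|by exists a|by rewrite -[LHS]Ea].
- move=> a /(rangeE _ EP) Ea; split=> //; last by rewrite -Ea FE0.
  by apply/rangeE => //=; rewrite -{2}Ea FE0 addr0.
- move=> a /(rangeE _ FP) Fa; split=> //; last by rewrite -Fa EF0.
  by apply/rangeE => //=; rewrite -{1}Fa EF0 add0r.
Qed.

(** The off-diagonal blocks of any lift are compact; once they are subtracted the
    lift is a direct sum. *)
Lemma eind_sum E E' F F' x k k' :
  projection E -> projection E' -> projection F -> projection F' ->
  E * E' = 0 -> F * F' = 0 ->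
  calkin_pi F * x * calkin_pi E' = 0 -> calkin_pi F' * x * calkin_pi E = 0 ->
  eind E F x k -> eind E' F' x k' -> eind (E + E') (F + F') x (k + k').
Proof.
move=> EP E'P FP F'P EE' FF' FxE' F'xE [[y [yx xy]] kP] [[y' [y'x xy']] kP'].
have [EEP E'E] := projectionD EP E'P EE'.
have [FFP F'F] := projectionD FP F'P FF'.
set e := calkin_pi E in FxE' F'xE yx xy *; set e' := calkin_pi E' in FxE' F'xE y'x xy' *.
set f := calkin_pi F in FxE' F'xE yx xy *; set f' := calkin_pi F' in FxE' F'xE y'x xy' *.
have ee : e * e = e by rewrite -calkin_pi_mul EP.1.
have ee' : e' * e' = e' by rewrite -calkin_pi_mul E'P.1.
have ff : f * f = f by rewrite -calkin_pi_mul FP.1.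
have ff' : f' * f' = f' by rewrite -calkin_pi_mul F'P.1.
have pi0 : calkin_pi 0 = 0 :> calkin H by exact: raddf0.
have fE : f * f' = 0 by rewrite -calkin_pi_mul FF' pi0.
have f'E : f' * f = 0 by rewrite -calkin_pi_mul F'F pi0.
have eE : e * e' = 0 by rewrite -calkin_pi_mul EE' pi0.
have e'E : e' * e = 0 by rewrite -calkin_pi_mul E'E pi0.
have blk : (f + f') * x * (e + e') = f * x * e + f' * x * e'.
  by rewrite !mulrDl !mulrDr FxE' F'xE addr0 add0r.
pose z := e * y * f + e' * y' * f'.
have inv : ess_inverse (E + E') (F + F') x z.
  rewrite /ess_inverse !calkin_piD -/e -/e' -/f -/f'.
  have -> : (e + e') * z * (f + f') = z.
    rewrite /z !mulrDl !mulrDr !mulrA ee ee' eE e'E !mul0r !addr0 !add0r.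
    by rewrite -!mulrA ff ff' fE f'E !mulr0 addr0 add0r !mulrA.
  have zf : z = z * (f + f').
    rewrite /z mulrDl !mulrDr -!mulrA ff ff' fE f'E !mulr0 addr0 add0r !mulrA.
    by [].
  have zE : (e + e') * z = z.
    by rewrite /z mulrDr !mulrDl !mulrA ee ee' eE e'E !mul0r !addr0 !add0r.
  split.
    rewrite zf -!mulrA !(mulrA _ x) blk.
    rewrite /z mulrDl !mulrDr !mulrA.
    rewrite -(mulrA (e * y) f f) ff -(mulrA (e' * y') f' f) f'E.
    rewrite -(mulrA (e * y) f f') fE -(mulrA (e' * y') f' f') ff'.
    by rewrite !mulr0 !mul0r yx y'x addr0 add0r.
  rewrite -[_ * z * _]mulrA -zf blk.
  rewrite /z mulrDl !mulrDr !mulrA.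
  rewrite -(mulrA (f * x) e e) ee -(mulrA (f' * x) e' e) e'E.
  rewrite -(mulrA (f * x) e e') eE -(mulrA (f' * x) e' e') ee'.
  by rewrite !mulr0 !mul0r xy xy' addr0 add0r.
have [X XE] : exists X, calkin_pi X = x by exists (repr x); exact: calkin_reprK.
(* x has no off-diagonal blocks, so B is another lift of it *)
pose B := X - F * X * E' - F' * X * E.
have BE : calkin_pi B = x.
  rewrite /B !calkin_pi_sub !calkin_pi_mul XE.
  by rewrite FxE' F'xE !subr0.
apply: (eind_lift EEP FFP inv BE).
have EF0 (a : H) : E (E' a) = 0 by rewrite -[E (E' a)]/((E * E') a) EE'.
have FE0 (a : H) : E' (E a) = 0 by rewrite -[E' (E a)]/((E' * E) a) E'E.
have BP (a : H) : ((F + F') * B * (E + E')) a = F (X (E a)) + F' (X (E' a)).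
  have FF0 (b : H) : F (F' b) = 0 by rewrite -[F (F' b)]/((F * F') b) FF'.
  have F'F0 (b : H) : F' (F b) = 0 by rewrite -[F' (F b)]/((F' * F) b) F'F.
  have [b [bE [Eb E'b]]] : exists b, b = E a + E' a /\ E b = E a /\ E' b = E' a.
    exists (E a + E' a); rewrite !raddfD /= EF0 FE0 addr0 add0r.
    by rewrite !projectionK.
  rewrite -[LHS]/((F + F') (X (E a + E' a) - F (X (E' (E a + E' a)))
    - F' (X (E (E a + E' a))))) -bE Eb E'b bE (raddfD X) /=.
  rewrite !(raddfB F) !(raddfB F') !(raddfD F) !(raddfD F') /=.
  rewrite FF0 F'F0 !(projectionK _ FP) !(projectionK _ F'P) !subr0.
  by rewrite addrK [F' _ + _]addrC addrK.
apply: (index_sum (range_subspace _) (range_subspace _) (direct_sum_range EP E'P EE')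
  (direct_sum_range FP F'P FF')).
- exact: bop_linear_on.
- move=> a /(rangeE _ EP) Ea; rewrite BP -Ea FE0 !raddf0 addr0.
  by apply/rangeE => //; rewrite projectionK.
- move=> a /(rangeE _ E'P) Ea; rewrite BP -Ea EF0 !raddf0 add0r.
  by apply/rangeE => //; rewrite projectionK.
- apply: index_ext (kP _ XE); try exact: range_subspace; try exact: bop_linear_on.
  by move=> a /(rangeE _ EP) Ea; rewrite BP -Ea FE0 !raddf0 addr0.
- apply: index_ext (kP' _ XE); try exact: range_subspace; try exact: bop_linear_on.
  by move=> a /(rangeE _ E'P) Ea; rewrite BP -Ea EF0 !raddf0 add0r.
Qed.

End HilbertIndex.

(** * Kernels, cokernels and the corner index *)

Section Bridge.
Variables (R : realType) (H : hilbertType R).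
Implicit Types (X Y K P S E F G : bop H) (x y : calkin H) (V W : set H).

(** The coordinates on V / W and the basis of V modulo W determine each other. *)
Lemma dim_quotientP V W n : @lin_subspace _ H V -> @lin_subspace _ H W -> W `<=` V ->
  dim_quotient V W n <-> codim V W n.
Proof.
move=> VP WP WV; split=> [[b [Vb bP]]|[phi [phiP Wphi phi_onto]]].
  have Vsum (c : {ffun 'I_n -> R[i]}) : V (\sum_(i < n) c i *: b i).
    by apply: subspace_sum => // i; exact: subspaceZ.
  have ex a : exists c : {ffun 'I_n -> R[i]}, V a -> W (a - \sum_(i < n) c i *: b i).
    have [/bP[c [Wc _]]|nV] := pselect (V a); first by exists c.
    by exists [ffun=> 0].
  pose c a := projT1 (cid (ex a)).
  have cP a : V a -> W (a - \sum_(i < n) c a i *: b i) by rewrite /c; case: cid.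
  have cE a (d : {ffun 'I_n -> R[i]}) : V a -> W (a - \sum_(i < n) d i *: b i) -> c a = d.
    move=> Va Wd; have [d' [_ d'P]] := bP _ Va.
    by rewrite -(d'P _ (cP _ Va)) -(d'P _ Wd).
  exists (fun a => \row_i c a i); split=> [z a a' Va Va'|a|r].
  - rewrite (cE _ [ffun i => z * c a i + c a' i]).
    + by apply/rowP => i; rewrite !mxE ffunE.
    + exact: (proj2 VP).
    + have := (proj2 WP) z _ _ (cP _ Va) (cP _ Va').
      congr W; rewrite scalerBr addrACA -opprD scaler_sumr -big_split /=.
      by congr (_ - _); apply: eq_bigr => i _; rewrite ffunE scalerDl scalerA.
  - split=> [Wa|[Va /rowP ca]].
      split; first exact: WV.
      apply/rowP => i; rewrite !mxE (cE a [ffun=> 0]) ?ffunE//; first exact: WV.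
      by rewrite big1 ?subr0// => j _; rewrite ffunE scale0r.
    have := cP _ Va; rewrite big1 ?subr0// => i _.
    by have := ca i; rewrite !mxE => ->; rewrite scale0r.
  - exists (\sum_(i < n) [ffun j => r 0 j] i *: b i); first exact: Vsum.
    apply/rowP => i; rewrite mxE (cE _ [ffun j => r 0 j]) ?ffunE//.
    by rewrite subrr; case: WP.
have [s [sP Vs sK]] := codim_section VP phiP phi_onto.
pose sS := GRing.isLinear.Build _ _ _ _ _ sP.
pose sL : {linear 'rV[R[i]]_n -> H} := HB.pack s sS.
have sE (c : 'I_n -> R[i]) : \sum_(i < n) c i *: s (delta_mx 0 i) = s (\row_i c i).
  rewrite [RHS](_ : _ = sL (\row_i c i))// [X in sL X]row_sum_delta linear_sum.
  by apply: eq_bigr => i _; rewrite linearZ mxE.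
exists (fun i => s (delta_mx 0 i)); split=> // a Va.
exists [ffun i => phi a 0 i]; split.
  rewrite sE; apply/Wphi; split; first exact: subspaceB.
  rewrite (linear_onB VP)// sK; apply/eqP; rewrite subr_eq0; apply/eqP/rowP => i.
  by rewrite mxE ffunE.
move=> c; rewrite sE => /Wphi[_]; rewrite (linear_onB VP)// sK => /eqP.
by rewrite subr_eq0 => /eqP ->; apply/ffunP => i; rewrite ffunE mxE.
Qed.

Lemma subspace0 : @lin_subspace _ H [set 0].
Proof. by split=> // c a b -> ->; rewrite scaler0 addr0. Qed.

Section Fredholm.
Variables E X : bop H.
Hypotheses (EP : projection E) (EXE : E * X * E = X).

Let VP := range_subspace E.

Let VX a : range E (X a).
Proof. by apply/rangeE => //; rewrite -EXE /= projectionK. Qed.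

Let N := range E `&` [set a | X a = 0].

Let NP : @lin_subspace _ H N.
Proof. exact: (linear_on_ker VP (@bop_linear_on _ _ _ X)). Qed.

Let XP : @lin_subspace _ H (X @` range E).
Proof. exact: (linear_on_image VP (@bop_linear_on _ _ _ X)). Qed.

Let XV : X @` range E `<=` range E.
Proof. by move=> _ [a _ <-]; exact: VX. Qed.

(** The complement of ker X in E H is the orthogonal one. *)
Lemma fredholm_has_index k : fredholm_index E X k ->
  has_index (range E) (range E) X k.
Proof.
move=> [m [n [Nm Xn ->]]].
have /(dim_quotientP _ VP XP XV) cX := Xn.
have N0 : [set 0] `<=` N by move=> _ ->; case: NP.
have /(dim_quotientP _ NP subspace0 N0) cN := Nm.
have [b [_ bN]] := Nm.
pose phi a : 'rV[R[i]]_m := \row_i inner a (b i).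
have phi_lin : linear phi.
  by move=> c u v; apply/rowP => i; rewrite !mxE innerDl innerZl.
have phiP W : linear_on W phi by move=> c u v _ _; exact: phi_lin.
have phiB u v : phi (u - v) = phi u - phi v.
  by apply/rowP => i; rewrite !mxE innerBl.
have phi_inj a : N a -> phi a = 0 -> a = 0.
  move=> Na /rowP phia; have [c [/= /eqP aE _]] := bN _ Na.
  rewrite subr_eq0 in aE; apply: inner_eq0; rewrite {2}(eqP aE) inner_bigr.
  by rewrite big1// => i _; rewrite innerZr; have := phia i; rewrite !mxE => ->; rewrite mulr0.
have phi_onto r : exists2 a, N a & phi a = r.
  have [psi [psiP zP psi_onto]] := cN.
  have [s [sP Ns sK]] := codim_section NP psiP psi_onto.
  have lP : linear (phi \o s) by move=> c u v /=; rewrite sP phi_lin.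
  pose lS := GRing.isLinear.Build _ _ _ _ _ lP.
  pose l : {linear 'rV[R[i]]_m -> 'rV[R[i]]_m} := HB.pack (phi \o s) lS.
  have : row_free (lin1_mx l).
    apply/inj_row_free => u; rewrite mul_rV_lin1 /= => /(phi_inj _ (Ns u)) su0.
    have := sK u; rewrite su0 => <-; exact: linear_on0 NP psiP.
  rewrite row_free_unit => lU; exists (s (r *m invmx (lin1_mx l))); first exact: Ns.
  by rewrite -[LHS](mul_rV_lin1 l) mulmxKV.
exists (range E `&` [set a | phi a = 0]), m, n; split=> //.
- exists phi; split=> // r.
  by have [a [Va _] phia] := phi_onto r; exists a.
- have -> // : X @` (range E `&` [set a | phi a = 0]) = X @` range E.
  apply/seteqP; split=> [_ [a [Va _] <-]|_ [a Va <-]]; first by exists a.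
  have [c [Vc Xc] phic] := phi_onto (phi a).
  exists (a - c); last by rewrite raddfB /= Xc subr0.
  by split; [exact: subspaceB|rewrite /= phiB phic subrr].
- move=> u v; rewrite !inE => -[Vu phiu] [Vv phiv] Xuv.
  apply/eqP; rewrite -subr_eq0; apply/eqP/phi_inj.
    by split; [exact: subspaceB|rewrite /= raddfB /= Xuv subrr].
  by rewrite phiB phiu phiv subrr.
Qed.

(** On ker X the coordinates modulo V0 are injective, since X is injective on V0. *)
Lemma has_index_fredholm k : has_index (range E) (range E) X k ->
  fredholm_index E X k.
Proof.
move=> kP; have [V0 [m [n [VV0 VX0 inj0 _]]]] := kP.
have [phi [phiP V0P _]] := VV0.
have V00 : V0 0 by case: (codim_subspace VP VV0).
have [m' cm'] : exists m', codim N [set 0] m'.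
  apply: (codim_ker (phi := phi)) => //.
    by apply: sub_linear_on phiP => a [].
  move=> a; split=> [->|[[Va Xa] phia]].
    by split; [case: NP|exact: linear_on0 VP phiP].
  apply: inj0; rewrite ?inE ?raddf0//.
  by apply/V0P.
have [n' cn'] : exists n', codim (range E) (X @` range E) n'.
  apply: codim_between VX0 => //.
  by move=> _ [a /(codim_sub VV0) Va <-]; exists a.
have N0 : [set 0] `<=` N by move=> _ ->; case: NP.
have fP : fredholm_index E X (m'%:Z - n'%:Z).
  exists m', n'; split=> //; first exact/(dim_quotientP _ NP subspace0 N0).
  exact/(dim_quotientP _ VP XP XV).
suff -> : k = m'%:Z - n'%:Z by [].
exact: (index_uniq VP VP (@bop_linear_on _ _ _ X) kP (fredholm_has_index fP)).
Qed.

End Fredholm.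

(** Two projections E and F that lift the same element are compared through the
    index j of the class of 1 from F H to E H: it is added once and subtracted
    once. *)
Lemma corner_index_eind E x k : projection E -> eind E E x k ->
  calkin_pi E * x * calkin_pi E = x -> corner_index (calkin_pi E) x = k.
Proof.
move=> EP kP exe; have XE := calkin_reprK x; set X := repr x in XE.
rewrite /corner_index; set A := (X in xget 0 X).
have Ak : A k.
  exists E, (E * X * E); split=> //.
  - by rewrite !mulrA EP.1 -!mulrA EP.1.
  - by rewrite !calkin_pi_mul XE.
  - apply: has_index_fredholm => //; first by rewrite !mulrA EP.1 -!mulrA EP.1.
    exact: kP.2.
have [F [Y [FP FE FYF YE /(fredholm_has_index FP FYF) YP]]] := xgetPex 0 (ex_intro _ k Ak).
have ee : calkin_pi E * calkin_pi E = calkin_pi E by rewrite -calkin_pi_mul EP.1.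
have inv1 : ess_inverse F E 1 1 by split; rewrite FE !mulr1 !ee.
have [j [FEj EFj]] := eind_exists FP EP inv1.
have := eind_comp FP EP FP (eind_comp FP EP EP FEj kP) EFj.
rewrite mul1r mulr1 mulrA exe (_ : j + k - j = k); last by lia.
move=> [_ /(_ _ YE)]; rewrite FYF => Fk.
by apply: (index_uniq (range_subspace F) (range_subspace F) (@bop_linear_on _ _ _ Y) YP Fk).
Qed.

Lemma ketbraE (v w a : H) : ketbra v w a = inner a w *: v.
Proof. by []. Qed.

Lemma projection0 : projection (0 : bop H).
Proof. by split; [rewrite mulr0|exact: bop_star0]. Qed.

Lemma projection_ketbra (v : H) : inner v v = 1 -> projection (ketbra v v).
Proof.
move=> v1; split; first by apply: bop_ext => a; rewrite /= /ketbra_fun innerZl v1 mulr1.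
apply: star_unique => a b; rewrite /= /ketbra_fun innerZl innerZr -inner_conj.
by rewrite mulrC.
Qed.

Lemma ketbra_compact (v w : H) : calkin_pi (ketbra v w) = 0.
Proof.
rewrite -[RHS](raddf0 (@calkin_pi R H)); apply/calkin_eqP; rewrite subr0.
exact: (@rank1_compact _ _ _ v (fun a => inner a w)).
Qed.

Lemma eind_vac (v : H) x : inner v v = 1 -> eind 0 (ketbra v v) x (- 1).
Proof.
move=> v1; have pi0 : calkin_pi 0 = 0 :> calkin H by exact: raddf0.
split=> [|X _]; first by exists 0; split; rewrite ?pi0 ?ketbra_compact ?mul0r.
have -> : range (0 : bop H) = [set 0].
  by apply/seteqP; split=> [_ [a _ <-]|_ ->]; [|exists 0].
apply: (index_from0 (n := 1)); first exact: raddf0.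
exists (fun a => (inner a v)%:M); split=> [c a b _ _|a|r].
- by rewrite innerDl innerZl raddfD /= scalar_mxM mul_scalar_mx.
- have vP := projection_ketbra v1.
  split=> [->|[/(rangeE _ vP) <-]].
    by split; [exists 0; rewrite ?raddf0|rewrite inner0l raddf0].
  rewrite ketbraE innerZl v1 mulr1 => /(congr1 (fun M : 'rV_1 => M 0 0)).
  by rewrite !mxE eqxx mulr1n => ->; rewrite scale0r.
- exists (r 0 0 *: v); last by rewrite innerZl v1 mulr1 -mx11_scalar.
  by exists (r 0 0 *: v) => //; rewrite /= /ketbra_fun innerZl v1 mulr1.
Qed.

End Bridge.

(** * The indices attached to the Toeplitz extension *)

Section Compute.
Variables (R : realType) (H : hilbertType R).

(** Evaluated at x in the range of P i, the sum of the |P j x|^2 is |x|^2,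
    which |P i x|^2 exhausts. *)
Lemma projections_orthogonal n (P : 'I_n -> bop H) :
  (forall i, projection (P i)) -> \sum_i P i = 1 ->
  forall i j, i != j -> P i * P j = 0.
Proof.
move=> PP P1 i j ij.
suff ji : P j * P i = 0.
  by rewrite -(PP i).2 -(PP j).2 -bop_starM ji bop_star0.
apply: bop_ext => b; rewrite /=; set a := P i b.
have Pia : P i a = a by rewrite /a projectionK.
have sumP : \sum_k rnorm (P k a) ^+ 2 = rnorm a ^+ 2.
  apply: (@complexI R); rewrite rmorph_sum -innerE -[X in inner X _]/((1 : bop H) a) -P1.
  have -> : (\sum_k P k) a = \sum_k P k a.
    by elim/big_rec2: _ => [//|k x y _ <-].
  rewrite inner_bigl; apply: eq_bigr => k _ /=.
  have /eqP := projection_inner (PP k) a a.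
  by rewrite innerBr subr_eq0 => /eqP ->; rewrite innerE.
move: sumP; rewrite (bigD1 i)//= Pia => /eqP; rewrite -subr_eq0 addrAC subrr add0r.
rewrite psumr_eq0 => [|k _]; last exact: sqr_ge0.
move=> /allP /(_ j (mem_index_enum _)); rewrite eq_sym ij /= sqrf_eq0 rnorm_eq0.
by move/eqP.
Qed.

Variables (N : nat) (A : 'M[int]_N).
Hypothesis A01 : zero_one A.

Lemma sum_zero_one (U : zmodType) (x : 'I_N -> U) i :
  \sum_j x j *~ A i j = \sum_(j | A i j == 1) x j.
Proof.
rewrite [RHS]big_mkcond; apply: eq_bigr => j _.
by have [->|->] := A01 i j; rewrite ?mulr0z ?mulr1z.
Qed.

Variables (V T : 'I_N -> bop H) (v : H).
Let E i := V i * star (V i).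
Let F i := T i * star (T i).
Let vac := ketbra v v.

(** The Cuntz-Krieger relations with the vacuum projection as defect. *)
Definition toeplitz_relations :=
  [/\ inner v v = 1, forall i, partial_isometry (T i),
      vac + \sum_j F j = 1, forall i j, i != j -> F i * F j = 0
    & forall i, F i * vac = 0 /\
       star (T i) * T i = vac + \sum_(j | A i j == 1) F j].

Lemma partial_isometry_projection (X : bop H) : partial_isometry X ->
  [/\ projection (X * star X), projection (star X * X)
    & star X * X * star X = star X].
Proof.
rewrite /partial_isometry => XX.
have XX' : star X * X * star X = star X.
  by have := congr1 star XX; rewrite !bop_starM bop_starK mulrA.
split=> //; (split; last by rewrite bop_starM bop_starK).
  by rewrite !mulrA XX.
by rewrite !mulrA XX'.
Qed.

Hypotheses (VP : ck_family A V) (TP : toeplitz_relations).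

Variable u : calkin H.
Hypotheses (uP : unitary u)
  (EF : forall i, calkin_pi (E i) = u * calkin_pi (F i) * star u).

Let EP i : projection (E i).
Proof. by case: VP => pV _ _; case: (partial_isometry_projection (pV i)). Qed.

Let FP i : projection (F i).
Proof. by case: TP => _ pT _ _ _; case: (partial_isometry_projection (pT i)). Qed.

Let vacP : projection vac.
Proof. by case: TP => v1 _ _ _ _; exact: projection_ketbra. Qed.

Let EE i j : i != j -> E i * E j = 0.
Proof. by case: VP => _ E1 _; exact: projections_orthogonal. Qed.

Let uE i : star u * calkin_pi (E i) = calkin_pi (F i) * star u.
Proof. by rewrite EF !mulrA uP.1 mul1r. Qed.

Let Eu i : calkin_pi (E i) * u = u * calkin_pi (F i).
Proof. by rewrite EF -!mulrA uP.1 mulr1. Qed.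

Let ess_u i : ess_inverse (E i) (F i) (star u) u.
Proof.
have ee : calkin_pi (E i) * calkin_pi (E i) = calkin_pi (E i).
  by rewrite -calkin_pi_mul (EP i).1.
have ff : calkin_pi (F i) * calkin_pi (F i) = calkin_pi (F i).
  by rewrite -calkin_pi_mul (FP i).1.
split.
  by rewrite Eu -(mulrA u) ff -EF ee.
by rewrite -uE -(mulrA (star u)) ee uE -(mulrA _ _ u) uP.1 mulr1 ff.
Qed.

Lemma sum_projection (P : 'I_N -> bop H) (s : seq 'I_N) :
  (forall i, projection (P i)) -> (forall i j, i != j -> P i * P j = 0) ->
  uniq s -> projection (\sum_(j <- s) P j) /\
    forall i, i \notin s -> P i * (\sum_(j <- s) P j) = 0.
Proof.
move=> PP PO us; have H2 s' i : i \notin s' -> P i * (\sum_(j <- s') P j) = 0.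
  move=> is'; rewrite mulr_sumr big_seq big1// => j js'.
  by apply: PO; apply: contraNneq is' => ->.
split; last by move=> i; exact: H2.
elim: s us => [_|j s IH] /=; first by rewrite big_nil; exact: projection0.
move=> /andP[js us]; rewrite big_cons.
by have [] := projectionD (PP j) (IH us) (H2 _ _ js).
Qed.

Let k : 'I_N -> int := fun i => projT1 (cid (eind_exists (EP i) (FP i) (ess_u i))).

Let kP i : eind (E i) (F i) (star u) (k i).
Proof. by rewrite /k; case: cid => ? []. Qed.

Let kP' i : eind (F i) (E i) u (- k i).
Proof. by rewrite /k; case: cid => ? []. Qed.

(** The vacuum has no counterpart on the left: it costs one. *)
Lemma eind_block (s : seq 'I_N) : uniq s ->
  eind (\sum_(j <- s) E j) (vac + \sum_(j <- s) F j) (star u)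
    (\sum_(j <- s) k j - 1).
Proof.
have [v1 pT _ FF Fvac] := TP.
have vacF i : F i * vac = 0 by have [] := Fvac i.
have pivac : calkin_pi vac = 0 by exact: ketbra_compact.
have EEpi i j : i != j -> calkin_pi (E i) * calkin_pi (E j) = 0.
  by move=> ij; rewrite -calkin_pi_mul EE//; exact: (raddf0 (@calkin_pi R H)).
elim: s => [_|j s IH /= /andP[js us]].
  by rewrite !big_nil addr0 add0r; exact: eind_vac.
rewrite !big_cons addrCA -addrA.
have [EsP EjEs] := sum_projection EP EE us.
have [FsP FjFs] := sum_projection FP FF us.
have vF : vac * \sum_(j <- s) F j = 0.
  rewrite mulr_sumr big1// => i _.
  by rewrite -vacP.2 -(FP i).2 -bop_starM vacF bop_star0.
have [GsP _] := projectionD vacP FsP vF.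
apply: eind_sum (kP j) (IH us) => //.
- exact: EjEs.
- by rewrite mulrDr vacF FjFs// addr0.
- rewrite -uE -mulrA -calkin_pi_mul EjEs//.
  by rewrite [calkin_pi 0](raddf0 (@calkin_pi R H)) mulr0.
- rewrite calkin_piD pivac add0r.
  have -> : calkin_pi (\sum_(i <- s) F i) = \sum_(i <- s) calkin_pi (F i).
    exact: (raddf_sum (@calkin_pi R H)).
  rewrite !mulr_suml big_seq big1// => i is_.
  rewrite -uE -mulrA EEpi ?mulr0//.
  by apply: contraNneq js => <-.
Qed.

(** The element factors as
      E i --> sum of the E j --> vac + sum of the F j --> F i --> E i
    with sums over the j such that A i j = 1 and maps V i ^*, u^*, T i and u.
    The first and the third are isomorphisms; the others have the indices
    sum_j A i j * k j - 1 and - k i. *)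
Lemma toeplitz_index i :
  corner_index (calkin_pi (E i)) (u * calkin_pi (T i) * star u * calkin_pi (star (V i)))
  = \sum_j A i j * k j - 1 - k i.
Proof.
have [pV _ VV] := VP; have [v1 pT _ FF Fvac] := TP.
have [_ GP GVs] := partial_isometry_projection (pV i).
have [_ G'P G'Ts] := partial_isometry_projection (pT i).
have VVV : V i * star (V i) * V i = V i by exact: pV.
have TTT : T i * star (T i) * T i = T i by exact: pT.
have GE : star (V i) * V i = \sum_(j <- enum [pred j | A i j == 1]) E j.
  by rewrite VV sum_zero_one big_enum.
have G'E : star (T i) * T i = vac + \sum_(j <- enum [pred j | A i j == 1]) F j.
  by rewrite (Fvac i).2 big_enum.
have kE : \sum_j A i j * k j = \sum_(j <- enum [pred j | A i j == 1]) k j.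
  rewrite big_enum -sum_zero_one; apply: eq_bigr => j _.
  by rewrite mulrzz mulrC.
have step1 : eind (E i) (star (V i) * V i) (calkin_pi (star (V i))) 0.
  by apply: (eind_iso (EP i) GP (Y := V i)); rewrite /E !mulrA ?VVV ?GVs ?VVV ?GVs.
have step2 := eind_block (enum_uniq [pred j | A i j == 1]).
rewrite -GE -G'E -kE in step2.
have step3 : eind (star (T i) * T i) (F i) (calkin_pi (T i)) 0.
  by apply: (eind_iso G'P (FP i) (Y := star (T i))); rewrite /F !mulrA ?TTT ?G'Ts ?TTT ?G'Ts.
have a1 : calkin_pi (star (V i) * V i) * calkin_pi (star (V i)) = calkin_pi (star (V i)).
  by rewrite -calkin_pi_mul GVs.
have a2 : calkin_pi (T i) * calkin_pi (star (T i) * T i) = calkin_pi (T i).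
  by rewrite -calkin_pi_mul mulrA TTT.
have a3 : calkin_pi (F i) * calkin_pi (T i) = calkin_pi (T i).
  by rewrite -calkin_pi_mul TTT.
have a4 : calkin_pi (star (V i)) * calkin_pi (E i) = calkin_pi (star (V i)).
  by rewrite -calkin_pi_mul mulrA GVs.
have := eind_comp (EP i) (FP i) (EP i)
  (eind_comp (EP i) G'P (FP i) (eind_comp (EP i) GP G'P step1 step2) step3) (kP' i).
have -> : u * calkin_pi (F i) *
    (calkin_pi (T i) * calkin_pi (star (T i) * T i) *
      (star u * calkin_pi (star (V i) * V i) * calkin_pi (star (V i))))
  = u * calkin_pi (T i) * star u * calkin_pi (star (V i)).
  by rewrite -[star u * _ * _]mulrA a1 a2 !mulrA -(mulrA u) a3.
rewrite add0r addr0 => kX.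
rewrite (corner_index_eind (EP i) kX)//.
by rewrite !mulrA Eu -(mulrA u) a3 -(mulrA _ _ (calkin_pi (E i))) a4.
Qed.

(** Over all letters, u^* maps 1 = sum_j E j to 1 = vac + sum_j F j with index
    sum_j k j - 1, which is 0 for a unitary operator. *)
Lemma toeplitz_index_strong (U : bop H) : unitary U -> u = calkin_pi U ->
  \sum_j k j = 1.
Proof.
move=> [UU UU'] uU; have [pV E1 VV] := VP; have [v1 pT F1 FF Fvac] := TP.
have P1 : projection (1 : bop H) by split; [rewrite mulr1|exact: bop_star1].
have := eind_block (index_enum_uniq _); rewrite E1 F1 => k1.
have : eind 1 1 (star u) 0.
  rewrite uU star_pi; apply: (eind_iso P1 P1 (Y := U)).
    by rewrite !mul1r !mulr1.
  by rewrite !mul1r !mulr1.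
by move=> /(eind_uniq k1) /eqP; rewrite subr_eq0 => /eqP.
Qed.

Lemma toeplitz_indices : exists k : 'I_N -> int,
  (forall i, corner_index (calkin_pi (E i))
      (u * calkin_pi (T i) * star u * calkin_pi (star (V i)))
    = \sum_j A i j * k j - 1 - k i) /\
  ((exists2 U : bop H, unitary U & u = calkin_pi U) -> \sum_j k j = 1).
Proof.
exists k; split; first exact: toeplitz_index.
by move=> [U UU uU]; exact: toeplitz_index_strong UU uU.
Qed.

End Compute.

(** * Operators that permute an orthonormal basis *)

Section OrthogonalSequences.
Variables (R : realType) (H : hilbertType R).

(** Orthonormal sequences in which vectors may be missing (replaced with 0). *)
Definition partial_orthonormal (b : nat -> H) (p : nat -> bool) :=
  forall i j, inner (b i) (b j) = ((i == j) && p i)%:R.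

Variables (b : nat -> H) (p : nat -> bool).
Hypothesis bP : partial_orthonormal b p.

Lemma inner_sum_orth (a : nat -> R[i]) n k : (n <= k)%N ->
  inner (\sum_(i < n) a i *: b i) (b k) = 0.
Proof.
move=> nk; rewrite inner_bigl big1// => i _.
by rewrite innerZl bP (ltn_eqF (leq_trans (ltn_ord i) nk)) mulr0.
Qed.

Lemma bessel x n : \sum_(i < n) cabs (inner x (b i)) ^+ 2 <= rnorm x ^+ 2.
Proof.
suff -> : rnorm x ^+ 2 = rnorm (x - \sum_(i < n) inner x (b i) *: b i) ^+ 2
    + \sum_(i < n) cabs (inner x (b i)) ^+ 2 by rewrite lerDr sqr_ge0.
elim: n => [|n IH]; first by rewrite !big_ord0 subr0 addr0.
rewrite !big_ord_recr /= opprD addrA (addrA x).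
have [y yE] : exists y, y = x - \sum_(i < n) inner x (b i) *: b i by eexists.
rewrite -yE in IH *.
have -> : inner x (b n) = inner y (b n).
  by rewrite yE innerBl (inner_sum_orth (fun i => inner x (b i)) (leqnn n)) subr0.
have bnn := bP n n; rewrite eqxx /= in bnn.
case: (p n) bnn => bnn.
  have b0 : b n != 0.
    by apply/eqP => b0; move: bnn; rewrite b0 inner0l => /esym/eqP; rewrite oner_eq0.
  have rb : rnorm (b n) ^+ 2 = 1 by apply: (@complexI R); rewrite -innerE bnn.
  have := rnorm_reject y b0; rewrite bnn divr1 rb divr1 => ->.
  by rewrite IH addrAC subrK.
by rewrite (inner_eq0 bnn) inner0r scaler0 subr0 cabs0 expr0n addr0.
Qed.

(** Pythagoras, for the tails of an orthogonal series. *)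
Lemma rnorm_sum_orth (a : nat -> R[i]) m n : (m <= n)%N ->
  rnorm (\sum_(i < n) a i *: b i - \sum_(i < m) a i *: b i) ^+ 2 <=
  \sum_(i < n) cabs (a i) ^+ 2 - \sum_(i < m) cabs (a i) ^+ 2.
Proof.
move=> mn; rewrite -(subnKC mn); elim: (n - m)%N => [|k IH].
  by rewrite addn0 !subrr rnorm0 expr0n.
rewrite addnS !big_ord_recr /= [X in rnorm X]addrAC [leRHS]addrAC.
rewrite pythagoras.
  rewrite lerD// rnormZ exprMn ler_piMr ?sqr_ge0//.
  rewrite -lecR -innerE bP eqxx /=; case: (p _); rewrite ?ler01//.
rewrite innerZr innerBl !inner_sum_orth ?leq_addr// subrr.
by rewrite mulr0.
Qed.
End OrthogonalSequences.

Lemma nondecreasing_cauchy (R : realType) (t : nat -> R) (B eps : R) :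
  (forall m n, (m <= n)%N -> t m <= t n) -> (forall n, t n <= B) -> 0 < eps ->
  exists N, forall n, (N <= n)%N -> t n - t N < eps.
Proof.
move=> t_mono tB eps0.
have t_sup : has_sup (range t).
  by split; [exists (t 0%N), 0%N|exists B => _ [n _ <-]].
have [_ [N _ <-] ltN] := sup_adherent eps0 t_sup.
exists N => n Nn; have : t n <= sup (range t).
  by apply: ub_le_sup; [case: t_sup|exists n].
lra.
Qed.

(** The partial sums of sum_i <x, b i> c i converge by Bessel's inequality. *)
Lemma orthonormal_map (R : realType) (H : hilbertType R)
    (b c : nat -> H) (p q : nat -> bool) :
  partial_orthonormal b p -> partial_orthonormal c q ->
  exists X : bop H, (forall j, p j -> X (b j) = c j) /\
    forall x, (forall i, inner x (b i) = 0) -> X x = 0.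
Proof.
move=> bP cP; pose u n : bop H := \sum_(i < n) ketbra (c i) (b i).
have uE n x : u n x = \sum_(i < n) inner x (b i) *: c i.
  rewrite /u; elim: n => [|n IH]; first by rewrite !big_ord0.
  by rewrite !big_ord_recr /= IH.
pose t x n := \sum_(i < n) cabs (inner x (b i)) ^+ 2.
have t_mono x m n : (m <= n)%N -> t x m <= t x n.
  move=> mn; rewrite -(subnKC mn); elim: (n - m)%N => [|k IH]; first by rewrite addn0.
  by rewrite addnS /t big_ord_recr /= (le_trans IH)// lerDl sqr_ge0.
have u_t x m n : (m <= n)%N -> rnorm (u n x - u m x) ^+ 2 <= t x n - t x m.
  by move=> mn; rewrite !uE; exact: (rnorm_sum_orth cP (fun i => inner x (b i))).
have [n x|x eps eps0|X XP] := @strong_limit R H u 1.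
- rewrite mul1r -(@ler_pXn2r _ 2) ?nnegrE ?rnorm_ge0//.
  have := u_t x _ _ (leq0n n); rewrite {2}/u /t !big_ord0 !subr0 => le1.
  exact: le_trans le1 (bessel bP x n).
- have e2 : 0 < eps ^+ 2 by rewrite exprn_gt0.
  have [N NP] := nondecreasing_cauchy (t_mono x) (bessel bP x) e2.
  have near m n : (N <= m)%N -> (m <= n)%N -> rnorm (u n x - u m x) < eps.
    move=> Nm mn; rewrite -(@ltr_pXn2r _ 2) ?nnegrE ?rnorm_ge0 ?(ltW eps0)//.
    have := u_t x _ _ mn; have := NP n (leq_trans Nm mn); have := t_mono x _ _ Nm.
    by rewrite /t; lra.
  exists N => m n Nm Nn; have [mn|nm] := leqP m n; last first.
    exact: near Nn (ltnW nm).
  by rewrite rnormBC; exact: near.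
exists X; split=> [j pj|x xb]; apply: eq_of_close => eps eps0; rewrite rnormBC; last first.
  have [N NP] := XP x eps eps0; have := NP N (leqnn _).
  by rewrite uE big1// => i _; rewrite xb scale0r.
have [N NP] := XP (b j) eps eps0; pose n := maxn N j.+1.
have := NP n (leq_maxl _ _); rewrite uE.
have jn : (j < n)%N by exact: leq_maxr.
rewrite (bigD1 (Ordinal jn))//= bP eqxx pj /= scale1r big1 ?addr0// => i ij.
by rewrite bP (_ : (j == i) = false) ?scale0r//; apply/negbTE; rewrite eq_sym.
Qed.

Section FockBasis.
Variables (R : realType) (H : hilbertType R) (N : nat) (A : 'M[int]_N).
Variables (e : seq 'I_N -> H).
Hypothesis eP : fock_basis A e.
Local Notation word := (seq 'I_N).
Local Notation adm := (admissible A).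

(** Two operators agree on a closed subspace. *)
Lemma fock_ext (X Y : bop H) : (forall w, adm w -> X (e w) = Y (e w)) -> X = Y.
Proof.
move=> XY; apply: bop_ext => x; have [_ eT] := eP.
have : closed_span [set e w | w in [set w | adm w]] x by rewrite eT.
move=> /(_ [set x | X x = Y x]); apply=> [|z zcl|_ [w /= ? <-]]; last exact: XY.
  by split=> [|c a b /= aE bE]; rewrite /= ?raddf0// !linearP /= aE bE.
apply: eq_of_close => eps eps0.
have [M M0 ZM] := bop_bound (X - Y).
have M1 : 0 < M + 1 by rewrite ltr_wpDl.
have [|y [/= yE /ballE zy]] := zcl (ball z (eps / (M + 1))%:C).
  by apply: nbhsx_ballx; rewrite ltcR divr_gt0.
have -> : X z - Y z = (X - Y) (z - y).
  by rewrite raddfB /= yE subrr subr0.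
apply: le_lt_trans (ZM _) _; rewrite ltr_pdivlMr// in zy.
apply: le_lt_trans zy; rewrite mulrC ler_wpM2l ?rnorm_ge0//.
by rewrite lerDl.
Qed.

Lemma fock_inner_ext (x y : H) :
  (forall w, adm w -> inner (e w) x = inner (e w) y) -> x = y.
Proof.
move=> xy; pose d := x - y.
have /(congr1 (fun X : bop H => X d)) : ketbra d x = ketbra d y.
  by apply: fock_ext => w aw; rewrite /= /ketbra_fun xy.
move=> /eqP; rewrite /= /ketbra_fun -subr_eq0 -scalerBl -innerBr -/d scaler_eq0.
have [/inner_eq0 d0 _|_ /= /eqP d0] := eqVneq (inner d d) 0.
  by apply/eqP; rewrite -subr_eq0; apply/eqP.
by apply/eqP; rewrite -subr_eq0; apply/eqP.
Qed.

Lemma fock_inner w w' : adm w -> adm w' -> inner (e w) (e w') = (w == w')%:R.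
Proof. by case: eP => eO _; exact: eO. Qed.

(** A partial injection h of the set of words with inverse g acts as a partial
    isometry, its adjoint through g. *)
Lemma word_operator (h g : word -> option word) :
  (forall w, adm w -> oapp adm true (h w)) ->
  (forall v, adm v -> oapp adm true (g v)) ->
  (forall w v, adm w -> adm v -> (h w == Some v) = (g v == Some w)) ->
  exists X : bop H, forall w, adm w ->
    X (e w) = oapp e 0 (h w) /\ star X (e w) = oapp e 0 (g w).
Proof.
move=> h_adm g_adm hg.
pose dom w := adm w && isSome (h w).
have pinvE k w : (pickle_inv k : option word) = Some w -> choice.pickle w = k.
  by move=> kw; have := @pickle_invK word k; rewrite kw.
pose on (f : word -> H) k :=
  if pickle_inv k is Some w then if dom w then f w else 0 else 0.
pose p k := if pickle_inv k is Some w then dom w else false.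
have onP f : (forall w w', dom w -> dom w' -> inner (f w) (f w') = (w == w')%:R) ->
    partial_orthonormal (on f) p.
  move=> fO i j; rewrite /on /p.
  case Ei: (pickle_inv i) => [w|]; last by rewrite inner0l andbF.
  case: ifP => dw; last by rewrite inner0l andbF.
  case Ej: (pickle_inv j) => [v|]; last first.
    by rewrite inner0r; have [ij|//] := eqVneq i j; rewrite -ij Ei in Ej.
  case: ifP => dv; last first.
    rewrite inner0r; have [ij|//] := eqVneq i j.
    by move: Ej; rewrite -ij Ei => -[wv]; rewrite -wv dw in dv.
  rewrite fO// andbT -(pinvE _ _ Ei) -(pinvE _ _ Ej).
  by rewrite (inj_eq (pcan_inj choice.pickleK)).
have bP := onP e (fun w w' => ltac:(move=> /andP[aw _] /andP[aw' _]; exact: fock_inner)).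
have cP : partial_orthonormal (on (fun w => oapp e 0 (h w))) p.
  apply: onP => w w' /andP[aw hw] /andP[aw' hw'].
  case Ew: (h w) hw => [v|//] _; case Ew': (h w') hw' => [v'|//] _ /=.
  have av : adm v by have := h_adm _ aw; rewrite Ew.
  have av' : adm v' by have := h_adm _ aw'; rewrite Ew'.
  rewrite fock_inner//; congr (nat_of_bool _)%:R; apply/eqP/eqP => [vv'|ww'].
    have := hg w v aw av; have := hg w' v' aw' av'.
    rewrite Ew Ew' !eqxx -vv' => /esym/eqP -> /esym/eqP[].
    by [].
  by move: Ew; rewrite ww' Ew' => -[].
have [X [Xb X0]] := orthonormal_map bP cP.
have Xe w : adm w -> X (e w) = oapp e 0 (h w).
  move=> aw; have [dw|ndw] := boolP (dom w).
    have := Xb (choice.pickle w).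
    by rewrite /p /on choice.pickleK_inv dw; apply.
  have hw : h w = None by move: ndw; rewrite /dom aw /=; case: (h w).
  rewrite hw /= X0// => i; rewrite /on.
  case: (pickle_inv i) => [v|]; last exact: inner0r.
  case: ifP => dv; last exact: inner0r.
  rewrite fock_inner//; last by case/andP: dv.
  by have [wv|//] := eqVneq w v; rewrite wv dv in ndw.
exists X => v av; split; first exact: Xe.
apply: fock_inner_ext => w aw; rewrite -adjointP Xe//.
have hv := h_adm _ aw; have gv := g_adm _ av; have := hg _ _ aw av.
case: (h w) hv => [v'|] /=; case: (g v) gv => [w'|] //= aw' av'.
- rewrite -[Some v' == _]/(v' == v) -[Some w' == _]/(w' == w) => vw.
  by rewrite !fock_inner// vw eq_sym.
- rewrite -[Some v' == _]/(v' == v) => vw.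
  by rewrite fock_inner// inner0r vw.
- rewrite -[Some w' == _]/(w' == w) => vw.
  by rewrite inner0l fock_inner// eq_sym -vw.
- by rewrite inner0l inner0r.
Qed.

End FockBasis.

(** * Admissible words *)

Section Words.
Variables (N : nat) (A : 'M[int]_N).
Hypotheses (A01 : zero_one A) (A_irr : irreducible A).
Local Notation word := (seq 'I_N).
Local Notation adm := (admissible A).
Local Notation arrow := (fun i j : 'I_N => A i j == 1).

Lemma power_path n i j : 0 < (A ^+ n) i j ->
  exists2 w : word, size w = n & path arrow i w /\ last i w = j.
Proof.
elim: n i => [|n IH] i.
  rewrite expr0 mxE; case: eqVneq => [->|//] _.
  by exists [::].
rewrite exprS [X in 0 < X]mxE => sum_gt0.
have [k Aik /IH[w <- [wp wl]]] : exists2 k, A i k = 1 & 0 < (A ^+ n) k j.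
  apply: contrapT => no; move: sum_gt0; apply/negP; rewrite -leNgt.
  apply: sumr_le0 => k _; have [->|Aik] := A01 i k; first by rewrite mul0r.
  by rewrite Aik mul1r leNgt; apply/negP => gt0; apply: no; exists k.
by exists (k :: w) => //=; rewrite Aik eqxx.
Qed.

Lemma long_path L i z : exists w : word,
  [/\ path arrow i w, last i w = z & (L < size w)%N].
Proof.
elim: L => [|L [w [wp wl Lw]]].
  have [n [n0 /power_path[w wn [wp wl]]]] := A_irr i z.
  by exists w; rewrite wn.
have [n [n0 /power_path[w' wn [wp' wl']]]] := A_irr z z.
exists (w ++ w'); rewrite cat_path wp wl wp' last_cat wl wl'.
by split=> //; rewrite size_cat wn -addn1 leq_add.
Qed.

Lemma long_words_infinite (W : set word) :
  (forall L, exists2 w, W w & (L < size w)%N) -> ~ finite_set W.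
Proof.
move=> WL /finite_seqP[s Ws].
have [w Ww] := WL (\max_(v <- s) size v)%N.
apply/negP; rewrite -leqNgt.
have ws : w \in s by rewrite Ws in Ww.
by rewrite (big_rem w)//= leq_max leqnn.
Qed.

Variables i0 z z' : 'I_N.
Hypothesis zz' : z' != z.

(** The empty word is given a letter so that every word belongs to exactly one
    letter, as the relation sum_j V j V j^* = 1 demands. *)
Definition letter (w : word) := head i0 w.

Definition ends_in (w : word) := (w != [::]) && (last i0 w == z).

(** For words ending in z the bijection is the creation operator; on the other
    words of its domain, infinitely many as there are paths to z', it has to be
    changed in order to become onto. *)
Lemma letter_bijection i : exists f g : word -> word,
  [/\ forall w, adm w -> A i (letter w) == 1 ->
        [/\ adm (f w), letter (f w) = i & g (f w) = w],
      forall v, adm v -> letter v = i ->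
        [/\ adm (g v), A i (letter (g v)) == 1 & f (g v) = v]
    & forall w, ends_in w -> f w = i :: w].
Proof.
pose D := [set w | [/\ adm w, A i (letter w) == 1 & ~~ ends_in w]].
pose E := [set v | [/\ adm v, letter v = i & ~~ ends_in (behead v)]].
have Dinf : ~ finite_set D.
  apply: long_words_infinite => L; have [w [wp wl Lw]] := long_path L i z'.
  exists w => //; case: w wp wl Lw => [//|j w] /= /andP[aij wp] wl _.
  by split=> //; rewrite /ends_in /= wl.
have Einf : ~ finite_set E.
  apply: long_words_infinite => L; have [w [wp wl Lw]] := long_path L i z'.
  exists (i :: w); last by rewrite /= ltnW// ltnS.
  split=> //=; apply/negP => /andP[w0 /eqP wz].
  by case: w w0 wl wz {wp Lw} => [//|j w] _ /= -> /eqP; rewrite (negPf zz').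
have DE : (D #= E)%card.
  apply: card_eq_trans (eq_card_nat (countableP _) Dinf) _.
  by rewrite card_eq_sym; exact: eq_card_nat (countableP _) Einf.
pose U : pointedType := HB.pack word (isPointed.Build word [::]).
have [f [fE f_inj f_surj]] := elimT (@card_set_bijP word U D E) DE.
have ex v : exists w, E v -> D w /\ f w = v.
  have [/f_surj[w Dw fw]|nE] := pselect (E v); first by exists w.
  by exists [::].
pose g v := projT1 (cid (ex v)).
have gP v : E v -> D (g v) /\ f (g v) = v by rewrite /g; case: cid.
exists (fun w => if ends_in w then i :: w else f w).
exists (fun v => if ends_in (behead v) then behead v else g v).
split=> [w aw Aw|v av vi|w ->//].
  case: ifP => [we|wne].
    by rewrite /= we; split=> //; case: w aw Aw we => [//|j w] /= -> ->.
  have Dw : D w by split; rewrite ?wne.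
  have [af lf nef] := fE _ Dw; rewrite (negPf nef); split=> //.
  have [Dg fg] := gP _ (fE _ Dw).
  by apply: f_inj; rewrite ?inE.
case: ifP => [ve|vne].
  case: v av vi ve => [//|j [//|k v]] /= /andP[ajk vp] <- ve.
  by rewrite ve.
have Ev : E v by split; rewrite ?vne.
have [[ag lg neg] fg] := gP _ Ev.
by rewrite (negPf neg).
Qed.

End Words.

(** * Cuntz-Krieger families on the Fock space *)

Section FockOperators.
Variables (R : realType) (H : hilbertType R) (N : nat) (A : 'M[int]_N).
Hypotheses (A01 : zero_one A) (A_irr : irreducible A).
Variable e : seq 'I_N -> H.
Hypothesis eP : fock_basis A e.
Local Notation word := (seq 'I_N).
Local Notation adm := (admissible A).

Lemma bop_sumE (I : Type) (r : seq I) (P : pred I) (X : I -> bop H) (x : H) :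
  (\sum_(i <- r | P i) X i) x = \sum_(i <- r | P i) X i x.
Proof. by elim/big_rec2: _ => [//|i a b _ <-]. Qed.

Lemma sum_select (P : pred 'I_N) (k : 'I_N) (x : H) :
  \sum_(j | P j) (if k == j then x else 0) = if P k then x else 0.
Proof.
rewrite big_mkcond (bigD1 k)//= eqxx big1 ?addr0// => j jk.
by rewrite eq_sym (negPf jk); case: (P j).
Qed.

(** Only finitely many words have length at most 1. *)
Lemma fock_compact (X : bop H) :
  (forall w, adm w -> (1 < size w)%N -> X (e w) = 0) -> X \in @compact_ops R H.
Proof.
move=> X0; pose s : seq word := [::] :: [seq [:: j] | j <- enum 'I_N].
have sE w : (w \in s) = (size w < 2)%N.
  rewrite inE; case: w => [//|j [|k w]] /=; last by apply/mapP => -[].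
  by rewrite map_f// mem_enum.
have us : uniq s.
  rewrite /= map_inj_uniq ?enum_uniq => [|j k []//]; rewrite andbT.
  by apply/mapP => -[].
have -> : X = \sum_(w <- s) ketbra (X (e w)) (e w).
  apply: (fock_ext eP) => w aw; rewrite bop_sumE.
  have small v : v \in s -> adm v by rewrite sE; case: v => [//|j []].
  have [ws|wns] := boolP (w \in s).
    rewrite (bigD1_seq w)//= /ketbra_fun (fock_inner eP)// eqxx scale1r.
    rewrite big_seq_cond big1 ?addr0// => v /andP[vs vw].
    by rewrite (fock_inner eP)// ?small// eq_sym (negPf vw) scale0r.
  rewrite X0//; last by rewrite leqNgt -sE.
  rewrite big_seq big1// => v vs /=; rewrite /ketbra_fun (fock_inner eP aw (small _ vs)).
  have /negbTE -> : w != v by apply: contraNneq wns => ->.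
  by rewrite scale0r.
by apply: rpred_sum => w _; exact: (rank1_compact (f := fun x => inner x (e w))).
Qed.

Lemma calkin_eq_words (X Y : bop H) :
  (forall w, adm w -> (1 < size w)%N -> X (e w) = Y (e w)) ->
  calkin_pi X = calkin_pi Y.
Proof.
move=> XY; apply/calkin_eqP/fock_compact => w aw w2.
by rewrite /= XY// subrr.
Qed.

Lemma vacE w : adm w -> ketbra (e [::]) (e [::]) (e w) = if w == [::] then e w else 0.
Proof.
move=> aw; rewrite ketbraE (fock_inner eP)//.
by case: eqP => [->|_]; rewrite ?scale1r ?scale0r.
Qed.

Section Creation.
Variable T : 'I_N -> bop H.
Hypothesis TP : creation_operators A e T.

Lemma creation_star i w : adm w -> star (T i) (e w) =
  if w is j :: w' then if j == i then e w' else 0 else 0.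
Proof.
move=> aw; apply: (fock_inner_ext eP) => v av; rewrite -adjointP TP//.
case: ifP => [aiv|naiv].
  rewrite (fock_inner eP)//; case: w aw => [|j w] aw; first by rewrite inner0r.
  rewrite eqseq_cons eq_sym; case: eqP => [ji|_]; last by rewrite inner0r.
  by rewrite (fock_inner eP)//; exact: path_sorted aw.
rewrite inner0l; case: w aw => [|j w] aw; first by rewrite inner0r.
case: eqP => [ji|_]; last by rewrite inner0r.
rewrite (fock_inner eP)//; last exact: path_sorted aw.
by case: eqP => // vw; rewrite -ji vw aw in naiv.
Qed.

Lemma creation_range i w : adm w -> (T i * star (T i)) (e w) =
  if w is j :: w' then if j == i then e w else 0 else 0.
Proof.
move=> aw; rewrite /= creation_star//; case: w aw => [|j w] aw; first by rewrite raddf0.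
case: eqP => [<-|_]; last by rewrite raddf0.
by rewrite TP ?aw//; exact: path_sorted aw.
Qed.

(** Every word other than the empty one has exactly one first letter, and the
    empty one spans the range of vac. *)
Lemma creation_relations : toeplitz_relations A T (e [::]).
Proof.
split.
- by rewrite (fock_inner eP).
- move=> i; apply: (fock_ext eP) => w aw.
  rewrite -[LHS]/((T i * star (T i)) (T i (e w))) TP//.
  case: ifP => [aiw|_]; last by rewrite raddf0.
  by rewrite creation_range//= eqxx.
- apply: (fock_ext eP) => w aw; rewrite [LHS]/= bop_sumE -[ketbra_fun _ _ _]/(ketbra _ _ _) vacE//.
  under eq_bigr do rewrite creation_range//.
  case: w aw => [|j w] aw; first by rewrite eqxx big1 ?addr0.
  by rewrite sum_select add0r.
- move=> i j ij; apply: (fock_ext eP) => w aw.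
  rewrite -[LHS]/((T i * star (T i)) ((T j * star (T j)) (e w))) creation_range//.
  case: w aw => [|k w] aw; first by rewrite raddf0.
  case: eqP => [kj|_]; last by rewrite raddf0.
  by rewrite creation_range// kj eq_sym (negPf ij).
- move=> i; split; apply: (fock_ext eP) => w aw.
    rewrite -[LHS]/((T i * star (T i)) (ketbra (e [::]) (e [::]) (e w))) vacE//.
    by case: eqP => [->|_]; rewrite ?raddf0// creation_range.
  rewrite [RHS]/= bop_sumE -[ketbra_fun _ _ _]/(ketbra _ _ _) vacE//.
  under [in RHS]eq_bigr do rewrite creation_range//.
  rewrite /= TP//; case: w aw => [|j w] aw.
    by rewrite /= creation_star//= eqxx big1 ?addr0// eqxx.
  rewrite sum_select add0r /= -[path _ j w]/(adm (j :: w)) aw andbT.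
  case: eqP => Aij; last by rewrite raddf0.
  rewrite creation_star ?eqxx//=.
  by rewrite Aij eqxx.
Qed.

End Creation.

Variables i0 z z' : 'I_N.
Hypothesis zz' : z' != z.

(** V i acts on the basis through the bijection attached to i.  Its domain consists
    of the words whose letter may follow i and its range of the words with letter
    i; these are the Cuntz-Krieger relations. *)
Lemma ck_family_words : exists V : 'I_N -> bop H, [/\ ck_family A V,
    forall i w, adm w -> (V i * star (V i)) (e w) = if letter i0 w == i then e w else 0,
    forall i w, adm w -> ends_in i0 z w ->
      V i (e w) = if adm (i :: w) then e (i :: w) else 0
  & forall i j w, adm (j :: w) -> ends_in i0 z w ->
      star (V i) (e (j :: w)) = if j == i then e w else 0].
Proof.
have ex i : exists X : bop H,
    [/\ forall w, adm w -> (star X * X) (e w) = if A i (letter i0 w) == 1 then e w else 0,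
        forall w, adm w -> (X * star X) (e w) = if letter i0 w == i then e w else 0,
        forall w, adm w -> ends_in i0 z w -> X (e w) = if adm (i :: w) then e (i :: w) else 0
      & forall j w, adm (j :: w) -> ends_in i0 z w ->
        star X (e (j :: w)) = if j == i then e w else 0].
  have [f [g [fP gP fz]]] := letter_bijection A01 A_irr i0 zz' i.
  pose h w := if A i (letter i0 w) == 1 then Some (f w) else None.
  pose h' v := if letter i0 v == i then Some (g v) else None.
  have [w aw|v av|w v aw av|X XP] := word_operator eP (h := h) (g := h').
  - by rewrite /h; case: ifP => // Aw; case: (fP _ aw Aw).
  - by rewrite /h'; case: ifP => // /eqP vi; case: (gP _ av vi).
  - apply/eqP/eqP; rewrite /h /h'.
      case: ifP => // Aw [<-]; have [_ -> gf] := fP _ aw Aw.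
      by rewrite eqxx gf.
    case: ifP => // /eqP vi [<-]; have [_ -> fg] := gP _ av vi.
    by rewrite fg.
  exists X; split=> [w aw|w aw|w aw we|j w ajw we] /=.
  - rewrite (XP _ aw).1 /h; case: ifP => Aw /=; last by rewrite raddf0.
    have [af fi gf] := fP _ aw Aw.
    by rewrite (XP _ af).2 /h' fi eqxx gf.
  - rewrite (XP _ aw).2 /h'; case: eqP => [wi|_] /=; last by rewrite raddf0.
    have [ag Ag fg] := gP _ aw wi.
    by rewrite (XP _ ag).1 /h Ag fg.
  - rewrite (XP _ aw).1 /h fz//.
    case: w aw we => [//|j w] /= aw _; rewrite aw andbT.
    by case: ifP.
  - have aw : adm w by exact: path_sorted ajw.
    rewrite (XP _ ajw).2 /h' /=; case: eqP => [ji|//] /=.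
    have Aw : A i (letter i0 w) == 1.
      by case: w we ajw {aw} => [//|k w] _ /= /andP[]; rewrite ji.
    have [_ _] := fP _ aw Aw; rewrite fz// => giw.
    by rewrite ji giw.
pose V i := projT1 (cid (ex i)).
have VP i := projT2 (cid (ex i)); rewrite -/(V _) in VP.
exists V; split.
- split.
  + move=> i; have [VV VV' _ _] := VP i; apply: (fock_ext eP) => w aw.
    rewrite -[LHS]/(V i ((star (V i) * V i) (e w))) VV//.
    case: ifP => // nAw; rewrite raddf0.
    have : rnorm (V i (e w)) ^+ 2 = 0.
      apply: (@complexI R); rewrite -innerE adjointP.
      by rewrite -[star (V i) (V i (e w))]/((star (V i) * V i) (e w)) VV// nAw inner0r.
    by move/eqP; rewrite sqrf_eq0 rnorm_eq0 => /eqP.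
  + apply: (fock_ext eP) => w aw; rewrite bop_sumE.
    under eq_bigr => i _ do [have [_ VV' _ _] := VP i; rewrite VV'//].
    by rewrite sum_select.
  + move=> i; rewrite (sum_zero_one A01); apply: (fock_ext eP) => w aw.
    have [VV _ _ _] := VP i; rewrite VV// bop_sumE.
    under eq_bigr => j _ do [have [_ VV' _ _] := VP j; rewrite VV'//].
    by rewrite sum_select.
- by move=> i; case: (VP i).
- by move=> i; case: (VP i).
- by move=> i; case: (VP i).
Qed.

(** The operator J l appends to the words that end in l a path from l to z, and it
    kills the other words.  Its values are words that end in z, on which V acts as
    T does: so it intertwines T and V except on short words. *)
Lemma append_operators : exists J : 'I_N -> bop H,
  [/\ \sum_l star (J l) * J l + ketbra (e [::]) (e [::]) = 1
    & forall (T V : 'I_N -> bop H), creation_operators A e T ->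
      (forall i w, adm w -> ends_in i0 z w ->
        V i (e w) = if adm (i :: w) then e (i :: w) else 0) ->
      (forall i j w, adm (j :: w) -> ends_in i0 z w ->
        star (V i) (e (j :: w)) = if j == i then e w else 0) ->
      forall i l, calkin_pi (J l) * calkin_pi (T i) = calkin_pi (V i) * calkin_pi (J l) /\
        calkin_pi (J l) * calkin_pi (star (T i)) = calkin_pi (star (V i)) * calkin_pi (J l)].
Proof.
have ex l : exists (s : word) (X : bop H),
    [/\ path (fun i j => A i j == 1) l s, last l s = z,
        forall w, adm w -> X (e w) = if ends_in i0 l w then e (w ++ s) else 0
      & forall w, adm w -> (star X * X) (e w) = if ends_in i0 l w then e w else 0].
  have [s [sp sz _]] := long_path A01 A_irr 0 l z.
  have aws w : adm w -> ends_in i0 l w -> adm (w ++ s).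
    by rewrite /ends_in; case: w => [//|j w] /= aw /eqP wl; rewrite cat_path aw wl.
  pose h w := if ends_in i0 l w then Some (w ++ s) else None.
  have catI (w w' : word) : w ++ s = w' ++ s -> w = w'.
    move=> ww'; have sz' : size w = size w'.
      by apply/eqP; rewrite -(eqn_add2r (size s)) -!size_cat ww'.
    by apply/eqP; have := eqseq_cat s s sz'; rewrite ww' !eqxx andbT => <-.
  have exv (v : word) : exists o : option word, forall w, adm w -> (h w == Some v) = (o == Some w).
    have [[w [aw hw]]|no] := pselect (exists w, adm w /\ h w = Some v).
      exists (Some w) => w' aw'; apply/eqP/eqP => [|[<-]//].
      move: hw; rewrite /h; case: ifP => // _ [<-]; case: ifP => // _ [] /catI ->.
      by [].
    exists None => w aw; apply/negbTE/eqP => hw.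
    by case: no; exists w.
  pose g0 v := projT1 (cid (exv v)).
  have g0P v w : adm w -> (h w == Some v) = (g0 v == Some w).
    by rewrite /g0; case: cid => o oP; exact: oP.
  pose g v := if g0 v is Some w then if adm w then Some w else None else None.
  have gP v w : adm w -> (h w == Some v) = (g v == Some w).
    move=> aw; rewrite g0P// /g; case E: (g0 v) => [w'|//]; case: ifP => // naw'.
    by apply/negP => /eqP[w'w]; rewrite w'w aw in naw'.
  have [w aw|v av|w v aw av|X XP] := word_operator eP (h := h) (g := g).
  - by rewrite /h; case: ifP => // we; exact: aws.
  - by rewrite /g; case: (g0 v) => // w; case: ifP.
  - exact: gP.
  exists s, X; split=> //.
    by move=> w aw; rewrite (XP _ aw).1 /h; case: ifP.
  move=> w aw /=; rewrite (XP _ aw).1 /h; case: ifP => [we|_] /=; last by rewrite raddf0.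
  rewrite (XP _ (aws _ aw we)).2.
  have : h w == Some (w ++ s) by rewrite /h we.
  by rewrite gP// => /eqP ->.
pose s l := projT1 (cid (ex l)).
pose J l := projT1 (cid (projT2 (cid (ex l)))).
have JP l : [/\ path (fun i j => A i j == 1) l (s l), last l (s l) = z,
    forall w, adm w -> J l (e w) = if ends_in i0 l w then e (w ++ s l) else 0
  & forall w, adm w -> (star (J l) * J l) (e w) = if ends_in i0 l w then e w else 0].
  exact: projT2 (cid (projT2 (cid (ex l)))).
exists J; split=> [|T V TP VT VTs i l].
  apply: (fock_ext eP) => w aw; rewrite [LHS]/= bop_sumE -[ketbra_fun _ _ _]/(ketbra _ _ _) vacE//.
  under eq_bigr => l _ do [have [_ _ _ JJ] := JP l; rewrite JJ//].
  have [->|w0] := eqVneq w [::]; first by rewrite big1 ?add0r.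
  rewrite /ends_in w0 /= addr0; exact: (sum_select predT).
have [sp sz Je _] := JP l.
have ends w : w != [::] -> ends_in i0 z (w ++ s l) = true \/ ~~ ends_in i0 l w.
  move=> w0; rewrite /ends_in w0 /=; case: (last i0 w =P l) => [wl|_]; last by right.
  by left; rewrite last_cat wl sz eqxx andbT; case: (w) w0.
have acat w : adm w -> ends_in i0 l w -> adm (w ++ s l).
  by rewrite /ends_in; case: w => [//|j w] /= aw /eqP wl; rewrite cat_path aw wl.
split; rewrite -!calkin_pi_mul; apply: calkin_eq_words => w aw w2 /=.
  case: w aw w2 => [//|j w] aw _.
  rewrite TP// (Je _ aw).
  have endsi : ends_in i0 l (i :: j :: w) = ends_in i0 l (j :: w) by [].
  case wl: (ends_in i0 l (j :: w)); last first.
    by case: ifP => aijw; rewrite !raddf0// Je// endsi wl.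
  have [we|] := ends (j :: w) isT; last by rewrite wl.
  rewrite VT ?acat//=; have := acat _ aw wl; rewrite /= => ->; rewrite andbT.
  have aw' : path (fun i j => A i j == 1) j w by [].
  rewrite aw' andbT; case: ifP => Aij; last by rewrite raddf0.
  by rewrite Je ?endsi ?wl//= Aij aw'.
case: w aw w2 => [//|j [//|k w]] aw _.
have aw' : adm (k :: w) by exact: path_sorted aw.
rewrite (creation_star TP)// (Je _ aw).
have endsi : ends_in i0 l (j :: k :: w) = ends_in i0 l (k :: w) by [].
rewrite endsi; case wl: (ends_in i0 l (k :: w)); last first.
  by rewrite raddf0; case: eqP => _; rewrite ?raddf0// Je// wl.
have [we|] := ends (k :: w) isT; last by rewrite wl.
rewrite VTs//; last by apply: (acat (j :: k :: w)).
by case: eqP => _; rewrite ?raddf0// Je// wl.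
Qed.

End FockOperators.

(** * Homomorphisms into the Calkin algebra *)

Section CNorm.
Variables (R : realType) (O : cstarAlgType R).
Implicit Types a b x y : O.

Lemma cnormZE (c : R[i]) a : cnorm (c *: a) = cabs c * cnorm a.
Proof. exact: cnormZ. Qed.

Lemma cstarZE (c : R[i]) a : star (c *: a) = conjc c *: star a.
Proof. exact: cstarZ. Qed.

Lemma cnorm0 : cnorm (0 : O) = 0.
Proof. by rewrite -(scale0r (0 : O)) cnormZE cabs0 mul0r. Qed.

Lemma cabs1 : cabs (1 : R[i]) = 1.
Proof. by rewrite /cabs normr1. Qed.

Lemma cnormN a : cnorm (- a) = cnorm a.
Proof. by rewrite -scaleN1r cnormZE cabsN cabs1 mul1r. Qed.

Lemma cnormB a b : cnorm (a - b) <= cnorm a + cnorm b.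
Proof. by rewrite -(cnormN b); exact: cnormD. Qed.

Lemma cnorm_ge0 a : 0 <= cnorm a.
Proof. by have := cnormB a a; rewrite subrr cnorm0; lra. Qed.

Lemma cstar0 : star (0 : O) = 0.
Proof. by apply: (addrI (star (0 : O))); rewrite -cstarD !addr0. Qed.

Lemma cstarB a b : star (a - b) = star a - star b.
Proof. by apply: (addIr (star b)); rewrite -cstarD !subrK. Qed.

Lemma cstar1 : star (1 : O) = 1.
Proof. by have := cstarM (star (1 : O)) 1; rewrite mulr1 cstarK mulr1 => <-. Qed.

Lemma cnorm_starE a : cnorm (star a) = cnorm a.
Proof.
have le_ b : cnorm b <= cnorm (star b).
  have [b0|b0] := eqVneq (cnorm b) 0; first by rewrite b0 cnorm_ge0.
  have lt0 : 0 < cnorm b by rewrite lt0r b0 cnorm_ge0.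
  by rewrite -(ler_pM2r lt0) -expr2 -cnorm_star cnormM.
by apply/eqP; rewrite eq_le le_ andbT -{2}(cstarK a) le_.
Qed.

Lemma cnorm_eq_of_close a b : (forall eps : R, 0 < eps -> cnorm (a - b) < eps) -> a = b.
Proof.
move=> ab; apply/eqP; rewrite -subr_eq0; apply/eqP/cnorm0_eq0.
apply/eqP/negPn/negP => n0.
have lt0 : 0 < cnorm (a - b) by rewrite lt0r n0 cnorm_ge0.
by have := ab _ lt0; rewrite ltxx.
Qed.

Lemma cnorm_sqrB a b : cnorm (a * a - b * b) <= (cnorm a + cnorm b) * cnorm (a - b).
Proof.
have -> : a * a - b * b = a * (a - b) + (a - b) * b.
  by rewrite mulrBr mulrBl addrA subrK.
apply: le_trans (cnormD _ _) _; rewrite [leRHS]mulrDl; apply: lerD; first exact: cnormM.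
by rewrite [leRHS]mulrC cnormM.
Qed.

Lemma cabs_half : cabs (2^-1 : R[i]) = 2^-1.
Proof.
have -> : (2^-1 : R[i]) = (2^-1 : R)%:C by rewrite fmorphV rmorph_nat.
by rewrite cabs_real// invr_ge0.
Qed.

(** 1 - a^* a has a selfadjoint square root 1 - x, where x is the fixed point of
    x |-> (a^* a + x^2) / 2, a contraction on the ball of radius 1/4. *)
Lemma sqrt_one_minus a : cnorm a <= 2^-1 ->
  exists y, star y = y /\ star a * a + y * y = 1.
Proof.
move=> a1; pose c := star a * a.
have c1 : cnorm c <= 4^-1.
  rewrite /c cnorm_star; have -> : 4^-1 = 2^-1 ^+ 2 :> R by rewrite expr2; field.
  by rewrite ler_pXn2r// nnegrE ?cnorm_ge0// invr_ge0.
have cs : star c = c by rewrite /c cstarM cstarK.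
pose f x := 2^-1 *: (c + x * x).
have [u [u0 uE]] : exists u : nat -> O, u 0%N = 0 /\ forall n, u n.+1 = f (u n).
  by exists (fix u n := if n is m.+1 then f (u m) else 0).
have fB x y : cnorm (f x - f y) <= 2^-1 * ((cnorm x + cnorm y) * cnorm (x - y)).
  rewrite /f -scalerBr cnormZE cabs_half ler_pM2l ?invr_gt0//.
  by rewrite opprD addrACA subrr add0r; exact: cnorm_sqrB.
have u1 n : cnorm (u n) <= 4^-1.
  elim: n => [|n IH]; first by rewrite u0 cnorm0 invr_ge0.
  rewrite uE /f cnormZE cabs_half.
  have := cnormD c (u n * u n); have := cnormM (u n) (u n).
  have : cnorm (u n) * cnorm (u n) <= 4^-1 * 4^-1 by apply: ler_pM => //; exact: cnorm_ge0.
  lra.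
have us n : star (u n) = u n.
  elim: n => [|n IH]; first by rewrite u0 cstar0.
  rewrite uE /f cstarZE cstarD cs cstarM IH; congr (_ *: _).
  by rewrite (conjc_inv 2) conjc_nat.
have uC n : cnorm (u n.+1 - u n) <= 1 / 2 ^+ n.
  elim: n => [|n IH].
    by rewrite u0 subr0 expr0 divr1; apply: le_trans (u1 _) _; lra.
  rewrite (uE n.+1) {2}(uE n); apply: le_trans (fB _ _) _.
  have : (cnorm (u n.+1) + cnorm (u n)) * cnorm (u n.+1 - u n) <= 1 * cnorm (u n.+1 - u n).
    by apply: ler_wpM2r; [exact: cnorm_ge0|have := u1 n; have := u1 n.+1; lra].
  by rewrite exprS invfM mul1r; rewrite mul1r in IH; lra.
have := geometric_cauchy cnormN (@cnormD _ O) cnorm0 uC.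
move=> /cnorm_complete[x xP].
have xs : star x = x.
  apply: cnorm_eq_of_close => eps eps0; have [M MP] := xP _ (divr_gt0 eps0 (ltr0n R 2)).
  have h := MP M (leqnn _).
  have -> : star x - x = (u M - x) - star (u M - x).
    by rewrite cstarB us opprB [RHS]addrC subrKA.
  by apply: le_lt_trans (cnormB _ _) _; rewrite cnorm_starE; lra.
have xf : x = f x.
  apply: cnorm_eq_of_close => eps eps0.
  have e0 : 0 < Num.min 1 (eps / 4) by rewrite lt_min ltr01 divr_gt0.
  have [M MP] := xP _ e0.
  have MP' n : (M <= n)%N -> cnorm (u n - x) < 1 /\ cnorm (u n - x) < eps / 4.
    by move=> /MP; rewrite lt_min => /andP.
  have [h1 h1'] := MP' M.+1 (leqnSn _); have [h2 h2'] := MP' M (leqnn _).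
  have x2 : cnorm x <= 2.
    have := cnormB (u M) (u M - x); rewrite opprB addrC subrK; have := u1 M; lra.
  have -> : x - f x = (f (u M) - f x) - (u M.+1 - x).
    by rewrite uE opprB [RHS]addrC subrKA.
  apply: le_lt_trans (cnormB _ _) _; have := fB (u M) x.
  have : (cnorm (u M) + cnorm x) * cnorm (u M - x) <= 4 * cnorm (u M - x).
    by apply: ler_wpM2r; [exact: cnorm_ge0|have := u1 M; lra].
  lra.
exists (1 - x); split; first by rewrite cstarB cstar1 xs.
have xx : x + x = c + x * x.
  have h1 : 2^-1 + 2^-1 = 1 :> R[i] by rewrite -[2^-1]div1r -splitr.
  by rewrite {1 2}xf /f -scalerDl h1 scale1r.
have cE : c = x + x - x * x by rewrite xx addrK.
rewrite -/c mulrBl mul1r mulrBr mulr1 cE opprB addrACA addKr -addrA.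
by rewrite -[1 - x - x]addrA -opprD addrC subrK.
Qed.

End CNorm.

Section UnitalStarHom.
Variables (R : realType) (A B : starAlgType R) (phi : A -> B).
Hypothesis phiP : unital_star_hom phi.

Lemma hom0 : phi 0 = 0.
Proof.
have [_ lin _ _] := phiP; have := lin 1 0 0; rewrite !scale1r addr0.
by move=> /(congr1 (fun z => z - phi 0)); rewrite subrr addrK.
Qed.

Lemma homD a b : phi (a + b) = phi a + phi b.
Proof. by have [_ lin _ _] := phiP; have := lin 1 a b; rewrite !scale1r. Qed.

Lemma homZ c a : phi (c *: a) = c *: phi a.
Proof. by have [_ lin _ _] := phiP; have := lin c a 0; rewrite hom0 !addr0. Qed.

Lemma homB a b : phi (a - b) = phi a - phi b.
Proof. by apply: (addIr (phi b)); rewrite -homD !subrK. Qed.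

Lemma hom_sum (I : Type) (r : seq I) (P : pred I) (x : I -> A) :
  phi (\sum_(i <- r | P i) x i) = \sum_(i <- r | P i) phi (x i).
Proof. by elim/big_rec2: _ => [|i a b _ <-]; rewrite ?hom0 ?homD. Qed.

Lemma ck_family_hom N (M : 'M[int]_N) (S : 'I_N -> A) : zero_one M ->
  ck_family M S -> ck_family M (fun i => phi (S i)).
Proof.
move=> M01 [Spi S1 SS]; have [phi1 _ phiM phis] := phiP.
split=> [i||i].
- by rewrite /partial_isometry -phis -!phiM Spi.
- by rewrite -phi1 -S1 hom_sum; apply: eq_bigr => j _; rewrite phiM phis.
- rewrite -phis -phiM SS !sum_zero_one// hom_sum.
  by apply: eq_bigr => j _; rewrite phiM phis.
Qed.

End UnitalStarHom.

Section StarHom.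
Variables (R : realType) (O : cstarAlgType R) (H : hilbertType R).

Lemma finite_rank_pi0 (F : bop H) : finite_rank F -> calkin_pi F = 0.
Proof.
move=> /finite_rank_compact cF; rewrite -[RHS](raddf0 (@calkin_pi R H)).
by apply/calkin_eqP; rewrite subr0.
Qed.

Section OneHom.
Variable phi : O -> calkin H.
Hypothesis phiP : unital_star_hom phi.

(** If a^* a + y^2 = 1 then X^* X + Y^* Y = 1 + K with K compact, for all lifts
    X and Y of phi a and phi y.  Let P be a projection of finite rank for which
    (1 - P) K is small.  Then |X z|^2 <= |z|^2 + <z, K z> for z = (1 - P) x, with
    a small last term, and X (1 - P) is also a lift of phi a. *)
Lemma small_lift a : cnorm a <= 2^-1 ->
  exists X : bop H, calkin_pi X = phi a /\ forall x, rnorm (X x) <= 2 * rnorm x.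
Proof.
move=> a1; have [y [ys ayy]] := sqrt_one_minus a1.
have [phi1 _ phiM phis] := phiP.
have [X XE] : exists X, calkin_pi X = phi a by exists (repr (phi a)); exact: calkin_reprK.
have [Y YE] : exists Y, calkin_pi Y = phi y by exists (repr (phi y)); exact: calkin_reprK.
pose K := star X * X + star Y * Y - 1.
have cK : K \in @compact_ops R H.
  apply/calkin_eqP; rewrite calkin_piD !calkin_pi_mul -!star_pi XE YE -!phis -!phiM.
  by rewrite ys -[calkin_pi 1]phi1 -ayy (homD phiP).
have [P [PP Pf KP]] := compact_approx cK ltr01.
exists (X * (1 - P)); split.
  by rewrite calkin_pi_mul calkin_pi_sub (finite_rank_pi0 Pf) subr0 mulr1 XE.
move=> x; have [z zE] : exists z, z = x - P x by exists (x - P x).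
have -> : (X * (1 - P)) x = X z by rewrite zE.
have Pz : P z = 0 by rewrite zE raddfB /= (projectionK _ PP) subrr.
have zx : rnorm z <= rnorm x by rewrite zE; exact: projection_compl_le.
have KE : inner z (K z) = (rnorm (X z) ^+ 2 + rnorm (Y z) ^+ 2 - rnorm z ^+ 2)%:C.
  rewrite -[K z]/(star X (X z) + star Y (Y z) - z) innerBr innerDr -!adjointP.
  by rewrite !innerE rmorphB rmorphD.
have : inner z (K z) = inner z (K z - P (K z)).
  by rewrite innerBr -[in X in _ - X]PP.2 -adjointP Pz inner0l subr0.
move=> /(congr1 (@cabs R)); rewrite KE => absE.
have := cauchy_schwarz z (K z - P (K z)); rewrite -absE => le1.
have := le_trans (Re_le_cabs _) le1 => /= le2.
have := KP z; rewrite mul1r => le3.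
have le4 : rnorm z * rnorm (K z - P (K z)) <= rnorm z * rnorm z.
  by rewrite ler_wpM2l ?rnorm_ge0.
have le5 : rnorm z ^+ 2 <= rnorm x ^+ 2 by rewrite ler_pXn2r ?nnegrE ?rnorm_ge0.
rewrite -(@ler_pXn2r _ 2) ?nnegrE ?mulr_ge0 ?rnorm_ge0// exprMn.
have := sqr_ge0 (rnorm (Y z)); have := sqr_ge0 (rnorm x).
rewrite -expr2 in le4; have -> : 2 ^+ 2 = 4 :> R by ring.
lra.
Qed.

Lemma scaled_lift a (eta : R) : 0 < eta -> cnorm a < eta ->
  exists X : bop H, calkin_pi X = phi a /\ forall x, rnorm (X x) <= 4 * eta * rnorm x.
Proof.
move=> eta0 a_lt; have eta2 : 0 < 2 * eta by lra.
have i2 : 0 <= (2 * eta)^-1 by rewrite invr_ge0 ltW.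
have [|X [XE XM]] := @small_lift ((2 * eta)^-1%:C *: a).
  rewrite cnormZE cabs_real// mulrC ler_pdivrMr//.
  have -> : 2^-1 * (2 * eta) = eta by field.
  exact: ltW.
exists ((2 * eta)%:C *: X); split.
  rewrite -[LHS]/(calkin_pi ((2 * eta)%:C *: X)) calkin_piZ.
  rewrite -[calkin_scale _ _]/((2 * eta)%:C *: calkin_pi X) XE (homZ phiP) scalerA.
  by rewrite -rmorphM mulfV ?scale1r// gt_eqF.
move=> x; rewrite /= rnormZ cabs_real; last exact: ltW.
have := XM x; have := rnorm_ge0 x => x0 Xx.
by apply: le_trans (ler_wpM2l (ltW eta2) Xx) _; rewrite mulrA; lra.
Qed.

End OneHom.

(** Both sides are continuous in a: by lifts of small norm, the difference is
    the class of an operator that is a limit of compact ones. *)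
Lemma hom_intertwine (phi psi : O -> calkin H) (j : calkin H) (n : nat) (S : 'I_n -> O) :
  unital_star_hom phi -> unital_star_hom psi ->
  (forall D : set O, star_subalg D -> cnorm_closed D -> (forall i, D (S i)) -> D = setT) ->
  (forall i, j * phi (S i) = psi (S i) * j /\ j * phi (star (S i)) = psi (star (S i)) * j) ->
  forall a, j * phi a = psi a * j.
Proof.
move=> phiP psiP gen jS a.
have [phi1 _ phiM _] := phiP; have [psi1 _ psiM _] := psiP.
pose I b := j * phi b = psi b * j.
have I_lin c b b' : I b -> I b' -> I (c *: b + b').
  rewrite /I => Ib Ib'; rewrite (homD phiP) (homD psiP) (homZ phiP) (homZ psiP).
  by rewrite mulrDr mulrDl -scalerAr -scalerAl Ib Ib'.
have I_mul b b' : I b -> I b' -> I (b * b').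
  by rewrite /I => Ib Ib'; rewrite phiM psiM mulrA Ib -mulrA Ib' mulrA.
have I_closed b : (forall eps : R, 0 < eps -> exists2 b', I b' & cnorm (b - b') < eps) -> I b.
  move=> Ib; apply/eqP; rewrite -subr_eq0; apply/eqP.
  have [Z ZE] : exists Z, calkin_pi Z = j * phi b - psi b * j.
    by exists (repr (j * phi b - psi b * j)); exact: calkin_reprK.
  have [J JE] : exists J, calkin_pi J = j by exists (repr j); exact: calkin_reprK.
  rewrite -ZE -[RHS](raddf0 (@calkin_pi R H)); apply/calkin_eqP; rewrite subr0.
  apply: compact_ops_closed => eps eps0.
  (* a lift of norm at most 4 eta on either side of J, so 8 eta M in total *)
  have [M M0 JM] := bop_bound J; pose eta := eps / (8 * (M + 1)).
  have M8 : 0 < 8 * (M + 1) by lra.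
  have eta0 : 0 < eta by rewrite divr_gt0.
  have [b' Ib' bb'] := Ib _ eta0.
  have [X [XE XM]] := scaled_lift phiP eta0 bb'.
  have [Y [YE YM]] := scaled_lift psiP eta0 bb'.
  exists (Z - (J * X - Y * J)).
    apply/calkin_eqP; rewrite ZE calkin_pi_sub !calkin_pi_mul JE XE YE.
    rewrite (homB phiP) (homB psiP) mulrBr mulrBl Ib'.
    by rewrite opprB addrA subrK.
  move=> x; rewrite opprB addrC subrK.
  apply: le_trans (rnormB (J (X x)) (Y (J x))) _.
  have h1 : rnorm (J (X x)) <= M * (4 * eta * rnorm x).
    by apply: le_trans (JM _) _; rewrite ler_wpM2l.
  have h2 : rnorm (Y (J x)) <= 4 * eta * (M * rnorm x).
    by apply: le_trans (YM _) _; rewrite ler_wpM2l// mulr_ge0// ltW.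
  have h3 : eta * (8 * (M + 1)) = eps by rewrite /eta mulfVK// gt_eqF.
  have h4 : 0 <= eta * rnorm x by rewrite mulr_ge0 ?rnorm_ge0// ltW.
  rewrite -h3; lra.
pose D := [set b | I b /\ I (star b)].
suff : D a by case.
rewrite (gen D) => // [|b bD].
  split=> [|c b b' [Ib Isb] [Ib' Isb']|b b' [Ib Isb] [Ib' Isb']|b [Ib Isb]].
  - by split; rewrite ?cstar1 /I phi1 psi1 mulr1 mul1r.
  - split; first exact: I_lin.
    by rewrite cstarD cstarZE; exact: I_lin.
  - by split; [exact: I_mul|rewrite cstarM; exact: I_mul].
  - by split=> //=; rewrite cstarK.
split; apply: I_closed => eps eps0; have [b' [Ib' Isb'] bb'] := bD eps eps0.
  by exists b'.
by exists (star b') => //; rewrite -cstarB cnorm_starE.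
Qed.

End StarHom.

(** * The classes of the Toeplitz extension *)

Section Cokernels.
Variable N : nat.
Implicit Types (M : 'M[int]_N) (v w : 'cV[int]_N).

Lemma coker_eq M v w : (exists x, v - w = M *m x) ->
  coker_class M v = coker_class M w.
Proof.
move=> vw; have := Quotient.idealrBE (mx_image M) v w.
by rewrite (_ : v - w \in mx_image M) => [/esym/eqP//|]; apply/asboolP.
Qed.

Lemma coker_classB M v w : coker_class M (v - w) = coker_class M v - coker_class M w.
Proof. exact: raddfB. Qed.

Lemma coker_classN M v : coker_class M (- v) = - coker_class M v.
Proof. exact: raddfN. Qed.

(** I - hat A = (I - A) (I - R) where R, the matrix of the first row of ones, kills
    the vectors whose coordinates sum to 0. *)
Lemma hat_mx_sum0 (A : 'M[int]_N) v : \sum_i v i 0 = 0 ->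
  (1%:M - hat_mx A) *m v = (1%:M - A) *m v.
Proof.
move=> v0; have R0 : first_row_ones N *m v = 0.
  apply/matrixP => i j; rewrite !mxE (eq_bigr (fun k => (i == 0 :> nat)%:R * v k 0)).
    by rewrite -mulr_sumr v0 mulr0.
  by move=> k _; rewrite mxE (ord1 j).
rewrite /hat_mx !mulmxBl mulmxDl -mulmxA R0 mulmx0 addr0 subr0.
by [].
Qed.

End Cokernels.

Lemma xget_unique (T : choiceType) (x0 q : T) (P : set T) :
  P !=set0 -> (forall p, P p -> p = q) -> xget x0 P = q.
Proof. by move=> [p Pp] Pq; apply: Pq; exact: xgetI Pp. Qed.

Section ToeplitzExtension.
Variables (R : realType) (N : nat) (A : 'M[int]_N).
Variables (O : cstarAlgType R) (S : 'I_N -> O).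
Variables (H : hilbertType R) (e : seq 'I_N -> H) (T : 'I_N -> bop H).
Variable sigma : extension O H.
Hypotheses (A01 : zero_one A) (OS : is_ck_algebra A S).
Hypotheses (eP : fock_basis A e) (TP : creation_operators A e T).
Hypothesis sigmaP : forall i, sigma (S i) = calkin_pi (T i).

Lemma sigma_star i : sigma (star (S i)) = calkin_pi (star (T i)).
Proof. by have [[_ _ _ ->] _] := extension_mono sigma; rewrite sigmaP star_pi. Qed.

Lemma sigma_range i : sigma (S i * star (S i)) = calkin_pi (T i * star (T i)).
Proof.
by have [[_ _ -> _] _] := extension_mono sigma; rewrite sigmaP sigma_star calkin_pi_mul.
Qed.

(** The representation of O on the Fock space given by V agrees with sigma on the
    range projections.  Modulo compact operators it is faithful: if it kills a
    then so does sigma, by the intertwiners J l, since the sum of the J l ^* J l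
    is 1 minus the vacuum projection. *)
Lemma trivial_extension_exists : (1 < N)%N -> irreducible A ->
  exists tau : extension O H, trivial_extension tau /\
    forall i, tau (S i * star (S i)) = sigma (S i * star (S i)).
Proof.
move=> N_gt1 A_irr; have [sigma_hom sigma_inj] := extension_mono sigma.
(* the first letter serves both as z and as the letter of the empty word *)
pose i0 := Ordinal (ltnW N_gt1); pose z' := Ordinal N_gt1.
have zz' : z' != i0 by [].
have [V [VP VV Vw Vsw]] := ck_family_words A01 A_irr eP i0 zz'.
have [J [JJ JP]] := append_operators A01 A_irr eP i0 i0.
have [_ gen univ] := OS.
have [rho [rho_hom rhoS]] := univ _ _ VP.
have [rho1 rho_lin rhoM rhos] := rho_hom.
have pirho_hom : unital_star_hom (fun a => calkin_pi (rho a)).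
  split=> [|c a b|a b|a]; first by rewrite rho1.
  - by rewrite rho_lin calkin_piD calkin_piZ.
  - by rewrite rhoM calkin_pi_mul.
  - by rewrite rhos star_pi.
have pirho_inj : injective (fun a => calkin_pi (rho a)).
  have ker0 a : calkin_pi (rho a) = 0 -> a = 0.
    move=> rhoa0; apply: sigma_inj; rewrite (hom0 sigma_hom).
    have Ja l : calkin_pi (J l) * sigma a = 0.
      rewrite (hom_intertwine (j := calkin_pi (J l)) sigma_hom pirho_hom gen) ?rhoa0 ?mul0r//.
      move=> i; rewrite rhos rhoS sigmaP sigma_star.
      exact: (JP T V TP Vw Vsw i l).
    rewrite -[LHS]mul1r -[1]/(calkin_pi 1) -JJ calkin_piD ketbra_compact addr0.
    have -> : calkin_pi (\sum_l star (J l) * J l) = \sum_l calkin_pi (star (J l) * J l).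
      exact: (raddf_sum (@calkin_pi R H)).
    rewrite mulr_suml big1// => l _.
    by rewrite calkin_pi_mul -mulrA Ja mulr0.
  move=> a b /eqP; rewrite -subr_eq0 => /eqP ab; apply/eqP; rewrite -subr_eq0.
  by apply/eqP/ker0; rewrite (homB pirho_hom).
have rho_inj : injective rho.
  by move=> a b ab; apply: pirho_inj; rewrite /= ab.
exists (Extension (conj pirho_hom pirho_inj)); split; first by exists rho.
move=> i; rewrite sigma_range /= rhoM rhos rhoS; apply: (calkin_eq_words eP) => w aw w2.
rewrite VV// (creation_range eP TP)//.
by case: w aw w2.
Qed.

(** The representation that lifts tau gives the Cuntz-Krieger family needed for
    the indices of sigma', a conjugate of sigma by u. *)
Lemma index_vector_toeplitz (u : calkin H) (sigma' tau : extension O H) :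
  unitary u -> (forall a, sigma' a = conjugation u (sigma a)) ->
  trivial_extension tau ->
  (forall i, tau (S i * star (S i)) = sigma' (S i * star (S i))) ->
  exists k : 'cV[int]_N,
    index_vector S sigma' tau = - ((1%:M - A) *m k) - const_mx 1 /\
    ((exists2 U : bop H, unitary U & u = calkin_pi U) -> \sum_i k i 0 = 1).
Proof.
move=> uP sigma'E [rho [rho_hom _] tauE] tauP.
have [_ _ rhoM rhos] := rho_hom; have [ckS _ _] := OS.
have VP := ck_family_hom rho_hom A01 ckS.
have TR := creation_relations eP TP.
have EF i : calkin_pi (rho (S i) * star (rho (S i))) =
    u * calkin_pi (T i * star (T i)) * star u.
  by rewrite -rhos -rhoM -tauE tauP sigma'E /conjugation sigma_range.
have [k [kE k1]] := toeplitz_indices A01 VP TR uP EF.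
exists (\col_i k i); split=> [|/k1 <-]; last by apply: eq_bigr => i _; rewrite mxE.
apply/matrixP => i j; rewrite mulmxBl mul1mx !mxE -tauP !tauE rhoM rhos sigma'E /conjugation sigmaP kE.
under [in RHS]eq_bigr do rewrite mxE.
by rewrite opprB addrAC.
Qed.

End ToeplitzExtension.

Theorem theorem4p4 (R : realType) (N : nat) (A : 'M[int]_N)
    (O : cstarAlgType R) (S : 'I_N -> O)
    (H : hilbertType R) (e : seq 'I_N -> H) (T : 'I_N -> bop H)
    (sigma : extension O H)
    (N_gt1 : (1 < N)%N) (A01 : zero_one A) (A_irr : irreducible A)
    (A_nperm : ~~ is_perm_mx A)
    (OS : is_ck_algebra A S)
    (eP : fock_basis A e) (TP : creation_operators A e T)
    (sigmaP : forall i, sigma (S i) = calkin_pi (T i)) :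
  d_s A S (class_s sigma)
    = - iota_hat A 1 - coker_class (1%:M - hat_mx A) (const_mx 1)
  /\ d_w A S (class_w sigma) = - coker_class (1%:M - A) (const_mx 1).
Proof.
have [tau [tau_triv tauP]] :=
  trivial_extension_exists A01 OS eP TP sigmaP N_gt1 A_irr.
have unit1 (B : cstarAlgType R) : unitary (1 : B).
  by rewrite /unitary cstar1 mulr1.
have pi1 : calkin_pi 1 = 1 :> calkin H by [].
split.
- apply: xget_unique => [|_ [sigma' [tau' [[U [UU UU'] sigma'E] tau'_triv tau'P ->]]]].
    exists (coker_class _ (index_vector S sigma tau)), sigma, tau; split=> //.
    exists 1 => [|a]; first exact: (unit1 (bop H)).
    by rewrite /conjugation star_pi bop_star1 pi1 mul1r mulr1.
  have piU : unitary (calkin_pi U).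
    by rewrite /unitary star_pi -!calkin_pi_mul UU UU'.
  have [k [-> k1]] :=
    index_vector_toeplitz A01 OS eP TP sigmaP piU sigma'E tau'_triv tau'P.
  have {}k1 : \sum_i k i 0 = 1 by apply: k1; exists U.
  rewrite /iota_hat -coker_classN -coker_classB.
  have := xgetPex 0 (ex_intro (fun x : 'cV[int]_N => \sum_i x i 0 = 1) k k1).
  set k0 := xget _ _ => k0E.
  apply: coker_eq; exists (k0 - k); rewrite hat_mx_sum0.
    rewrite opprB addrA subrK opprK mulmxBr addrC.
    by [].
  under eq_bigr do rewrite !mxE.
  by rewrite sumrB k0E k1 subrr.
- apply: xget_unique => [|_ [sigma' [tau' [[u uP sigma'E] tau'_triv tau'P ->]]]].
    exists (coker_class _ (index_vector S sigma tau)), sigma, tau; split=> //.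
    exists 1 => [|a].
      by rewrite /unitary -pi1 star_pi bop_star1 mulr1.
    by rewrite /conjugation -pi1 star_pi bop_star1 pi1 mul1r mulr1.
  have [k [-> _]] :=
    index_vector_toeplitz A01 OS eP TP sigmaP uP sigma'E tau'_triv tau'P.
  rewrite -coker_classN; apply: coker_eq; exists (- k).
  by rewrite opprK subrK mulmxN.
Qed.
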